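(* Assume the setting and notation described in the context (in particular, the zero-energy problem (R) has exactly $m\ge 0$ linearly independent solutions and $H$ is the limit operator defined there). Then $H_\varepsilon\to H$ in the norm-resolvent sense as $\varepsilon\to0$; more precisely, for every fixed $\zeta\in\mathbb{C}\setminus\mathbb{R}$ there is a constant $C$ (independent of $\varepsilon$) such that \[ \|(H_\varepsilon-\zeta)^{-1}-(H-\zeta)^{-1}\|_{\mathcal{B}(L^2(\Gamma))}\le C\sqrt{\varepsilon},\qquad \varepsilon\in(0,1]. \]
   Context: Let $\Gamma$ be the star graph consisting of $n$ semi-infinite edges $\gamma_1,\dots,\gamma_n$, each identified with $[0,\infty)$, joined at a common vertex $a$ (corresponding to $s=0$ on each edge). A function $\phi$ on $\Gamma$ is a tuple $(\phi_{\gamma_1},\dots,\phi_{\gamma_n})$ of functions on $[0,\infty)$; $L^2(\Gamma)=\bigoplus_i L^2(0,\infty)$, $H^2(\Gamma)=\bigoplus_i H^2(0,\infty)$ (no matching imposed at $a$), $\phi_{\gamma_i}(a):=\phi_{\gamma_i}(0)$ and $\frac{\mathrm d\phi}{\mathrm d\gamma_i}(a):=\phi_{\gamma_i}'(0)$ (derivative in the direction away from the vertex). $K(\Gamma)$ is the set of functions satisfying the Kirchhoff conditions at $a$: $\phi_{\gamma_1}(a)=\dots=\phi_{\gamma_n}(a)$ and $\sum_{i=1}^n\frac{\mathrm d\phi}{\mathrm d\gamma_i}(a)=0$. Fix $a_1,\dots,a_n>0$ and let $\Omega\subset\Gamma$ be the compact star graph with edges $\omega_i=[0,a_i]\subset\gamma_i$;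 $a_i$ also denotes the endpoint vertex of $\omega_i$, and for a function $\psi$ on $\Omega$, $\psi(a_j)$ is the value of $\psi_{\omega_j}$ at $a_j$ and $\frac{\mathrm d\psi}{\mathrm d\omega_j}(a_j)=\psi_{\omega_j}'(a_j)$. $K(\Omega)$ denotes the Kirchhoff conditions at $a$ together with the Neumann conditions $\psi_{\omega_j}'(a_j)=0$, $j=1,\dots,n$. Let $Q\in L^\infty(\Gamma)$ be real-valued with support contained in $\Omega$. Let $\lambda(\cdot)$ be holomorphic in a neighbourhood of $0$, real-valued for real arguments, with $\lambda(\varepsilon)=1+\varepsilon\lambda+O(\varepsilon^2)$ as $\varepsilon\to0$, where $\lambda\in\mathbb R$. For $\varepsilon\in(0,1]$ let $H_\varepsilon$ be the operator in $L^2(\Gamma)$ acting on each edge as $\phi\mapsto-\phi''+\lambda(\varepsilon)\varepsilon^{-2}Q(x/\varepsilon)\phi$, with domain $H^2(\Gamma)\cap K(\Gamma)$. Problem (R): $-\psi''+Q\psi=0$ on each edge of $\Omega$, $\psi\in H^2(\Omega)\cap K(\Omega)$. Assume (R) has exactly $m\ge0$ linearly independent solutions. After renumbering the edges, one can choose a basis of real-valued solutions $\psi_1,\dots,\psi_m$ with $\psi_i(a_j)=\delta_{ij}$ for $i,j\in\{1,\dots,m\}$. Put $\mathfrak m=\{1,\dots,m\}$ (empty if $m=0$), $\mathfrak n=\{1,\dots,n\}$, $\theta_{ij}:=\psi_i(a_j)$ for $i\in\mathfrak m$, $j\in\mathfrak n\setminus\mathfrak m$, and $q_{ij}:=\int_\Omega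 Q\psi_i\psi_j$ for $i,j\in\mathfrak m$. The limit operator $H$ acts as $H\phi=-\phi''$ on all $\phi\in H^2(\Gamma)$ satisfying \[ \phi_{\gamma_j}(a)-\sum_{i\in\mathfrak m}\theta_{ij}\phi_{\gamma_i}(a)=0,\quad j\in\mathfrak n\setminus\mathfrak m,\qquad \frac{\mathrm d\phi}{\mathrm d\gamma_i}(a)+\sum_{j\in\mathfrak n\setminus\mathfrak m}\theta_{ij}\frac{\mathrm d\phi}{\mathrm d\gamma_j}(a)-\lambda\sum_{j\in\mathfrak m}q_{ij}\phi_{\gamma_j}(a)=0,\quad i\in\mathfrak m. \] *)

(* Defs.v *)
From HB Require Import structures.
From mathcomp Require Import all_boot all_order all_algebra.
From mathcomp Require Import all_classical all_reals all_analysis.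
From mathcomp Require Import complex.
Set Implicit Arguments. Unset Strict Implicit. Unset Printing Implicit Defensive.
Import Order.TTheory GRing.Theory Num.Theory.
Import numFieldNormedType.Exports.
Local Open Scope classical_set_scope.
Local Open Scope ring_scope.

Section StarGraph.
Variable R : realType.
Notation mu := (@lebesgue_measure R).

Definition L2R (D : set R) (g : R -> R) : Prop :=
  measurable_fun D g /\ mu.-integrable D (fun x => ((g x) ^+ 2)%:E).

Definition L2C (D : set R) (g : R -> R[i]) : Prop :=
  L2R D (fun x => complex.Re (g x)) /\ L2R D (fun x => complex.Im (g x)).

(* u in H^2 on D (D = [0,b] or [0,+oo)), with u1 = u' (continuous
   representative) and u2 = u'' (a.e. second derivative) :
   u, u1 absolutely continuous with u' = u1, u1' = u2, and u,u1,u2 in L^2(D). *)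
Definition H2R (D : set R) (u u1 u2 : R -> R) : Prop :=
  D 0 /\ L2R D u /\ L2R D u1 /\ L2R D u2 /\
  (forall x, D x ->
     mu.-integrable `[0, x] (fun t => (u1 t)%:E) /\
     mu.-integrable `[0, x] (fun t => (u2 t)%:E) /\
     u x = u 0 + Rintegral mu `[0, x] u1 /\
     u1 x = u1 0 + Rintegral mu `[0, x] u2).

Definition H2C (D : set R) (u u1 u2 : R -> R[i]) : Prop :=
  H2R D (fun x => complex.Re (u x)) (fun x => complex.Re (u1 x)) (fun x => complex.Re (u2 x)) /\
  H2R D (fun x => complex.Im (u x)) (fun x => complex.Im (u1 x)) (fun x => complex.Im (u2 x)).

Definition toC (r : R) : R[i] := Complex r 0.

Definition halfline : set R := `[0, +oo[%classic.

Definition L2sq (n : nat) (u : 'I_n -> R -> R[i]) : R :=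
  \sum_(i < n) fine (\int[mu]_(x in halfline)
                       ((complex.Re (u i x)) ^+ 2 + (complex.Im (u i x)) ^+ 2)%:E).

Definition L2norm (n : nat) (u : 'I_n -> R -> R[i]) : R := Num.sqrt (L2sq u).

Definition L2Gamma (n : nat) (f : 'I_n -> R -> R[i]) : Prop :=
  forall i, L2C halfline (f i).

Definition potential_ok (n : nat) (a : 'I_n -> R) (Q : 'I_n -> R -> R) : Prop :=
  (forall i, measurable_fun halfline (Q i)) /\
  (exists M : R, forall i x, 0 <= x -> `|Q i x| <= M) /\
  (forall i x, a i < x -> Q i x = 0).

Definition solR (n : nat) (a : 'I_n -> R) (Q : 'I_n -> R -> R)
    (psi : 'I_n -> R -> R) : Prop :=
  exists d1 d2 : 'I_n -> R -> R,
    (forall j, H2R `[0, a j]%classic (psi j) (d1 j) (d2 j)) /\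
    (forall j, {ae mu, forall x, `[0, a j]%classic x ->
                  - d2 j x + Q j x * psi j x = 0}) /\
    (forall i j, psi i 0 = psi j 0) /\
    (\sum_(j < n) d1 j 0 = 0) /\
    (forall j, d1 j (a j) = 0).

Definition coupling_ok (lamf : R -> R) (lam1 : R) : Prop :=
  (exists r : R, 0 < r /\ exists c : nat -> R, forall x, `|x| < r ->
      (fun N => \sum_(0 <= k < N) c k * x ^+ k) @ \oo --> lamf x) /\
  (exists K delta : R, 0 < delta /\ forall e, `|e| < delta ->
      `|lamf e - 1 - e * lam1| <= K * e ^+ 2).

Definition Heps_solves (n : nat) (Q : 'I_n -> R -> R) (lamf : R -> R) (eps : R)
    (zeta : R[i]) (u f : 'I_n -> R -> R[i]) : Prop :=
  exists u1 u2 : 'I_n -> R -> R[i],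
    (forall i, H2C halfline (u i) (u1 i) (u2 i)) /\
    (forall i j, u i 0 = u j 0) /\
    (\sum_(i < n) u1 i 0 = 0) /\
    (forall i, {ae mu, forall x, halfline x ->
       - u2 i x + toC ((lamf eps / eps ^+ 2) * Q i (x / eps)) * u i x
         - zeta * u i x = f i x}).

Definition theta (n m : nat) (a : 'I_n -> R) (psi : 'I_m -> 'I_n -> R -> R)
    (i : 'I_m) (j : 'I_n) : R := psi i j (a j).

Definition qcoef (n m : nat) (a : 'I_n -> R) (Q : 'I_n -> R -> R)
    (psi : 'I_m -> 'I_n -> R -> R) (i k : 'I_m) : R :=
  \sum_(j < n) Rintegral mu `[0, a j]%classic
                 (fun x => Q j x * psi i j x * psi k j x).

(* u is in dom(H) and (H - zeta) u = f.  The edges sigma i (i < m) play the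
   role of the edges 1..m after renumbering; the other edges are
   the set n \ m. *)
Definition H_solves (n m : nat) (a : 'I_n -> R) (Q : 'I_n -> R -> R)
    (lam1 : R) (psi : 'I_m -> 'I_n -> R -> R) (sigma : 'I_m -> 'I_n)
    (zeta : R[i]) (u f : 'I_n -> R -> R[i]) : Prop :=
  exists u1 u2 : 'I_n -> R -> R[i],
    (forall i, H2C halfline (u i) (u1 i) (u2 i)) /\
    (forall j, j \notin codom sigma ->
       u j 0 - \sum_(i < m) toC (theta a psi i j) * u (sigma i) 0 = 0) /\
    (forall i : 'I_m,
       u1 (sigma i) 0
       + \sum_(j < n | j \notin codom sigma) toC (theta a psi i j) * u1 j 0
       - toC lam1 * \sum_(k < m) toC (qcoef a Q psi i k) * u (sigma k) 0 = 0) /\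
    (forall i, {ae mu, forall x, halfline x ->
       - u2 i x - zeta * u i x = f i x}).

End StarGraph.

(* Main.v *)
Require Import Defs.
From HB Require Import structures.
From mathcomp Require Import all_boot all_order all_algebra.
From mathcomp Require Import all_classical all_reals all_analysis.
From mathcomp Require Import measurable_realfun complex ring lra.
Set Implicit Arguments. Unset Strict Implicit. Unset Printing Implicit Defensive.
Import Order.TTheory GRing.Theory Num.Theory.
Import numFieldNormedType.Exports.
Local Open Scope classical_set_scope.
Local Open Scope ring_scope.

(* Write W = u - v for the difference of the two resolvents applied to f.  The
   scaled potential lives on the segments [0, eps a_j]; rescaling them to Omega,
   the solution u solves the zero-energy Neumann problem up to an error
   O(eps), hence is O(eps)-close to the combination of zero modes with the same
   values at the ends a_sigma(i).  The values of u at eps a_j therefore satisfy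
   the first group of limit conditions up to O(eps).  Green's formula against
   psi_i, in which Q is weighted by lambda(eps) - 1 = eps lambda + O(eps^2) and
   whose right-hand side f contributes O(sqrt eps) by Cauchy-Schwarz, yields the
   second group up to O(sqrt eps).  As v varies by O(sqrt eps) on [0, eps a_j],
   W satisfies the limit conditions at the points eps a_j up to O(sqrt eps),
   and it solves the free equation beyond them.  The boundary form of the
   self-adjoint limit conditions is then O(sqrt eps) times the boundary values
   of W, which a trace estimate bounds by the L^2 norm of W outside, so the
   imaginary part of the energy identity gives |W| = O(sqrt eps).  On the short
   segments themselves u and v are bounded, so W is O(sqrt eps) there too. *)

(** The scaled potential has size eps^-2, so no uniform estimate can use it in the original
    variable. The values at eps a_j are bounded from the outside, where the equation is free, and
    only then carried inwards in the rescaled variable, where the potential is bounded. The rate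
    sqrt eps comes from a source that is merely square-integrable: its integral over a segment of
    length O(eps) is O(sqrt eps). The expansion of lambda holds near 0 only, so the comparison is
    made for small eps; for the other eps the a priori bound 1/|Im zeta| on both resolvents is
    enough. Existence of the resolvents is part of the claim and is obtained without spectral
    theory. The energy identity gives uniqueness for all self-adjoint vertex conditions, and
    uniqueness gives existence by a dimension count: the unknowns are the Cauchy data at the vertex,
    the equations are the vertex conditions and the absence of growth at infinity. The vertex
    conditions have real coefficients, so complex functions are split into real and imaginary
    parts. *)

(* Locked, so that [ring] and [lra] do not unfold integrals while comparing
   atoms. *)
HB.lock Definition Int {R : realType} (D : set R) (f : R -> R) : R :=
  Rintegral (@lebesgue_measure R) D f.

(** * Integrable functions and their integrals over intervals *)

Section Integrals.
Context {R : realType}.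
Notation mu := (@lebesgue_measure R).
Implicit Types (f g h u v : R -> R) (c d x y k M : R) (D E : set R).

Definition L1 D f := mu.-integrable D (EFin \o f).

Lemma L1_measurable D f : L1 D f -> measurable_fun D f.
Proof. by move=> /integrableP[/measurable_EFinP]. Qed.

Lemma L1_sub D E f : measurable D -> measurable E -> E `<=` D -> L1 D f -> L1 E f.
Proof. by move=> mD mE ED; exact: integrableS. Qed.

Lemma L1_ext D f g : measurable D -> (forall x, D x -> f x = g x) -> L1 D f -> L1 D g.
Proof.
move=> mD fg; apply: eq_integrable => // x; rewrite inE => Dx /=.
by rewrite fg.
Qed.

Lemma L1D D f g : measurable D -> L1 D f -> L1 D g -> L1 D (fun x => f x + g x).
Proof. by move=> mD; exact: integrableD. Qed.

Lemma L1B D f g : measurable D -> L1 D f -> L1 D g -> L1 D (fun x => f x - g x).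
Proof. by move=> mD; exact: integrableB. Qed.

Lemma L1Z D k f : measurable D -> L1 D f -> L1 D (fun x => k * f x).
Proof. by move=> mD; exact: integrableZl. Qed.

Lemma L1_sum (I : finType) D (F : I -> R -> R) : measurable D ->
  (forall i, L1 D (F i)) -> L1 D (fun x => \sum_i F i x).
Proof.
move=> mD h; rewrite /L1.
rewrite [X in mu.-integrable _ X](_ : _ = (fun x => (\sum_(i <- index_enum I) (F i x)%:E)%E)).
  by apply: integrable_sum => // i _; exact: h.
by apply/funext => x /=; rewrite sumEFin.
Qed.

Lemma L1_norm D f : measurable D -> L1 D f -> L1 D (fun x => `|f x|).
Proof. by move=> mD; exact: integrable_norm. Qed.

Lemma L1_le D f g : measurable D -> measurable_fun D f ->
  (forall x, D x -> `|f x| <= g x) -> L1 D g -> L1 D f.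
Proof.
move=> mD mf fg; apply: le_integrable => //; first exact/measurable_EFinP.
by move=> x Dx /=; rewrite lee_fin (le_trans (fg _ Dx))// ler_norm.
Qed.

Lemma L1_Mbdd D f h M : measurable D -> measurable_fun D h ->
  (forall x, D x -> `|h x| <= M) -> L1 D f -> L1 D (fun x => h x * f x).
Proof.
move=> mD mh hM Lf; apply: (@L1_le _ _ (fun x => M * `|f x|)) => //.
- by apply: measurable_funM => //; exact: L1_measurable.
- by move=> x Dx; rewrite normrM ler_wpM2r ?hM.
- by apply: L1Z => //; exact: L1_norm.
Qed.

Lemma L1_cst c d k : L1 `[c, d]%classic (fun=> k).
Proof.
apply: measurable_bounded_integrable => //.
  have /= -> := @lebesgue_measure_itv R `[c, d].
  by case: ifPn => //= _; rewrite -EFinB ltry.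
exists `|k|; split; first exact: num_real.
by move=> x kx y _; exact: ltW.
Qed.

Lemma L1_bdd c d f M : measurable_fun `[c, d]%classic f ->
  (forall x, c <= x <= d -> `|f x| <= M) -> L1 `[c, d]%classic f.
Proof.
by move=> mf fM; apply: (@L1_le _ _ (fun=> M)) => //; exact: L1_cst.
Qed.

Lemma IntE D f : Int D f = Rintegral mu D f.
Proof. by rewrite unlock. Qed.

Lemma Ri_ext D f g : (forall x, D x -> f x = g x) ->
  Int D f = Int D g.
Proof. by rewrite !IntE => fg; apply: eq_Rintegral => x; rewrite inE; exact: fg. Qed.

Lemma RiD D f g : measurable D -> L1 D f -> L1 D g ->
  Int D (fun x => f x + g x) = Int D f + Int D g.
Proof. by move=> mD Lf Lg; rewrite !IntE RintegralD. Qed.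

Lemma RiB D f g : measurable D -> L1 D f -> L1 D g ->
  Int D (fun x => f x - g x) = Int D f - Int D g.
Proof. by move=> mD Lf Lg; rewrite !IntE RintegralB. Qed.

Lemma RiZ D k f : measurable D -> L1 D f ->
  Int D (fun x => k * f x) = k * Int D f.
Proof. by move=> mD Lf; rewrite !IntE RintegralZl. Qed.

Lemma RiN D f : measurable D -> L1 D f ->
  Int D (fun x => - f x) = - Int D f.
Proof.
move=> mD Lf; rewrite -mulN1r -RiZ//.
by apply: Ri_ext => x _; rewrite mulN1r.
Qed.

Lemma Ri_sum (I : finType) D (F : I -> R -> R) : measurable D ->
  (forall i, L1 D (F i)) ->
  Int D (fun x => \sum_i F i x) = \sum_i Int D (F i).
Proof.
move=> mD h; elim: (index_enum I) => [|i s IH].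
  rewrite big_nil -[RHS](mul0r (fine (mu D))) -Rintegral_cst// -IntE.
  by apply: Ri_ext => x _; rewrite big_nil.
rewrite big_cons -IH -RiD//.
  by apply: Ri_ext => x _; rewrite big_cons.
elim: s {IH} => [|j s IH].
  by apply: (@L1_ext _ (fun x => 0 * F i x)) => // [x _|]; rewrite ?big_nil ?mul0r//; exact: L1Z.
by apply: (@L1_ext _ (fun x => F j x + \sum_(i <- s) F i x)) => // [x _|]; rewrite ?big_cons//; exact: L1D.
Qed.

Lemma Ri_le D f g : measurable D -> L1 D f -> L1 D g ->
  (forall x, D x -> f x <= g x) -> Int D f <= Int D g.
Proof. by move=> mD Lf Lg fg; rewrite !IntE; exact: le_Rintegral. Qed.

Lemma Ri_norm_le D f g : measurable D -> L1 D f -> L1 D g ->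
  (forall x, D x -> `|f x| <= g x) -> `|Int D f| <= Int D g.
Proof.
move=> mD Lf Lg fg; apply: (@le_trans _ _ (Int D (fun x => `|f x|))).
  by rewrite !IntE; exact: le_normr_Rintegral.
by apply: Ri_le => //; exact: L1_norm.
Qed.

Lemma Ri_cst c d k : c <= d -> Int `[c, d]%classic (fun=> k) = k * (d - c).
Proof.
move=> cd; rewrite IntE Rintegral_cst//.
have /= -> := @lebesgue_measure_itv R `[c, d].
rewrite lte_fin; case: ltP => //= dc.
have -> : d = c by apply/eqP; rewrite eq_le cd dc.
by rewrite subrr.
Qed.

Lemma Ri_pt c f : Int `[c, c]%classic f = 0.
Proof. by rewrite IntE set_itv1 Rintegral_set1. Qed.

Lemma itv_sub c d x y : c <= x -> y <= d -> `[x, y]%classic `<=` `[c, d]%classic.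
Proof.
move=> cx yd t /=; rewrite !in_itv/= => /andP[xt ty].
by rewrite (le_trans cx xt) (le_trans ty yd).
Qed.

Lemma L1_itv c d x y f : c <= x -> y <= d -> L1 `[c, d]%classic f -> L1 `[x, y]%classic f.
Proof. by move=> cx yd; apply: L1_sub => //; exact: itv_sub. Qed.

Lemma itv_suby c x y : c <= x -> `[x, y]%classic `<=` `[c, +oo[%classic.
Proof. by move=> cx t /=; rewrite !in_itv/= andbT => /andP[xt _]; exact: le_trans xt. Qed.

Lemma itvy_suby c x : c <= x -> `[x, +oo[%classic `<=` `[c, +oo[%classic.
Proof. by move=> cx t /=; rewrite !in_itv/= !andbT; exact: le_trans. Qed.

Lemma L1_itvy c x y f : c <= x -> L1 `[c, +oo[%classic f -> L1 `[x, y]%classic f.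
Proof. by move=> cx; apply: L1_sub => //; exact: itv_suby. Qed.

Lemma L1_itvyy c x f : c <= x -> L1 `[c, +oo[%classic f -> L1 `[x, +oo[%classic f.
Proof. by move=> cx; apply: L1_sub => //; exact: itvy_suby. Qed.

Lemma Ri_cat c x d f : c <= x <= d -> L1 `[c, d]%classic f ->
  Int `[c, d]%classic f =
  Int `[c, x]%classic f + Int `[x, d]%classic f.
Proof.
move=> /andP[cx xd] Lf; rewrite !IntE; have := Rintegral_itvB Lf _ _ => /(_ x).
rewrite !bnd_simp => /(_ cx xd) /eqP; rewrite subr_eq => /eqP ->.
rewrite addrC Rintegral_itv_obnd_cbnd//.
apply: L1_sub Lf => // t /=; rewrite !in_itv/= => /andP[xt ->].
by rewrite andbT (le_trans cx)// ltW.
Qed.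

Lemma Ri_caty c x f : c <= x -> L1 `[c, +oo[%classic f ->
  Int `[c, +oo[%classic f =
  Int `[c, x]%classic f + Int `[x, +oo[%classic f.
Proof.
move=> cx Lf; rewrite !IntE; have := Rintegral_itvB Lf _ _ => /(_ x).
rewrite !bnd_simp => /(_ cx isT) /eqP; rewrite subr_eq => /eqP ->.
rewrite addrC Rintegral_itv_obnd_cbnd//.
apply: L1_sub Lf => // t /=; rewrite !in_itv/= !andbT => xt.
by rewrite (le_trans cx)// ltW.
Qed.

Lemma Ri_ge0 D f : (forall x, D x -> 0 <= f x) -> 0 <= Int D f.
Proof. by move=> f0; rewrite IntE fine_ge0// integral_ge0// => x Dx; rewrite lee_fin f0. Qed.

Lemma Ri_le_sub D E f : measurable D -> measurable E -> E `<=` D ->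
  L1 D f -> (forall x, D x -> 0 <= f x) -> Int E f <= Int D f.
Proof.
move=> mD mE ED Lf f0; rewrite !IntE /Rintegral fine_le//.
- by apply: integrable_fin_num => //; exact: L1_sub Lf.
- exact: integrable_fin_num.
- apply: ge0_subset_integral => //.
  by apply/measurable_EFinP; exact: L1_measurable.
Qed.

End Integrals.

(** * Absolutely continuous functions and the product rule *)

Section AbsolutelyContinuous.
Context {R : realType}.
Notation mu := (@lebesgue_measure R).
Implicit Types (f g h u v m : R -> R) (c d x y k M : R).

(** Absolute continuity is encoded by the integral formula, not by differentiability almost
    everywhere: this is the form that [H2R] provides, and [u'] is then a chosen representative. For
    [d < c] it holds trivially. *)
Definition AC c d u u' := L1 `[c, d]%classic u' /\
  forall x, c <= x <= d -> u x = u c + Int `[c, x]%classic u'.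

Lemma AC_diff c d x y u u' : AC c d u u' -> c <= x -> x <= y -> y <= d ->
  u y - u x = Int `[x, y]%classic u'.
Proof.
move=> [Lu uE] cx xy yd.
rewrite (uE y) ?(le_trans cx xy)// (uE x) ?cx ?(le_trans xy yd)//.
rewrite (@Ri_cat _ c x y) ?cx//; last exact: L1_itv Lu.
by ring.
Qed.

Lemma AC_sub c d x y u u' : c <= x -> y <= d -> AC c d u u' -> AC x y u u'.
Proof.
move=> cx yd ACu; split; first by case: ACu => Lu _; exact: L1_itv Lu.
move=> t /andP[xt ty]; by rewrite -(AC_diff ACu cx xt (le_trans ty yd)); ring.
Qed.

Lemma AC_ext c d u u' v v' : (forall x, c <= x <= d -> u x = v x) ->
  (forall x, c <= x <= d -> u' x = v' x) -> AC c d u u' -> AC c d v v'.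
Proof.
move=> uv uv' [Lu uE]; split; first exact: L1_ext Lu.
move=> x cxd; have /andP[cx xd] := cxd.
rewrite -!uv ?lexx ?(le_trans cx xd)// uE//; congr (_ + _); apply: Ri_ext => t /=.
by rewrite in_itv/= => /andP[ct tx]; apply: uv'; rewrite ct (le_trans tx xd).
Qed.

Lemma AC_cont c d u u' : c <= d -> AC c d u u' -> {within `[c, d]%classic, continuous u}.
Proof.
move=> cd [Lu uE].
have cI : {within `[c, d]%classic, continuous (fun x => Int `[c, x]%classic u')}.
  rewrite (_ : (fun x => _) = (parameterized_integral mu c)^~ u').
    exact: parameterized_integral_continuous.
  by apply/funext => x; rewrite IntE.
have : {within `[c, d]%classic, continuous (fun x => u c + Int `[c, x]%classic u')}.
  move=> x; apply: (@cvgD _ _ _ (nbhs (x : subspace `[c, d]%classic))).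
    exact: cvg_cst.
  exact: cI.
apply: subspace_eq_continuous => x; rewrite inE/= in_itv/= => xcd.
by rewrite /from_subspace (uE x).
Qed.

Lemma AC_measurable c d u u' : AC c d u u' -> measurable_fun `[c, d]%classic u.
Proof.
move=> ACu; have [cd|dc] := leP c d.
  by apply: subspace_continuous_measurable_fun => //; exact: AC_cont ACu.
rewrite set_itv_ge ?bnd_simp -?ltNge//; exact: measurable_fun_set0.
Qed.

Lemma AC_diff_bdd c d x y u u' : AC c d u u' -> c <= x <= d -> c <= y <= d ->
  `|u y - u x| <= Int `[c, d]%classic (fun t => `|u' t|).
Proof.
move=> ACu; have [Lu _] := ACu; have := L1_norm (measurable_itv `[c, d]) Lu => Lnu.
wlog xy : x y / x <= y => [hw xcd ycd|/andP[cx xd] /andP[cy yd]].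
  by case: (lerP x y) => [|/ltW] xy; [|rewrite distrC]; exact: hw.
rewrite (AC_diff ACu cx xy yd); apply: (@le_trans _ _ (Int `[x, y]%classic (fun t => `|u' t|))).
  by apply: Ri_norm_le => //; [exact: L1_itv Lu|exact: L1_itv Lnu].
by apply: Ri_le_sub => //; exact: itv_sub.
Qed.

Lemma AC_bdd c d x u u' : AC c d u u' -> c <= x <= d ->
  `|u x| <= `|u c| + Int `[c, d]%classic (fun t => `|u' t|).
Proof.
move=> ACu /[dup] xcd /andP[cx xd]; have cd := le_trans cx xd.
rewrite -{1}(subrK (u c) (u x)) addrC (le_trans (ler_normD _ _))// lerD2l.
by rewrite (AC_diff_bdd ACu)// lexx.
Qed.

Lemma AC_L1 c d u u' : AC c d u u' -> L1 `[c, d]%classic u.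
Proof.
by move=> ACu; apply: L1_bdd => [|x]; [exact: AC_measurable ACu | exact: AC_bdd ACu].
Qed.

Lemma AC_L1M c d u u' f : AC c d u u' -> L1 `[c, d]%classic f ->
  L1 `[c, d]%classic (fun x => u x * f x).
Proof.
move=> ACu Lf; apply: (@L1_Mbdd _ _ _ _ (`|u c| + Int `[c, d]%classic (fun t => `|u' t|))) => //.
  exact: AC_measurable ACu.
by move=> x /=; rewrite in_itv/=; exact: AC_bdd.
Qed.

Lemma AC_L1Mr c d u u' f : AC c d u u' -> L1 `[c, d]%classic f ->
  L1 `[c, d]%classic (fun x => f x * u x).
Proof.
move=> ACu Lf; apply: L1_ext (AC_L1M ACu Lf) => // x _; exact: mulrC.
Qed.

Lemma AC_cst c d k : AC c d (fun=> k) (fun=> 0).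
Proof.
split; first exact: L1_cst.
by move=> x /andP[cx _]; rewrite Ri_cst// mul0r addr0.
Qed.

Lemma AC_D c d u u' v v' : AC c d u u' -> AC c d v v' ->
  AC c d (fun x => u x + v x) (fun x => u' x + v' x).
Proof.
move=> [Lu uE] [Lv vE]; split; first exact: L1D.
move=> x /[dup] xcd /andP[cx xd]; rewrite uE// vE// addrACA RiD//.
  exact: L1_itv Lu.
exact: L1_itv Lv.
Qed.

Lemma AC_Z c d k u u' : AC c d u u' -> AC c d (fun x => k * u x) (fun x => k * u' x).
Proof.
move=> [Lu uE]; split; first exact: L1Z.
move=> x /[dup] xcd /andP[cx xd]; rewrite uE// mulrDr RiZ//.
exact: L1_itv Lu.
Qed.

Lemma AC_N c d u u' : AC c d u u' -> AC c d (fun x => - u x) (fun x => - u' x).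
Proof. by move=> /(AC_Z (-1)); apply: AC_ext => x _; rewrite mulN1r. Qed.

Lemma AC_B c d u u' v v' : AC c d u u' -> AC c d v v' ->
  AC c d (fun x => u x - v x) (fun x => u' x - v' x).
Proof. by move=> ACu /AC_N; exact: AC_D. Qed.

Lemma AC_sum (I : finType) c d (u u' : I -> R -> R) : (forall i, AC c d (u i) (u' i)) ->
  AC c d (fun x => \sum_i u i x) (fun x => \sum_i u' i x).
Proof.
move=> h; split; first by apply: L1_sum => // i; case: (h i).
move=> x /[dup] xcd /andP[cx xd]; rewrite Ri_sum//.
  by rewrite -big_split/=; apply: eq_bigr => i _; case: (h i) => _ ->.
by move=> i; case: (h i) => Li _; exact: L1_itv Li.
Qed.

Lemma le_geometric0 x M : (forall n, x <= M / 2 ^+ n) -> x <= 0.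
Proof.
move=> h; rewrite leNgt; apply/negP => x0.
have M0 : 0 < M by apply: lt_le_trans x0 _; have := h 0%N; rewrite expr0 divr1.
have /= := archi_boundP (ltW (divr_gt0 M0 x0)); set n := Num.bound _ => Mn.
have := h n; rewrite leNgt => /negP; apply.
rewrite ltr_pdivrMr ?exprn_gt0// mulrC -ltr_pdivrMr//.
apply: lt_trans Mn _; rewrite -natrX ltr_nat; exact: ltn_expl.
Qed.

(* Bisection at the midpoint of the values of m halves the bound, so the
   increment of F is 0. *)
Lemma sqr_increment_cst (F : R -> R) m c d : c <= d ->
  {within `[c, d]%classic, continuous m} ->
  (forall x y, c <= x -> x <= y -> y <= d -> m x <= m y) ->
  (forall x y, c <= x -> x <= y -> y <= d -> `|F y - F x| <= (m y - m x) ^+ 2) ->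
  F d = F c.
Proof.
move=> cd cm mm Fm.
have H n : forall x y, c <= x -> x <= y -> y <= d ->
    `|F y - F x| <= (m y - m x) ^+ 2 / 2 ^+ n.
  elim: n => [|n IH] x y cx xy yd; first by rewrite expr0 divr1 Fm.
  have mxy := mm _ _ cx xy yd.
  have cm' : {within `[x, y]%classic, continuous m}.
    by apply: continuous_subspaceW cm; exact: itv_sub.
  have mid : Num.min (m x) (m y) <= (m x + m y) / 2 <= Num.max (m x) (m y).
    by rewrite min_l// max_r//; lra.
  have [z] := IVT xy cm' mid.
  rewrite in_itv/= => /andP[xz zy] mz.
  have h1 := IH x z cx xz (le_trans zy yd).
  have h2 := IH z y (le_trans cx xz) zy yd.
  rewrite (_ : F y - F x = (F y - F z) + (F z - F x)); last by ring.
  apply: (le_trans (ler_normD _ _)); apply: (le_trans (lerD h2 h1)).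
  rewrite mz [2 ^+ n.+1]exprS; have p0 : (2 : R) ^+ n != 0 by rewrite expf_neq0.
  by rewrite le_eqVlt; apply/orP; left; apply/eqP; field.
apply/eqP; rewrite -subr_eq0 -normr_le0.
by apply: (@le_geometric0 _ ((m d - m c) ^+ 2)) => n; exact: H.
Qed.

(** Needs neither Fubini nor differentiation almost everywhere. The defect [F] of the product
    formula changes over [x, y] by at most the square of the change of [m], the indefinite integral
    of |u'| + |v'|, and such a function is constant by [sqr_increment_cst]. *)
Lemma AC_M c d u u' v v' : AC c d u u' -> AC c d v v' ->
  AC c d (fun x => u x * v x) (fun x => u' x * v x + u x * v' x).
Proof.
move=> ACu ACv; have [Lu uE] := ACu; have [Lv vE] := ACv.
have L1' : L1 `[c, d]%classic (fun x => u' x * v x + u x * v' x).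
  apply: L1D => //; last exact: AC_L1M ACu Lv.
  exact: AC_L1Mr ACv Lu.
split => // x0 /andP[cx0 x0d].
pose m x := Int `[c, x]%classic (fun t => `|u' t| + `|v' t|).
have Lm : L1 `[c, d]%classic (fun t => `|u' t| + `|v' t|).
  by apply: L1D => //; exact: L1_norm.
have mE x y : c <= x -> x <= y -> y <= d ->
    m y - m x = Int `[x, y]%classic (fun t => `|u' t| + `|v' t|).
  move=> cx xy yd; rewrite /m (@Ri_cat _ c x y) ?cx//; last exact: L1_itv Lm.
  by rewrite addrAC subrr add0r.
pose F x := u x * v x - Int `[c, x]%classic (fun x => u' x * v x + u x * v' x).
suff : F x0 = F c.
  rewrite /F Ri_pt subr0 => <-; by rewrite subrK.
have cd := le_trans cx0 x0d.
apply: (@sqr_increment_cst _ m) => //.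
- apply: (@AC_cont _ _ _ (fun t => `|u' t| + `|v' t|)) => //.
  split; first exact: L1_itv Lm.
  by move=> x _; rewrite /m Ri_pt add0r.
- move=> x y cx xy /le_trans/(_ x0d) yd; rewrite -subr_ge0 mE//.
  by apply: Ri_ge0 => t _; rewrite addr_ge0.
move=> x y cx xy /le_trans/(_ x0d) yd.
have Lu2 : L1 `[x, y]%classic u' by exact: L1_itv Lu.
have Lv2 : L1 `[x, y]%classic v' by exact: L1_itv Lv.
have ACu2 : AC x y u u' by exact: AC_sub ACu.
have ACv2 : AC x y v v' by exact: AC_sub ACv.
(* The splitting u(y)v(y) - u(x)v(x) = (u(y) - u(x)) v(y) + u(x) (v(y) - v(x)) leaves under the
   integral only products of an increment and a derivative, which is what makes the bound
   quadratic. *)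
have -> : F y - F x = Int `[x, y]%classic
    (fun t => (v y - v t) * u' t + (u x - u t) * v' t).
  rewrite /F (@Ri_cat _ c x y) ?cx//; last exact: L1_itv L1'.
  transitivity ((u y - u x) * v y + u x * (v y - v x) -
     Int `[x, y]%classic (fun x => u' x * v x + u x * v' x)); first by ring.
  rewrite (AC_diff ACu)// (AC_diff ACv)// mulrC -!RiZ// -RiD//; try exact: L1Z.
  rewrite -RiB//; first by apply: Ri_ext => t _; ring.
    by apply: L1D => //; exact: L1Z.
  exact: L1_itv L1'.
have key t : x <= t <= y -> `|v y - v t| <= m y - m x /\ `|u x - u t| <= m y - m x.
  move=> xty; rewrite mE//; split.
    apply: (le_trans (AC_diff_bdd ACv2 xty _)); first by rewrite xy lexx.
    apply: Ri_le => // [||s _]; [exact: L1_norm|exact: L1_itv Lm|by rewrite lerDr].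
  apply: (le_trans (AC_diff_bdd ACu2 xty _)); first by rewrite xy lexx.
  apply: Ri_le => // [||s _]; [exact: L1_norm|exact: L1_itv Lm|by rewrite lerDl].
rewrite expr2 {2}mE// -RiZ//; last exact: L1_itv Lm.
apply: Ri_norm_le => //.
- apply: L1D => //; apply: AC_L1M => //.
    by apply: AC_B ACv2; exact: AC_cst.
  by apply: AC_B ACu2; exact: AC_cst.
- by apply: L1Z => //; exact: L1_itv Lm.
move=> t /=; rewrite in_itv/= => /key[k1 k2].
rewrite (le_trans (ler_normD _ _))// !normrM mulrDr lerD// ler_wpM2r//.
Qed.

Lemma AC_C1 c d u u' : (forall x, is_derive x 1 u (u' x)) -> continuous u' -> AC c d u u'.
Proof.
move=> du cu'.
have cu : continuous u.
  by move=> x; apply: differentiable_continuous; apply/derivable1_diffP; have [] := du x.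
have Lu' : L1 `[c, d]%classic u'.
  have [cd|dc] := leP c d; last first.
    by rewrite set_itv_ge ?bnd_simp -?ltNge//; exact: integrable_set0.
  apply: continuous_compact_integrable; first exact: segment_compact.
  exact: continuous_subspaceT.
split=> // x /andP[cx xd]; move: cx; rewrite le_eqVlt => /predU1P[<-|cx].
  by rewrite Ri_pt addr0.
rewrite IntE /Rintegral (@continuous_FTC2 _ u' u)//.
- by rewrite -EFinB /= addrC subrK.
- exact: continuous_subspaceT.
- split; first by move=> y _; have [] := du y.
    by apply: cvg_at_right_filter; exact: cu.
  by apply: cvg_at_left_filter; exact: cu.
- by move=> y _; rewrite derive1E; have [_ ->] := du y.
Qed.

End AbsolutelyContinuous.

(** * Square-integrable functions and the Cauchy-Schwarz inequality *)

Section SquareIntegrable.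
Context {R : realType}.
Notation mu := (@lebesgue_measure R).
Implicit Types (f g h u v m : R -> R) (c d x y k M : R) (D : set R).

Lemma L2_L1 D f : L2R D f -> L1 D (fun x => f x ^+ 2).
Proof. by case. Qed.

Lemma L2_sub D E f : measurable D -> measurable E -> E `<=` D -> L2R D f -> L2R E f.
Proof.
move=> mD mE ED [mf Lf]; split; first exact: measurable_funS mf.
exact: (L1_sub mD).
Qed.

Lemma L2_ext D f g : measurable D -> (forall x, D x -> f x = g x) -> L2R D f -> L2R D g.
Proof.
move=> mD fg [mf Lf]; split.
  by apply: eq_measurable_fun mf => x; rewrite inE; exact: fg.
by apply: L1_ext Lf => // x Dx; rewrite fg.
Qed.

Lemma L2_le D f g : measurable D -> measurable_fun D f ->
  (forall x, D x -> f x ^+ 2 <= g x) -> L1 D g -> L2R D f.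
Proof.
move=> mD mf fg Lg; split=> //; apply: L1_le Lg => //.
  exact: measurable_funX.
by move=> x Dx; rewrite ger0_norm ?sqr_ge0 ?fg.
Qed.

Lemma L2_M D f g : measurable D -> L2R D f -> L2R D g -> L1 D (fun x => f x * g x).
Proof.
move=> mD [mf Lf] [mg Lg].
apply: (@L1_le _ _ _ (fun x => f x ^+ 2 + g x ^+ 2)) => //; last exact: L1D.
  exact: measurable_funM.
move=> x _; rewrite ler_norml; apply/andP; split.
  by have := sqr_ge0 (f x + g x); have := sqr_ge0 (f x); have := sqr_ge0 (g x); lra.
by have := sqr_ge0 (f x - g x); have := sqr_ge0 (f x); have := sqr_ge0 (g x); lra.
Qed.

Lemma L2_D D f g : measurable D -> L2R D f -> L2R D g -> L2R D (fun x => f x + g x).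
Proof.
move=> mD [mf Lf] [mg Lg].
apply: (@L2_le _ _ (fun x => 2 * (f x ^+ 2) + 2 * (g x ^+ 2))) => //.
- exact: measurable_funD.
- by move=> x _; have := sqr_ge0 (f x - g x); lra.
- by apply: L1D => //; exact: L1Z.
Qed.

Lemma L2_Mbdd D f h M : measurable D -> measurable_fun D h ->
  (forall x, D x -> `|h x| <= M) -> L2R D f -> L2R D (fun x => h x * f x).
Proof.
move=> mD mh hM [mf Lf].
apply: (@L2_le _ _ (fun x => M ^+ 2 * (f x ^+ 2))) => //.
- exact: measurable_funM.
- move=> x Dx; rewrite exprMn ler_wpM2r ?sqr_ge0//.
  by have := hM x Dx; rewrite ler_norml => /andP[]; nra.
- exact: L1Z.
Qed.

Lemma L2_Z D k f : measurable D -> L2R D f -> L2R D (fun x => k * f x).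
Proof. by move=> mD; apply: (@L2_Mbdd _ _ _ `|k|). Qed.

Lemma L2_N D f : measurable D -> L2R D f -> L2R D (fun x => - f x).
Proof. by move=> mD /(L2_Z (-1) mD); apply: L2_ext => // x _; rewrite mulN1r. Qed.

Lemma L2_B D f g : measurable D -> L2R D f -> L2R D g -> L2R D (fun x => f x - g x).
Proof. by move=> mD Lf /(L2_N mD); exact: L2_D. Qed.

Lemma L2_integrable c d f : L2R `[c, d]%classic f -> L1 `[c, d]%classic f.
Proof.
move=> [mf Lf]; apply: (@L1_le _ _ _ (fun x => 1 + f x ^+ 2)) => //.
  move=> x _; rewrite -[X in _ + X](real_normK (num_real _)).
  by have := sqr_ge0 (`|f x| - 1); have := normr_ge0 (f x); nra.
by apply: L1D => //; exact: L1_cst.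
Qed.

Lemma AC_L2 c d u u' : AC c d u u' -> L2R `[c, d]%classic u.
Proof.
move=> ACu; apply: (@L2_le _ _ (fun x => u x * u x)) => //.
- exact: AC_measurable ACu.
- exact: AC_L1M ACu (AC_L1 ACu).
Qed.

Lemma L2_itvy c x y f : c <= x -> L2R `[c, +oo[%classic f -> L2R `[x, y]%classic f.
Proof. by move=> cx; apply: L2_sub => //; exact: itv_suby. Qed.

Lemma cauchy_schwarz D f g : measurable D -> L2R D f -> L2R D g ->
  (Int D (fun x => f x * g x)) ^+ 2 <=
  Int D (fun x => f x ^+ 2) * Int D (fun x => g x ^+ 2).
Proof.
move=> mD Lf Lg; have Lfg := L2_M mD Lf Lg.
have Lf2 := L2_L1 Lf; have Lg2 := L2_L1 Lg.
set A := Int D (fun x => f x ^+ 2); set B := Int D (fun x => f x * g x).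
set C := Int D (fun x => g x ^+ 2).
have A0 : 0 <= A by apply: Ri_ge0 => x _; exact: sqr_ge0.
have C0 : 0 <= C by apply: Ri_ge0 => x _; exact: sqr_ge0.
(* The quadratic form is tested at (C, -B), where it equals C (A C - B^2), and for C = 0 at (B, -(A
   + 1)/2), where it equals -B^2. *)
have key s t : 0 <= s ^+ 2 * A + 2 * s * t * B + t ^+ 2 * C.
  rewrite -!RiZ// -RiD ?(L1Z)// -RiD//; last 2 first.
    by apply: L1D => //; exact: L1Z.
    exact: L1Z.
  apply: Ri_ge0 => x _; rewrite (_ : _ + _ = (s * f x + t * g x) ^+ 2) ?sqr_ge0//.
  by ring.
move: A0 C0 key; move: A B C => A B C A0 C0 key.
have [C0'|Cn0] := eqVneq C 0; first rewrite C0' in key *.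
  by rewrite mulr0; have := key B (- (A + 1) / 2); lra.
have Cp : 0 < C by rewrite lt_neqAle eq_sym Cn0.
rewrite -subr_ge0 -(pmulr_rge0 _ Cp); have := key C (- B); lra.
Qed.

End SquareIntegrable.

(** * Integrals over half-lines and behaviour at infinity *)

Section HalfLine.
Context {R : realType}.
Notation mu := (@lebesgue_measure R).
Implicit Types (f g h u v w m : R -> R) (b c d x y k M e : R) (D : set R).

Lemma cvg_Int_halfline b f : measurable_fun `[b, +oo[%classic f ->
  (forall x, b <= x -> 0 <= f x) ->
  (\int[mu]_(x in `[b, (b + n%:R)%R]%classic) (f x)%:E)%E @[n --> \oo] -->
  (\int[mu]_(x in `[b, +oo[%classic) (f x)%:E)%E.
Proof.
move=> mf f0; rewrite itv_bndy_bigcup_BRight.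
apply: ge0_nondecreasing_set_cvg_integral => //.
- move=> p q pq; apply/subsetPset; apply: itv_sub => //.
  by rewrite lerD2l ler_nat.
- move=> n; apply/measurable_EFinP; apply: measurable_funS mf => //.
  exact: itv_suby.
- by move=> n x /=; rewrite in_itv/= => /andP[bx _]; rewrite lee_fin f0.
Qed.

(** Monotone convergence along the truncations [b, b + n]. *)
Lemma L1_halfline b f M : measurable_fun `[b, +oo[%classic f ->
  (forall x, b <= x -> 0 <= f x) ->
  (forall x, b <= x -> L1 `[b, x]%classic f) ->
  (forall x, b <= x -> Int `[b, x]%classic f <= M) ->
  L1 `[b, +oo[%classic f /\ Int `[b, +oo[%classic f <= M.
Proof.
move=> mf f0 Lf fM.
have fE n : (\int[mu]_(x in `[b, (b + n%:R)%R]%classic) (f x)%:E)%E =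
    (Int `[b, b + n%:R]%classic f)%:E.
  by rewrite IntE /Rintegral fineK//; apply: integrable_fin_num => //; apply: Lf; rewrite lerDl.
have le : (\int[mu]_(x in `[b, +oo[%classic) (f x)%:E <= M%:E)%E.
  apply: (cvge_le _ (cvg_Int_halfline mf f0)).
  by apply: nearW => n; rewrite fE lee_fin fM// lerDl.
have ge : (0 <= \int[mu]_(x in `[b, +oo[%classic) (f x)%:E)%E.
  by apply: integral_ge0 => x /=; rewrite in_itv/= andbT => bx; rewrite lee_fin f0.
have Lfb : L1 `[b, +oo[%classic f.
  apply/integrableP; split; first exact/measurable_EFinP.
  apply: le_lt_trans (ltry M); apply: le_trans le.
  rewrite le_eqVlt; apply/orP; left; apply/eqP; apply: eq_integral => x.
  by rewrite inE/= in_itv/= andbT => bx; rewrite ger0_norm ?f0.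
split=> //; rewrite IntE /Rintegral -lee_fin fineK//.
exact: integrable_fin_num.
Qed.

Lemma Int_tail b f e : L1 `[b, +oo[%classic f -> 0 < e ->
  exists2 x, b <= x & Int `[x, +oo[%classic (fun t => `|f t|) < e.
Proof.
move=> Lf e0; have Lnf := L1_norm (measurable_itv `[b, +oo[) Lf.
(* If every tail were at least [e], all truncated integrals would be at most [T - e], and
   [L1_halfline] would give T <= T - e. *)
apply: contrapT => H.
set T := Int `[b, +oo[%classic (fun t => `|f t|).
have [||||_] := @L1_halfline b (fun t => `|f t|) (T - e) => //.
- exact: L1_measurable Lnf.
- by move=> x _; exact: L1_itvy Lnf.
- move=> x bx; rewrite /T (Ri_caty bx Lnf).
  rewrite -addrA lerDl subr_ge0 leNgt; apply/negP => xe; apply: H.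
  by exists x.
by rewrite -/T; lra.
Qed.

(** Integrability of w' gives w a limit at infinity, and integrability of w forces this limit to be
    0. In the proof [l] is the absolute value of the limit. *)
Lemma Int_halfline_derivative b w w' :
  (forall x, b <= x -> AC b x w w') ->
  L1 `[b, +oo[%classic w -> L1 `[b, +oo[%classic w' ->
  Int `[b, +oo[%classic w' = - w b.
Proof.
move=> ACw Lw Lw'.
set I := Int `[b, +oo[%classic w'; apply/eqP; rewrite -addr_eq0; apply/negPn/negP => n0.
set l := `|I + w b|; have l0 : 0 < l by rewrite normr_gt0.
have [||x0 bx0 tx0] := @Int_tail b w' (l / 2) => //; first by rewrite divr_gt0.
have Lnw' := L1_norm (measurable_itv `[b, +oo[) Lw'.
have Lnw := L1_norm (measurable_itv `[b, +oo[) Lw.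
have wl x : x0 <= x -> l / 2 <= `|w x|.
  move=> x0x; have bx := le_trans bx0 x0x.
  have wx : w x = I + w b - Int `[x, +oo[%classic w'.
    rewrite /I (Ri_caty bx Lw') -(AC_diff (ACw _ bx))//; by ring.
  have : `|Int `[x, +oo[%classic w'| <= l / 2.
    apply: (@le_trans _ _ (Int `[x, +oo[%classic (fun t => `|w' t|))).
      by apply: Ri_norm_le => //; [exact: L1_itvyy Lw'|exact: L1_itvyy Lnw'].
    apply/ltW; apply: le_lt_trans tx0; apply: Ri_le_sub => //; first exact: itvy_suby.
    exact: L1_itvyy Lnw'.
  have := ler_normB (I + w b - Int `[x, +oo[%classic w') (- Int `[x, +oo[%classic w').
  rewrite opprK subrK -wx normrN -/l; lra.
set T := Int `[b, +oo[%classic (fun t => `|w t|).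
have T0 : 0 <= T by apply: Ri_ge0 => t _.
(* The length is chosen so that [l / 2] integrates to T + l/2 over the interval, more than the whole
   integral T of |w|. *)
have x1 : x0 <= x0 + (2 / l * T + 1).
  by rewrite lerDl addr_ge0// mulr_ge0// divr_ge0// ltW.
have : Int `[x0, x0 + (2 / l * T + 1)]%classic (fun=> l / 2) <= T.
  apply: (@le_trans _ _ (Int `[x0, x0 + (2 / l * T + 1)]%classic (fun t => `|w t|))).
    apply: Ri_le => //; first exact: L1_cst.
      exact: L1_itvy Lnw.
    by move=> t /=; rewrite in_itv/= => /andP[xt _]; exact: wl.
  by apply: Ri_le_sub => //; exact: itv_suby.
rewrite Ri_cst// addrAC subrr add0r mulrDr mulr1 mulrA.
rewrite (_ : l / 2 * (2 / l) = 1); last by field; rewrite lt0r_neq0.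
by lra.
Qed.

(** Replaces a second derivative known only almost everywhere by the expression that the
    differential equation prescribes for it. *)
Lemma AC_ae c d u u' v : AC c d u u' -> measurable_fun `[c, d]%classic v ->
  {ae mu, forall x, `[c, d]%classic x -> u' x = v x} -> AC c d u v.
Proof.
move=> [Lu uE] mv uv.
have mu' := L1_measurable Lu.
have Lv : L1 `[c, d]%classic v.
  apply/integrableP; split; first exact/measurable_EFinP.
  have /integrableP[_] := Lu; rewrite (@ae_eq_integral _ _ _ mu _ (fun x => (`|(v x)%:E|)%E))//.
  - by apply/measurable_EFinP; apply: measurableT_comp.
  - by apply/measurable_EFinP; apply: measurableT_comp.
  - exact: (@ae_eq_comp _ _ _ mu _ _ _ (fun y : R => (`|y%:E|)%E) _ _ uv).
split=> // x /andP[cx xd]; rewrite uE ?cx//; congr (_ + _).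
have sub : `[c, x]%classic `<=` `[c, d]%classic by exact: itv_sub.
rewrite !IntE /Rintegral; congr fine; apply: ae_eq_integral => //.
- by apply/measurable_EFinP; apply: measurable_funS mu'.
- by apply/measurable_EFinP; apply: measurable_funS mv.
- by apply: ae_eq_comp; exact: ae_eq_subset uv.
Qed.

Lemma AC_id c d : AC c d id (fun=> 1 : R).
Proof.
split; first exact: L1_cst.
by move=> x /andP[cx _]; rewrite Ri_cst// mul1r addrC subrK.
Qed.

End HalfLine.

(** * Dilations of Lebesgue measure, and the trace estimate *)

Section ScalingAndTraces.
Context {R : realType}.
Notation mu := (@lebesgue_measure R).
Implicit Types (f g h u v w m : R -> R) (b c d x y k M e : R) (D : set R).

Lemma ae_imply (P Q : R -> Prop) : (forall x, P x -> Q x) ->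
  {ae mu, forall x, P x} -> {ae mu, forall x, Q x}.
Proof. by move=> PQ; apply: negligibleS; apply: subsetC => x /=; exact: PQ. Qed.

Lemma measurable_scale e : measurable_fun setT ( *%R e : measurableTypeR R -> measurableTypeR R).
Proof. by apply: measurable_funM => //; exact: measurable_cst. Qed.

Lemma preimage_scale_itv e (e0 : 0 < e) (a1 a2 : bool) c d :
  *%R e @^-1` [set` Interval (BSide a1 (e * c)) (BSide a2 (e * d))] =
  [set` Interval (BSide a1 c) (BSide a2 d)].
Proof.
apply/seteqP; split=> x /=; rewrite !in_itv/=;
  by case: a1; case: a2; rewrite /= ?ler_pM2l ?ltr_pM2l.
Qed.

(** By uniqueness of Lebesgue measure it suffices to compare both sides on half-open intervals. *)
Lemma lebesgue_measure_scale e (e0 : 0 < e) (A : set R) : measurable A ->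
  mu A = (e%:E * pushforward mu ( *%R e : R -> measurableTypeR R) A)%E.
Proof.
move=> mA.
have /(_ (measurable_scale e)) := @lebesgue_measure_unique R
  (mscale (NngNum (ltW e0)) (pushforward mu ( *%R e : measurableTypeR R -> measurableTypeR R))).
apply => // _ [[a b]] _ <-.
rewrite /mscale/= /pushforward.
have en0 : e != 0 by rewrite lt0r_neq0.
have [c ->] : exists c, a = e * c by exists (e^-1 * a); rewrite mulVKf.
have [d ->] : exists d, b = e * d by exists (e^-1 * b); rewrite mulVKf.
have /= -> := @lebesgue_measure_itv R `]e * c, e * d].
rewrite [RHS](_ : _ = (e%:E * mu ( *%R e @^-1` `](e * c)%R, (e * d)%R]%classic))%E)// preimage_scale_itv//.
have /= -> := @lebesgue_measure_itv R `]c, d].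
rewrite !lte_fin ltr_pM2l//; case: ifP => _; last by rewrite mule0.
by rewrite -!EFinB -EFinM mulrBr.
Qed.

Lemma ge0_integral_scale e D (f : R -> \bar R) : 0 < e -> measurable D ->
  measurable_fun D f -> (forall x, D x -> (0 <= f x)%E) ->
  (\int[mu]_(x in D) f x = e%:E * \int[mu]_(x in *%R e @^-1` D) f (e * x)%R)%E.
Proof.
move=> e0 mD mf f0.
have /= H := @ge0_integral_pushforward _ _ _ _ R ( *%R e : measurableTypeR R -> measurableTypeR R) (measurable_scale e) mu D f mD mf.
rewrite -H; last by move=> y; rewrite inE; exact: f0.
have /(_ (measurable_scale e)) /= <- := @ge0_integral_mscale _ _ R
  (pushforward mu ( *%R e : measurableTypeR R -> measurableTypeR R)) D mD (NngNum (ltW e0)) f mf f0.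
by apply: eq_measure_integral => A mA AD; exact: lebesgue_measure_scale.
Qed.

Lemma Int_scale e c d f : 0 < e -> L1 `[e * c, e * d]%classic f ->
  L1 `[c, d]%classic (fun x => f (e * x)) /\
  Int `[e * c, e * d]%classic f = e * Int `[c, d]%classic (fun x => f (e * x)).
Proof.
move=> e0 Lf.
have S (g : R -> \bar R) : measurable_fun `[e * c, e * d]%classic g ->
    (forall x, `[e * c, e * d]%classic x -> (0 <= g x)%E) ->
    (\int[mu]_(x in `[(e * c)%R, (e * d)%R]%classic) g x = e%:E * \int[mu]_(x in `[c, d]%classic) g (e * x)%R)%E.
  by move=> mg g0; rewrite (ge0_integral_scale e0)// preimage_scale_itv.
have mf := L1_measurable Lf.
have mfe : measurable_fun `[c, d]%classic (fun x => f (e * x)).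
  apply: (@measurable_comp _ _ _ _ _ _ `[e * c, e * d]%classic _ _ ( *%R e)) => //.
  by rewrite -(preimage_scale_itv e0); exact: image_preimage_subset.
have Le : L1 `[c, d]%classic (fun x => f (e * x)).
  apply/integrableP; split; first exact/measurable_EFinP.
  have /integrableP[_] := Lf; rewrite S//; last first.
    by apply/measurable_EFinP; apply: measurableT_comp.
  (* An infinite value would stay infinite after multiplication by [e > 0], against the finiteness
     of the original integral. *)
  have : (0 <= \int[mu]_(x in `[c, d]%classic) `|(f (e * x))%:E|)%E by exact: integral_ge0.
  rewrite /=; case: (\int[mu]_(x in `[c, d]%classic) _)%E => [r _ _||//]; first exact: ltry.
  by rewrite gt0_muley ?lte_fin.
split=> //.
have E1 : (\int[mu]_(x in `[(e * c)%R, (e * d)%R]%classic) (f x)%:E =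
    e%:E * \int[mu]_(x in `[c, d]%classic) (f (e * x)%R)%:E)%E.
  rewrite [LHS]integralE [X in (_ * X)%E]integralE muleBr//; last exact: integrable_add_def.
  rewrite !S//.
  - by congr (_ * _ - _ * _)%E; apply: eq_integral => x _; rewrite ?funeposE ?funenegE.
  - by apply: measurable_funeneg; exact/measurable_EFinP.
  - by apply: measurable_funepos; exact/measurable_EFinP.
by rewrite !IntE /Rintegral E1 fineM//; exact: integrable_fin_num.
Qed.

Lemma AC_scale e c d u u' : 0 < e -> AC (e * c) (e * d) u u' ->
  AC c d (fun x => u (e * x)) (fun x => e * u' (e * x)).
Proof.
move=> e0 [Lu uE]; have [Ls _] := Int_scale e0 Lu; split; first exact: L1Z.
move=> x /andP[cx xd]; rewrite uE ?ler_pM2l ?cx//.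
have [|L2s ->] := @Int_scale e c x u' e0.
  by apply: L1_itv Lu => //; rewrite ler_pM2l.
by rewrite RiZ.
Qed.

Lemma Int_sqr_unit x f : L2R `[x, x + 1]%classic f ->
  (Int `[x, x + 1]%classic f) ^+ 2 <= Int `[x, x + 1]%classic (fun t => f t ^+ 2).
Proof.
move=> Lf; have xx1 : x <= x + 1 by rewrite lerDl.
have := @cauchy_schwarz _ `[x, x + 1]%classic (fun=> 1) f (measurable_itv _) (AC_L2 (AC_cst _ _ _)) Lf.
rewrite [X in _ <= X * _ -> _](_ : _ = 1).
  by rewrite mul1r; under Ri_ext do rewrite mul1r.
rewrite (@Ri_ext _ _ _ (fun=> 1)) => [|t _]; last by rewrite expr1n.
by rewrite Ri_cst// mul1r addrAC subrr add0r.
Qed.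

(* Green's formula against a quadratic-cubic test function k that vanishes to
   second order at x + 1. *)
Lemma trace_test x u u1 u2 (k k1 k2 : R -> R) :
  AC x (x + 1) u u1 -> AC x (x + 1) u1 u2 -> L2R `[x, x + 1]%classic u2 ->
  AC x (x + 1) k k1 -> AC x (x + 1) k1 k2 -> L2R `[x, x + 1]%classic k2 ->
  k (x + 1) = 0 -> k1 (x + 1) = 0 ->
  (forall t, x <= t <= x + 1 -> `|k t| <= 6 /\ `|k2 t| <= 6) ->
  (u1 x * k x - u x * k1 x) ^+ 2 <=
  72 * Int `[x, x + 1]%classic (fun t => u t ^+ 2 + u2 t ^+ 2).
Proof.
move=> ACu ACu1 Lu2 ACk ACk1 Lk2 ke k1e kb.
have xx1 : x <= x + 1 by rewrite lerDl.
have ACw := AC_B (AC_M ACu1 ACk) (AC_M ACu ACk1).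
have := AC_diff ACw (lexx _) xx1 (lexx _); rewrite ke k1e !mulr0 subrr sub0r => E.
have {}E : u1 x * k x - u x * k1 x = - Int `[x, x + 1]%classic (fun t => u2 t * k t - u t * k2 t).
  rewrite -[LHS]opprK E; congr (- _); apply: Ri_ext => t _; ring.
have Lu := AC_L2 ACu; have Lk := AC_L2 ACk.
rewrite E sqrrN.
have mk f : L2R `[x, x+1]%classic f -> measurable_fun `[x, x+1]%classic f by case.
have L2w : L2R `[x, x + 1]%classic (fun t => u2 t * k t - u t * k2 t).
  apply: L2_B => //.
    apply: L2_ext (_ : L2R _ (fun t => k t * u2 t)) => // [t _|]; first exact: mulrC.
    apply: (@L2_Mbdd _ _ _ _ 6) => //; first exact: mk.
    by move=> t /=; rewrite in_itv/= => /kb[].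
  apply: L2_ext (_ : L2R _ (fun t => k2 t * u t)) => // [t _|]; first exact: mulrC.
  apply: (@L2_Mbdd _ _ _ _ 6) => //; first exact: mk.
  by move=> t /=; rewrite in_itv/= => /kb[].
apply: (le_trans (Int_sqr_unit L2w)); rewrite -RiZ//; last first.
  by apply: L1D => //; exact: L2_L1.
apply: Ri_le => //; first exact: L2_L1.
  by apply: L1Z => //; apply: L1D => //; exact: L2_L1.
move=> t /=; rewrite in_itv/= => /kb[]; rewrite !ler_norml => /andP[a1 a2] /andP[b1 b2].
have h1 : (u2 t * k t) ^+ 2 <= 36 * u2 t ^+ 2.
  by rewrite exprMn mulrC ler_wpM2r ?sqr_ge0//; nra.
have h2 : (u t * k2 t) ^+ 2 <= 36 * u t ^+ 2.
  by rewrite exprMn mulrC ler_wpM2r ?sqr_ge0//; nra.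
have := sqr_ge0 (u2 t * k t + u t * k2 t); lra.
Qed.

Lemma trace_bound x u u1 u2 :
  AC x (x + 1) u u1 -> AC x (x + 1) u1 u2 -> L2R `[x, x + 1]%classic u2 ->
  u x ^+ 2 + u1 x ^+ 2 <= 144 * Int `[x, x + 1]%classic (fun t => u t ^+ 2 + u2 t ^+ 2).
Proof.
move=> ACu ACu1 Lu2.
have ACs : AC x (x + 1) (fun t => t - x) (fun=> 1).
  by apply: AC_ext (AC_B (AC_id _ _) (AC_cst _ _ x)) => t _ //; rewrite subr0.
have ACr : AC x (x + 1) (fun t => 1 - (t - x)) (fun=> -1).
  by apply: AC_ext (AC_B (AC_cst _ _ 1) ACs) => t _ //; rewrite sub0r.
have ACp := AC_M ACs ACr.
(* [k] and [l] are the cubic Hermite polynomials at x in s = t - x: k = 0, k' = 1 and l = 1, l' = 0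
   at s = 0, both with a double zero at s = 1. Tested against them, Green's formula isolates -u(x)
   and u1(x). Their second derivatives are bounded by 6, whence 72 = 2 * 36 for each and 144 in
   all. *)
pose k t : R := (t - x) * (1 - (t - x)) ^+ 2.
pose k' t : R := (1 - (t - x)) ^+ 2 - 2 * (t - x) * (1 - (t - x)).
pose k'' t : R := 6 * (t - x) - 4.
pose l t : R := (1 - (t - x)) ^+ 2 * (1 + 2 * (t - x)).
pose l' t : R := - 6 * ((t - x) * (1 - (t - x))).
pose l'' t : R := - 6 * (1 - 2 * (t - x)).
have ACk : AC x (x + 1) k k'.
  by apply: AC_ext (AC_M ACs (AC_M ACr ACr)) => t _; rewrite /k /k'; ring.
have ACk' : AC x (x + 1) k' k''.
  apply: AC_ext (AC_B (AC_M ACr ACr) (AC_Z 2 ACp)) => t _; rewrite /k' /k''; ring.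
have ACk'' : AC x (x + 1) k'' (fun=> 6).
  by apply: AC_ext (AC_B (AC_Z 6 ACs) (AC_cst _ _ 4)) => t _; rewrite /k''; ring.
have ACl : AC x (x + 1) l l'.
  apply: AC_ext (AC_M (AC_M ACr ACr) (AC_D (AC_cst _ _ 1) (AC_Z 2 ACs))) => t _; rewrite /l /l'; ring.
have ACl' : AC x (x + 1) l' l''.
  by apply: AC_ext (AC_Z (- 6) ACp) => t _; rewrite /l' /l''; ring.
have ACl'' : AC x (x + 1) l'' (fun=> 12).
  by apply: AC_ext (AC_Z (-6) (AC_B (AC_cst _ _ 1) (AC_Z 2 ACs))) => t _; rewrite /l''; ring.
have [] := (@trace_test x u u1 u2 k k' k'' ACu ACu1 Lu2 ACk ACk' (AC_L2 ACk''),
            @trace_test x u u1 u2 l l' l'' ACu ACu1 Lu2 ACl ACl' (AC_L2 ACl'')).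
have E1 : x + 1 - x = 1 by ring.
rewrite /k /k' /k'' /l /l' /l'' !E1 !subrr !(mulr0, mul0r, addr0, subr0, expr1n, expr0n, mul1r, mulr1)/=.
move=> /(_ erefl erefl) h1 /(_ erefl erefl) h2.
have bnd t : x <= t <= x + 1 -> exists2 s, t - x = s & 0 <= s <= 1.
  by move=> /andP[xt tx]; exists (t - x) => //; lra.
have {}h1 := h1 _; have {}h2 := h2 _.
have : (- u x) ^+ 2 <= 72 * Int `[x, x + 1]%classic (fun t => u t ^+ 2 + u2 t ^+ 2).
  rewrite -sub0r; apply: h1 => t /bnd[s -> /andP[s0 s1]].
  rewrite !ler_norml; split; apply/andP; split; nra.
have : u1 x ^+ 2 <= 72 * Int `[x, x + 1]%classic (fun t => u t ^+ 2 + u2 t ^+ 2).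
  apply: h2 => t /bnd[s -> /andP[s0 s1]].
  rewrite !ler_norml; split; apply/andP; split; nra.
by rewrite sqrrN; lra.
Qed.

End ScalingAndTraces.

(** * Global solutions of Lipschitz systems by Picard iteration *)

Section Picard.
Context {R : realType}.
Notation mu := (@lebesgue_measure R).
Implicit Types (f g h u v w : R -> R) (b c d x k M e : R) (D : set R).

Lemma le0_geometric x M : (forall n, `|x| <= M / 2 ^+ n) -> x = 0.
Proof. by move=> h; apply/eqP; rewrite -normr_le0; exact: le_geometric0 h. Qed.

Lemma dyadic_cauchy_cvg (a : nat -> R) c :
  (forall n, `|a n.+1 - a n| <= c / 2 ^+ n) ->
  exists2 l, a @ \oo --> l & forall n, `|a n - l| <= 2 * c / 2 ^+ n.
Proof.
move=> ac.
have step n m : `|a (n + m)%N - a n| <= 2 * c / 2 ^+ n - 2 * c / 2 ^+ (n + m).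
  elim: m => [|m IH]; first by rewrite addn0 !subrr normr0.
  rewrite addnS; have := ac (n + m)%N => h.
  rewrite (_ : a _ - a n = (a (n + m).+1 - a (n + m)%N) + (a (n + m)%N - a n)); last by ring.
  apply: (le_trans (ler_normD _ _)); apply: (le_trans (lerD h IH)).
  rewrite exprS; have p0 : (2 : R) ^+ (n + m) != 0 by rewrite expf_neq0.
  rewrite le_eqVlt; apply/orP; left; apply/eqP; field.
  by rewrite !expf_neq0.
have c0 : 0 <= c by have := le_trans (normr_ge0 _) (ac 0%N); rewrite expr0 divr1.
have geo : (fun n => 2 * c / 2 ^+ n) @ \oo --> (0 : R).
  have h : `|2^-1 : R| < 1 by rewrite ger0_norm ?invr_ge0// invf_lt1// ltr1n.
  have := cvg_geometric (2 * c) h.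
  by rewrite (_ : geometric _ _ = (fun n => 2 * c / 2 ^+ n))//; apply/funext => n /=; rewrite exprVn.
(* Subtracting the bound on the remaining variation makes the sequence nondecreasing; the subtracted
   term tends to 0, so [a] has the same limit. *)
have cb : cvgn (fun n => a n - 2 * c / 2 ^+ n).
  apply: nondecreasing_is_cvgn.
    apply/nondecreasing_seqP => n; have := step n 1%N; rewrite addn1 ler_norml => /andP[]; lra.
  exists (a 0%N + 2 * c) => _ [n _ <-].
  have := step 0%N n; rewrite add0n expr0 divr1 ler_norml => /andP[_].
  have : 0 <= 2 * c / 2 ^+ n by rewrite divr_ge0 ?mulr_ge0// exprn_ge0.
  lra.
have [l al] : exists l : R, (a @ \oo --> l).
  exists (limn (fun n => a n - 2 * c / 2 ^+ n) + 0).
  rewrite [X in X @ _](_ : a = (fun n => (a n - 2 * c / 2 ^+ n) + 2 * c / 2 ^+ n)).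
    exact: cvgD cb geo.
  by apply/funext => n; rewrite subrK.
exists l => // n; have bd m : (n <= m)%N -> `|a m - a n| <= 2 * c / 2 ^+ n.
  move=> nm; apply: le_trans (_ : _ <= 2 * c / 2 ^+ n - 2 * c / 2 ^+ m) _.
    by have := step n (m - n)%N; rewrite subnKC.
  by rewrite lerBlDr lerDl divr_ge0 ?mulr_ge0// exprn_ge0.
rewrite ler_norml; apply/andP; split.
  rewrite lerBrDl -lerBrDr opprK; apply: cvgr_to_le al _.
  by exists n => // m /= /bd; rewrite ler_norml => /andP[]; lra.
rewrite lerBlDr -lerBlDl; apply: cvgr_to_ge al _.
by exists n => // m /= /bd; rewrite ler_norml => /andP[]; lra.
Qed.

Lemma is_derive_scale k x : is_derive x 1 ( *%R k) k.
Proof.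
have := @is_deriveZ R R R id k x 1 1 _.
by rewrite /GRing.scale/= mulr1; apply; exact: is_derive_id.
Qed.

Lemma is_derive_comp_scale (F : R -> R) f k x : is_derive (k * x) 1 F (f (k * x)) ->
  is_derive x 1 (fun t => F (k * t)) (k * f (k * x)).
Proof.
move=> dF; have := @is_derive1_comp R F ( *%R k) x _ _ dF (is_derive_scale k x).
by rewrite mulrC.
Qed.

Lemma continuous_scale k : continuous ( *%R k : R -> R).
Proof. by move=> x; apply: cvgM; [exact: cvg_cst|exact: cvg_id]. Qed.

Lemma Int_expR k x : 0 < k -> 0 <= x ->
  L1 `[0, x]%classic (fun t => expR (k * t)) /\
  k * Int `[0, x]%classic (fun t => expR (k * t)) <= expR (k * x).
Proof.
move=> k0 x0.
have AE : AC 0 x (fun t => expR (k * t)) (fun t => k * expR (k * t)).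
  apply: AC_C1 => [t|t].
    exact: is_derive_comp_scale.
  apply: cvgM; first exact: cvg_cst.
  by apply: continuous_comp; [exact: continuous_scale|exact: continuous_expR].
split; first exact: AC_L1 AE.
rewrite -RiZ//; last exact: AC_L1 AE.
rewrite -(AC_diff AE)//.
by rewrite lerBlDr lerDl expR_ge0.
Qed.

(** The field is Lipschitz in y uniformly in t, but only integrable in t. Measuring the distance of
    successive iterates against the weight exp(K t) makes one iteration converge on every [0, x], so
    that no local solutions have to be glued. *)
Lemma picard (I : finType) (B : (I -> R) -> R -> I -> R) (y0 : I -> R) M :
  0 <= M ->
  (forall y z (t : R) i, 0 <= t -> `|B y t i - B z t i| <= M * \sum_j `|y j - z j|) ->
  (forall (y : I -> R -> R) x, 0 <= x ->
     (forall i, measurable_fun `[0, x]%classic (y i)) ->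
     (forall i, exists k : R, forall t : R, 0 <= t <= x -> `|y i t| <= k) ->
     forall i, L1 `[0, x]%classic (fun t => B (fun j => y j t) t i)) ->
  exists y : I -> R -> R, (forall i, y i 0 = y0 i) /\
    forall i x, 0 <= x -> AC 0 x (y i) (fun t => B (fun j => y j t) t i).
Proof.
move=> M0 Blip BL.
pose Y := fix Y n : I -> R -> R := if n is n'.+1 then
  fun i x => y0 i + Int `[0, x]%classic (fun t => B (fun j => Y n' j t) t i)
  else fun i _ => y0 i.
have AY n : exists Y', forall i x, 0 <= x -> AC 0 x (Y n i) (Y' i).
  elim: n => [|n [Y' IH]]; first by exists (fun _ _ => 0) => i x _; exact: AC_cst.
  exists (fun i t => B (fun j => Y n j t) t i) => i x x0; split.
    apply: (BL (Y n)) => // j; first exact: AC_measurable (IH j x x0).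
    by eexists => t; exact: AC_bdd (IH j x x0).
  by move=> t _; rewrite /= Ri_pt addr0.
have LY n i x : 0 <= x -> L1 `[0, x]%classic (fun t => B (fun j => Y n j t) t i).
  move=> x0; have [Y' IH] := AY n; apply: (BL (Y n)) => // j; first exact: AC_measurable (IH j x x0).
  by eexists => t; exact: AC_bdd (IH j x x0).
pose N : R := #|I|%:R.
(* With K >= 2 M N each step halves the weighted distance, as integrating exp(K t) gains a factor
   1/K; the summand 1 keeps K positive. *)
have [K KE] : exists K, K = 2 * M * N + 1 by exists (2 * M * N + 1).
have N0 : 0 <= N by rewrite ler0n.
have K0 : 0 < K by rewrite KE ltr_pwDr// !mulr_ge0.
pose D n x := \sum_i `|Y n.+1 i x - Y n i x|.
have D0 n x : 0 <= D n x by apply: sumr_ge0.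
have Dbd x : 0 <= x -> exists2 c, 0 <= c & forall n (t : R), 0 <= t <= x -> D n t <= c / 2 ^+ n * expR (K * t).
  move=> x0; have [Y0' A0] := AY 0%N; have [Y1' A1] := AY 1%N.
  pose c := \sum_i (`|Y 1%N i 0 - Y 0%N i 0| + Int `[0, x]%classic (fun t => `|Y1' i t - Y0' i t|)).
  have c0 : 0 <= c by apply: sumr_ge0 => i _; rewrite addr_ge0// Ri_ge0.
  exists c => //; elim=> [|n IH] t /[dup] t0x /andP[t0 tx].
    rewrite expr0 divr1; apply: (@le_trans _ _ c); last first.
      by rewrite ler_peMr// -expR0 ler_expR mulr_ge0// ltW.
    by apply: ler_sum => i _; exact: AC_bdd (AC_B (A1 i x x0) (A0 i x x0)) _.
  have [LE IE] := Int_expR K0 t0.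
  have step i : `|Y n.+2 i t - Y n.+1 i t| <= M * (c / 2 ^+ n) * (expR (K * t) / K).
    rewrite /= -/(Y n.+1) opprD addrACA subrr add0r -RiB//; last 2 first.
      exact: (LY n.+1).
      exact: LY.
    apply: (@le_trans _ _ (Int `[0, t]%classic (fun s => M * (c / 2 ^+ n) * expR (K * s)))).
      apply: Ri_norm_le => //.
      - by apply: L1B => //; [exact: (LY n.+1)|exact: LY].
      - exact: L1Z.
      move=> s /=; rewrite in_itv/= => /andP[s0 st].
      apply: (le_trans (Blip _ _ _ _ s0)); rewrite -mulrA ler_wpM2l//.
      by apply: IH; rewrite s0 (le_trans st).
    rewrite RiZ//; apply: ler_wpM2l; first by rewrite mulr_ge0// divr_ge0// exprn_ge0.
    by rewrite ler_pdivlMr// mulrC.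
  apply: (@le_trans _ _ (\sum_(i : I) (M * (c / 2 ^+ n) * (expR (K * t) / K)))).
    exact: ler_sum.
  have p0 : (2 : R) ^+ n != 0 by rewrite expf_neq0.
  have Kn0 : K != 0 by rewrite lt0r_neq0.
  set w := expR (K * t); have w0 : 0 <= w by rewrite expR_ge0.
  rewrite sumr_const -[leLHS]mulr_natl (_ : #|xpredT|%:R = N)//.
  rewrite (_ : N * (M * (c / 2 ^+ n) * (w / K)) = N * M / K * (c / 2 ^+ n * w)); last by field; rewrite ?Kn0 ?p0.
  rewrite [2 ^+ n.+1]exprS (_ : c / (2 * 2 ^+ n) * w = 2^-1 * (c / 2 ^+ n * w)); last by field.
  apply: ler_wpM2r; first by rewrite mulr_ge0// divr_ge0// exprn_ge0.
  by rewrite ler_pdivrMr// KE; lra.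
pose y i x := limn (fun n => Y n i x).
have lim x : 0 <= x -> exists2 c, 0 <= c & forall i n (t : R), 0 <= t <= x ->
    ((fun n => Y n i t) @ \oo --> y i t) /\ `|Y n i t - y i t| <= c / 2 ^+ n.
  move=> x0; have [c c0 H] := Dbd x x0.
  exists (2 * (c * expR (K * x))); first by rewrite !mulr_ge0// expR_ge0.
  move=> i n t /[dup] t0x /andP[t0 tx].
  have [|l Yl bl] := @dyadic_cauchy_cvg (fun n => Y n i t) (c * expR (K * x)).
    move=> k; apply: (@le_trans _ _ (D k t)).
      by rewrite /D (bigD1 i)//= lerDl sumr_ge0.
    apply: (le_trans (H k t t0x)); rewrite mulrAC ler_wpM2r ?invr_ge0 ?exprn_ge0//.
    by rewrite ler_wpM2l// ler_expR ler_wpM2l// ltW.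
  by rewrite /y (cvg_lim _ Yl).
have my i x : 0 <= x -> measurable_fun `[0, x]%classic (y i).
  move=> x0; have [c c0 H] := lim x x0.
  apply: (@measurable_fun_cvg _ _ _ _ (fun n => Y n i)).
    by move=> n; have [Y' AYn] := AY n; exact: AC_measurable (AYn i x x0).
  by move=> t; rewrite /= in_itv/= => /(H i 0%N)[].
have by_ i x : 0 <= x -> exists k : R, forall t : R, 0 <= t <= x -> `|y i t| <= k.
  move=> x0; have [c c0 H] := lim x x0.
  exists (c + `|y0 i|) => t /(H i 0%N)[_]; rewrite expr0 divr1 /= => h.
  rewrite -(subrK (y0 i) (y i t)) (le_trans (ler_normD _ _))// lerD2r.
  by rewrite distrC.
have yE i x : 0 <= x -> y i x = y0 i + Int `[0, x]%classic (fun t => B (fun j => y j t) t i).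
  move=> x0; apply/eqP; rewrite -subr_eq0; apply/eqP.
  have [c c0 H] := lim x x0.
  (* The first term bounds the distance of [y] from the iterate n + 1, the second the distance of
     the two integrals, by the Lipschitz condition. *)
  apply: (@le0_geometric _ (c + x * (M * N * c))) => n.
  have LB : L1 `[0, x]%classic (fun t => B (fun j => y j t) t i).
    by apply: BL => // j; [exact: my|exact: by_].
  have h1 : `|y i x - Y n.+1 i x| <= c / 2 ^+ n.
    have [|_] := H i n.+1 x; first by rewrite x0 lexx.
    rewrite distrC => /le_trans; apply; rewrite ler_wpM2l// lef_pV2 ?posrE ?exprn_gt0//.
    by rewrite exprS ler_peMl// ?exprn_ge0// ler1n.
  have h2 : `|Int `[0, x]%classic (fun t => B (fun j => Y n j t) t i) -
       Int `[0, x]%classic (fun t => B (fun j => y j t) t i)| <= x * (M * N * c) / 2 ^+ n.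
    rewrite -RiB//; last exact: LY.
    rewrite (_ : x * _ / _ = M * (N * (c / 2 ^+ n)) * (x - 0)); last by rewrite subr0; ring.
    rewrite -Ri_cst//; apply: Ri_norm_le => //.
    - by apply: L1B => //; exact: LY.
    - exact: L1_cst.
    move=> t /=; rewrite in_itv/= => /[dup] t0x /andP[t0 tx].
    apply: (le_trans (Blip _ _ _ _ t0)); rewrite ler_wpM2l//.
    rewrite mulr_natl -[leRHS]sumr_const; apply: ler_sum => j _.
    by have [] := H j n t t0x.
  rewrite mulrDl; apply: le_trans (lerD h1 h2).
  apply: le_trans (ler_normD _ _); rewrite [Y n.+1 i x]/= -/(Y n).
  move: (Int _ _) (Int _ _) => I1 I2.
  by rewrite le_eqVlt; apply/orP; left; apply/eqP; congr (`| _ |); ring.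
have y00 i : y i 0 = y0 i by rewrite yE// Ri_pt addr0.
exists y; split=> // i x x0; split.
  by apply: BL => // j; [exact: my|exact: by_].
by move=> t /andP[t0 _]; rewrite y00 yE.
Qed.

End Picard.

(** * Growth bound for second-order systems *)

Section Energy.
Context {R : realType}.
Notation mu := (@lebesgue_measure R).
Implicit Types (f g h u v w : R -> R) (b c d s t x y k M e : R) (D : set R).

Lemma AC_expR c d k : AC c d (fun t => expR (k * t)) (fun t => k * expR (k * t)).
Proof.
apply: AC_C1 => [t|t]; first exact: is_derive_comp_scale.
apply: cvgM; first exact: cvg_cst.
by apply: continuous_comp; [exact: continuous_scale|exact: continuous_expR].
Qed.

Lemma AC_cos c d k : AC c d (fun t => cos (k * t)) (fun t => - k * sin (k * t)).
Proof.
apply: AC_C1 => [t|t].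
  have := @is_derive_comp_scale R cos (fun t => - sin t) k t (is_derive_cos _).
  by rewrite mulrN mulNr.
apply: cvgM; first exact: cvg_cst.
by apply: continuous_comp; [exact: continuous_scale|exact: continuous_sin].
Qed.

Lemma AC_sin c d k : AC c d (fun t => sin (k * t)) (fun t => k * cos (k * t)).
Proof.
apply: AC_C1 => [t|t]; first exact: is_derive_comp_scale.
apply: cvgM; first exact: cvg_cst.
by apply: continuous_comp; [exact: continuous_scale|exact: continuous_cos].
Qed.

Lemma AC_sqr c d u u' : AC c d u u' -> AC c d (fun t => u t ^+ 2) (fun t => 2 * (u t * u' t)).
Proof. by move=> A; apply: AC_ext (AC_M A A) => t _; ring. Qed.

(** Gronwall's inequality in both directions. The sum N of the four squares satisfies |N'| <= (2 +
    M) N + G. For x <= y the product exp(K t) N loses at most exp(K b) times the integral of G; for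
    y < x the product exp(- K t) N gains at most that integral. *)
Lemma energy_bound b (p p1 p2 q q1 q2 G : R -> R) M x y :
  0 <= M -> AC 0 b p p1 -> AC 0 b p1 p2 -> AC 0 b q q1 -> AC 0 b q1 q2 ->
  L1 `[0, b]%classic G ->
  (forall t, 0 <= t <= b -> 0 <= G t) ->
  (forall t, 0 <= t <= b -> p2 t ^+ 2 + q2 t ^+ 2 <= M * (p t ^+ 2 + q t ^+ 2) + G t) ->
  0 <= x <= b -> 0 <= y <= b ->
  p x ^+ 2 + p1 x ^+ 2 + q x ^+ 2 + q1 x ^+ 2 <=
  expR ((2 + M) * b) * (p y ^+ 2 + p1 y ^+ 2 + q y ^+ 2 + q1 y ^+ 2 + Int `[0, b]%classic G).
Proof.
move=> M0 Ap Ap1 Aq Aq1 LG G0 HG /andP[x0 xb] /andP[y0 yb].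
have b0 := le_trans x0 xb.
pose N t := p t ^+ 2 + p1 t ^+ 2 + q t ^+ 2 + q1 t ^+ 2.
pose N' t := 2 * (p t * p1 t) + 2 * (p1 t * p2 t) + 2 * (q t * q1 t) + 2 * (q1 t * q2 t).
have AN : AC 0 b N N' by exact: AC_D (AC_D (AC_D (AC_sqr Ap) (AC_sqr Ap1)) (AC_sqr Aq)) (AC_sqr Aq1).
have N0 t : 0 <= N t by rewrite /N !addr_ge0// sqr_ge0.
set K := 2 + M; have K0 : 0 <= K by rewrite addr_ge0.
have NG t : 0 <= t <= b -> - (K * N t + G t) <= N' t <= K * N t + G t.
  move=> tb; have := HG t tb; have := G0 t tb.
  have := sqr_ge0 (p t + p1 t); have := sqr_ge0 (p t - p1 t).
  have := sqr_ge0 (p1 t + p2 t); have := sqr_ge0 (p1 t - p2 t).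
  have := sqr_ge0 (q t + q1 t); have := sqr_ge0 (q t - q1 t).
  have := sqr_ge0 (q1 t + q2 t); have := sqr_ge0 (q1 t - q2 t).
  have : 0 <= M * (p1 t ^+ 2 + q1 t ^+ 2) by rewrite mulr_ge0// addr_ge0// sqr_ge0.
  have := sqr_ge0 (p t); have := sqr_ge0 (q t).
  rewrite /N /N' /K => *; apply/andP; split; lra.
set J := Int _ G.
have J0 : 0 <= J by apply: Ri_ge0 => t; rewrite /= in_itv/=; exact: G0.
have sJ s t : 0 <= s -> t <= b -> Int `[s, t]%classic G <= J.
  by move=> s0 tb; apply: Ri_le_sub => //; exact: itv_sub.
have eb t : 0 <= t <= b -> 1 <= expR (K * t) <= expR (K * b).
  by move=> /andP[t0 tb]; rewrite -expR0 !ler_expR mulr_ge0//= ler_wpM2l.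
rewrite -/(N x) -/(N y).
have [xy|yx] := leP x y.
  have AW := AC_sub x0 yb (AC_M (AC_expR 0 b K) AN).
  have := AC_diff AW (lexx _) xy (lexx _); set I := Int _ _ => E.
  have : Int `[x, y]%classic (fun t => (- expR (K * b)) * G t) <= I.
    apply: Ri_le => //; first by apply: L1Z => //; exact: L1_itv LG.
      by case: AW.
    move=> t /=; rewrite in_itv/= => /andP[xt ty].
    have tb : 0 <= t <= b by rewrite (le_trans x0 xt) (le_trans ty).
    have /andP[n1 n2] := NG t tb; have /andP[e1 e2] := eb t tb.
    have := G0 t tb; move: n1 e1 e2; set Et := expR (K * t); set Eb := expR (K * b) => n1 e1 e2 g.
    have e0 : 0 <= Et by exact: expR_ge0.
    rewrite mulrAC -mulrA; nra.
  rewrite RiZ//; last exact: L1_itv LG.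
  have := sJ x y x0 yb.
  have /andP[] := eb x (introT andP (conj x0 xb)).
  have /andP[] := eb y (introT andP (conj y0 yb)).
  move: E; rewrite -/(N x) -/(N y); have := N0 x; have := N0 y.
  set ex := expR (K * x); set ey := expR (K * y); set eB := expR (K * b).
  move: (N x) (N y) (Int `[x, y]%classic G) I => Nx Ny Ixy I Ny0 Nx0 E h1 h2 h3 h4 h5 h6.
  have k1 : Nx <= ex * Nx by rewrite ler_peMl.
  have k2 : ey * Ny <= eB * Ny by rewrite ler_wpM2r.
  have k3 : eB * Ixy <= eB * J by rewrite ler_wpM2l// expR_ge0.
  by rewrite mulrDr; lra.
have AW := AC_sub y0 xb (AC_M (AC_expR 0 b (- K)) AN).
have := AC_diff AW (lexx _) (ltW yx) (lexx _); set I := Int _ _ => E.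
have e1 t : 0 <= t -> expR (- K * t) <= 1.
  by move=> t0; rewrite -expR0 ler_expR mulNr oppr_le0 mulr_ge0.
have : I <= Int `[y, x]%classic G.
  apply: Ri_le => //; first by case: AW.
    exact: L1_itv LG.
  move=> t /=; rewrite in_itv/= => /andP[yt tx].
  have t0 := le_trans y0 yt.
  have tb : 0 <= t <= b by rewrite t0 (le_trans tx).
  have /andP[n1 n2] := NG t tb; have := e1 t t0.
  have := G0 t tb; move: n2; set Et := expR (- K * t) => n2 g e1t.
  have e0 : 0 <= Et by exact: expR_ge0.
  rewrite -mulrA; nra.
move=> h1; have h2 := sJ y x y0 xb.
have h3 : expR (- K * y) * N y <= N y by rewrite ler_piMl// e1.
have h4 : expR (- K * x) * N x <= N y + J by lra.
have := ler_wpM2l (expR_ge0 (K * x)) h4; rewrite mulrA -expRD mulNr subrr expR0 mul1r.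
move=> /le_trans; apply; rewrite ler_wpM2r ?addr_ge0 ?sqr_ge0//.
by have /andP[] := eb x (introT andP (conj x0 xb)).
Qed.

Lemma AC_measurable_halfline b u u' : (forall x, b <= x -> AC b x u u') ->
  measurable_fun `[b, +oo[%classic u.
Proof.
move=> A; rewrite itv_bndy_bigcup_BRight; apply/measurable_fun_bigcup => // n.
by apply: AC_measurable (A _ _); rewrite lerDl.
Qed.

End Energy.

(** * Growing and decaying solutions of the free equation on a half-line *)

Section Decay.
Context {R : realType}.
Notation mu := (@lebesgue_measure R).
Notation half := (`[0, +oo[%classic : set R).
Implicit Types (f g h u v w : R -> R) (b c d s t x y : R).

Lemma L1_sqr_halfline b u v M : (forall x, b <= x -> L1 `[b, x]%classic (fun t => u t ^+ 2 + v t ^+ 2)) ->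
  measurable_fun `[b, +oo[%classic u -> measurable_fun `[b, +oo[%classic v ->
  (forall x, b <= x -> Int `[b, x]%classic (fun t => u t ^+ 2 + v t ^+ 2) <= M) ->
  L2R `[b, +oo[%classic u /\ L2R `[b, +oo[%classic v.
Proof.
move=> L mu_ mv H.
have [||//||L2 _] := @L1_halfline _ b (fun t => u t ^+ 2 + v t ^+ 2) M => //.
  by apply: measurable_funD => //; exact: measurable_funX.
- by move=> x _; rewrite addr_ge0// sqr_ge0.
by split; apply: L2_le L2 => // x _; rewrite ?lerDl ?lerDr ?sqr_ge0.
Qed.

Variables (al be kap om : R).
Hypotheses (kap0 : 0 < kap) (kapom : kap ^+ 2 - om ^+ 2 = - al) (kapbe : 2 * kap * om = - be).

Let kapn0 : kap != 0. Proof. exact: lt0r_neq0. Qed.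

(** The hypotheses say that mu = kap + i om is the square root of -(al + i be) with positive real
    part, and w = u + i v solves w' = - mu w + F + i G. The rotation leaves |w| unchanged and the
    damping absorbs half of the source term: (|w|^2)' <= (F^2 + G^2)/kap - kap |w|^2. *)
Lemma damped_L2 u v F G : L2R half F -> L2R half G ->
  (forall x, 0 <= x -> AC 0 x u (fun t => - kap * u t + om * v t + F t)) ->
  (forall x, 0 <= x -> AC 0 x v (fun t => - kap * v t - om * u t + G t)) ->
  L2R half u /\ L2R half v.
Proof.
move=> LF LG Au Av.
set T := Int half (fun t => kap^-1 * (F t ^+ 2 + G t ^+ 2)).
have LFG : L1 half (fun t => kap^-1 * (F t ^+ 2 + G t ^+ 2)).
  by apply: L1Z => //; apply: L1D => //; exact: L2_L1.
have LE x : 0 <= x -> L1 `[0, x]%classic (fun t => u t ^+ 2 + v t ^+ 2).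
  by move=> x0; exact: AC_L1 (AC_D (AC_sqr (Au x x0)) (AC_sqr (Av x x0))).
apply: (@L1_sqr_halfline _ _ _ (kap^-1 * (u 0 ^+ 2 + v 0 ^+ 2 + T))) => //.
- exact: AC_measurable_halfline Au.
- exact: AC_measurable_halfline Av.
move=> x x0; have A := AC_D (AC_sqr (Au x x0)) (AC_sqr (Av x x0)).
have := AC_diff A (lexx _) x0 (lexx _); set I := Int _ _ => E.
have : I <= Int `[0, x]%classic (fun t => kap^-1 * (F t ^+ 2 + G t ^+ 2) - kap * (u t ^+ 2 + v t ^+ 2)).
  apply: Ri_le => //; first by case: A.
    by apply: L1B => //; [exact: L1_itvy LFG|apply: L1Z => //; exact: LE].
  move=> t _.
  have := sqr_ge0 (kap * u t - F t); have := sqr_ge0 (kap * v t - G t).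
  rewrite -subr_ge0 -(pmulr_rge0 _ kap0) => h1 h2.
  rewrite -subr_ge0 -(pmulr_rge0 _ kap0).
  rewrite [X in 0 <= X](_ : _ = (kap * u t - F t) ^+ 2 + (kap * v t - G t) ^+ 2).
    by rewrite addr_ge0// sqr_ge0.
  by field.
rewrite RiB//; last 2 first.
  exact: L1_itvy LFG.
  by apply: L1Z => //; exact: LE.
rewrite RiZ//; last exact: LE.
have : Int `[0, x]%classic (fun t => kap^-1 * (F t ^+ 2 + G t ^+ 2)) <= T.
  apply: Ri_le_sub => //; first exact: itv_suby.
  by move=> t _; rewrite mulr_ge0 ?invr_ge0 ?(ltW kap0)// addr_ge0// sqr_ge0.
rewrite ler_pdivlMl//; have := sqr_ge0 (u x); have := sqr_ge0 (v x).
lra.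
Qed.

(** [ER] and [EI] are the real and imaginary parts of exp(- (kap + i om) t), the decaying solution
    of the free equation. *)
Definition ER t : R := expR (- kap * t) * cos (om * t).
Definition EI t : R := - (expR (- kap * t) * sin (om * t)).

Lemma AC_ER c d : AC c d ER (fun t => - kap * ER t + om * EI t).
Proof.
by apply: AC_ext (AC_M (AC_expR c d (- kap)) (AC_cos c d om)) => t _; rewrite /ER /EI//; ring.
Qed.

Lemma AC_EI c d : AC c d EI (fun t => - kap * EI t - om * ER t).
Proof.
by apply: AC_ext (AC_N (AC_M (AC_expR c d (- kap)) (AC_sin c d om))) => t _; rewrite /ER /EI//; ring.
Qed.

Lemma EE t : ER t ^+ 2 + EI t ^+ 2 = expR (- kap * t) ^+ 2.
Proof.
rewrite /ER /EI; have := cos2Dsin2 (om * t).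
set e := expR _; set c := cos _; set s := sin _ => H.
by rewrite sqrrN !exprMn -mulrDr H mulr1.
Qed.

Lemma L2_E : L2R half ER /\ L2R half EI.
Proof.
have L0 : L2R half (fun=> 0 : R).
  split; first exact: measurable_cst.
  by apply: (@L1_ext _ _ (fun=> 0)) => // [x _|]; [rewrite expr0n|exact: integrable0].
apply: (damped_L2 L0 L0) => x _.
  by apply: AC_ext (AC_ER 0 x) => // t _; rewrite addr0.
by apply: AC_ext (AC_EI 0 x) => // t _; rewrite addr0.
Qed.

Lemma Int_EE x : 0 <= x ->
  Int `[x, +oo[%classic (fun t => ER t ^+ 2 + EI t ^+ 2) = (2 * kap)^-1 * expR (- kap * x) ^+ 2.
Proof.
move=> x0; have [LR LI] := L2_E.
have LE : L1 `[x, +oo[%classic (fun t => ER t ^+ 2 + EI t ^+ 2).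
  by apply: (L1_itvyy x0); apply: L1D => //; exact: L2_L1.
have := @Int_halfline_derivative _ x (fun t => ER t ^+ 2 + EI t ^+ 2)
  (fun t => - (2 * kap) * (ER t ^+ 2 + EI t ^+ 2)) _ LE (L1Z _ _ LE).
rewrite RiZ// EE => H.
have {}H := H _ _; rewrite -[LHS](mulKf (_ : - (2 * kap) != 0)); last by rewrite oppr_eq0 mulf_neq0.
rewrite H//; first by field.
move=> y _; apply: AC_ext (AC_D (AC_sqr (AC_ER x y)) (AC_sqr (AC_EI x y))) => t _ //; ring.
Qed.

Section HalfLineSolution.
Variables (p p1 q q1 F G : R -> R).
Hypotheses (LF : L2R half F) (LG : L2R half G).
Hypotheses (Ap : forall x, 0 <= x -> AC 0 x p p1)
  (Ap1 : forall x, 0 <= x -> AC 0 x p1 (fun t => - al * p t + be * q t - F t))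
  (Aq : forall x, 0 <= x -> AC 0 x q q1)
  (Aq1 : forall x, 0 <= x -> AC 0 x q1 (fun t => - al * q t - be * p t - G t)).

Let hR t := - p1 t + kap * p t - om * q t.
Let hI t := - q1 t + kap * q t + om * p t.

(** With w = p + i q, [hR + i hI] is h = mu w - w'. Since w'' = mu^2 w - (F + i G), it solves the
    damped first-order equation h' = - mu h + F + i G, and so is square-integrable whether or not w
    grows. *)
Lemma L2_h : L2R half hR /\ L2R half hI.
Proof.
have alE : al = om ^+ 2 - kap ^+ 2 by move: kapom; lra.
have beE : be = - (2 * kap * om) by rewrite kapbe opprK.
apply: (damped_L2 LF LG) => x x0.
  apply: AC_ext (AC_B (AC_D (AC_N (Ap1 x0)) (AC_Z kap (Ap x0))) (AC_Z om (Aq x0))) => t _ //.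
  by rewrite /hR /hI alE beE; ring.
apply: AC_ext (AC_D (AC_D (AC_N (Aq1 x0)) (AC_Z kap (Aq x0))) (AC_Z om (Ap x0))) => t _ //.
by rewrite /hR /hI alE beE; ring.
Qed.

Lemma L1_Eh : L1 half (fun t => ER t * hR t - EI t * hI t) /\
  L1 half (fun t => ER t * hI t + EI t * hR t).
Proof.
have [LR LI] := L2_E; have [HR HI] := L2_h.
by split; [apply: L1B|apply: L1D] => //; exact: L2_M.
Qed.

(** Since (exp(- mu t) w)' = - exp(- mu t) h, the two conditions say that exp(- mu x) w(x) equals
    the tail integral of exp(- mu t) h, that is, it tends to 0. The tail is O(exp(- kap x)), so w is
    bounded, and a bounded w is square-integrable. *)
Lemma decaying_L2 :
  p 0 = Int half (fun t => ER t * hR t - EI t * hI t) ->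
  q 0 = Int half (fun t => ER t * hI t + EI t * hR t) ->
  L2R half p /\ L2R half q.
Proof.
move=> p0 q0; have [LXR LXI] := L1_Eh; have [HR HI] := L2_h; have [LER LEI] := L2_E.
have ER0 : ER 0 = 1 by rewrite /ER !mulr0 expR0 cos0 mulr1.
have EI0 : EI 0 = 0 by rewrite /EI !mulr0 sin0 mulr0 oppr0.
set H := Int half (fun t => hR t ^+ 2 + hI t ^+ 2).
have LH : L1 half (fun t => hR t ^+ 2 + hI t ^+ 2) by apply: L1D => //; exact: L2_L1.
have tailR x : 0 <= x -> ER x * p x - EI x * q x =
    Int `[x, +oo[%classic (fun t => ER t * hR t - EI t * hI t).
  move=> x0.
  have A : AC 0 x (fun t => ER t * p t - EI t * q t) (fun t => - (ER t * hR t - EI t * hI t)).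
    apply: AC_ext (AC_B (AC_M (AC_ER 0 x) (Ap x0)) (AC_M (AC_EI 0 x) (Aq x0))) => t _ //.
    by rewrite /hR /hI; ring.
  have := AC_diff A (lexx _) x0 (lexx _).
  rewrite RiN//; last exact: L1_itvy LXR.
  by rewrite ER0 EI0 mul1r mul0r subr0 p0 (Ri_caty x0)//; lra.
have tailI x : 0 <= x -> ER x * q x + EI x * p x =
    Int `[x, +oo[%classic (fun t => ER t * hI t + EI t * hR t).
  move=> x0.
  have A : AC 0 x (fun t => ER t * q t + EI t * p t) (fun t => - (ER t * hI t + EI t * hR t)).
    apply: AC_ext (AC_D (AC_M (AC_ER 0 x) (Aq x0)) (AC_M (AC_EI 0 x) (Ap x0))) => t _ //.
    by rewrite /hR /hI; ring.
  have := AC_diff A (lexx _) x0 (lexx _).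
  rewrite RiN//; last exact: L1_itvy LXI.
  by rewrite ER0 EI0 mul1r mul0r addr0 q0 (Ri_caty x0)//; lra.
(* With s = exp(kap x), |E| |h| <= s |E|^2 / 2 + |h|^2 / (2 s), and |E|^2 integrates to 1/(2 kap
   s^2) beyond x; both terms then carry the factor 1/s. *)
set C := (4 * kap)^-1 + H / 2.
have tail_bound x X : 0 <= x -> L1 `[x, +oo[%classic X ->
    (forall t, X t ^+ 2 <= (ER t ^+ 2 + EI t ^+ 2) * (hR t ^+ 2 + hI t ^+ 2)) ->
    `|Int `[x, +oo[%classic X| <= expR (- kap * x) * C.
  move=> x0 LX HX.
  set s := expR (kap * x); have s0 : 0 < s by exact: expR_gt0.
  have sE : expR (- kap * x) = s^-1 by rewrite mulNr expRN.
  have L1b : L1 `[x, +oo[%classic (fun t => s / 2 * (ER t ^+ 2 + EI t ^+ 2)).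
    by apply: L1Z => //; apply: (L1_itvyy x0); apply: L1D => //; exact: L2_L1.
  have L2b : L1 `[x, +oo[%classic (fun t => (2 * s)^-1 * (hR t ^+ 2 + hI t ^+ 2)).
    by apply: L1Z => //; exact: L1_itvyy LH.
  apply: (@le_trans _ _ (Int `[x, +oo[%classic
      (fun t => s / 2 * (ER t ^+ 2 + EI t ^+ 2) + (2 * s)^-1 * (hR t ^+ 2 + hI t ^+ 2)))).
    apply: Ri_norm_le => //; first exact: L1D.
    move=> t _; move: (HX t); set A := _ + _; set B := _ + _ => h.
    have A0 : 0 <= A by rewrite addr_ge0// sqr_ge0.
    have B0 : 0 <= B by rewrite addr_ge0// sqr_ge0.
    have Y0 : 0 <= s / 2 * A + (2 * s)^-1 * B.
      by rewrite addr_ge0// mulr_ge0// ?invr_ge0 ?mulr_ge0// ltW.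
    rewrite -ler_sqr ?nnegrE// real_normK ?num_real//; apply: (le_trans h).
    rewrite -subr_ge0 (_ : _ - _ = (s / 2 * A - (2 * s)^-1 * B) ^+ 2) ?sqr_ge0//.
    by field; rewrite lt0r_neq0.
  rewrite RiD// RiZ//; last first.
    by apply: (L1_itvyy x0); apply: L1D => //; exact: L2_L1.
  rewrite Int_EE// RiZ//; last exact: L1_itvyy LH.
  have : Int `[x, +oo[%classic (fun t => hR t ^+ 2 + hI t ^+ 2) <= H.
    apply: Ri_le_sub => //; first exact: itvy_suby.
    by move=> t _; rewrite addr_ge0// sqr_ge0.
  rewrite sE; set J := Int _ _ => JH.
  rewrite (_ : s / 2 * _ = s^-1 * (4 * kap)^-1); last by field; rewrite kapn0 lt0r_neq0.
  rewrite (_ : (2 * s)^-1 * J = s^-1 * (J / 2)); last by field; rewrite lt0r_neq0.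
  rewrite -mulrDr /C ler_wpM2l ?invr_ge0 ?(ltW s0)//.
  by rewrite lerD2l ler_wpM2r// invr_ge0.
have Ubd x : 0 <= x -> p x ^+ 2 + q x ^+ 2 <= 2 * C ^+ 2.
  move=> x0.
  have h1 := tail_bound x _ x0 (L1_itvyy x0 LXR); rewrite -tailR// in h1.
  have h2 := tail_bound x _ x0 (L1_itvyy x0 LXI); rewrite -tailI// in h2.
  have {}h1 : `|ER x * p x - EI x * q x| <= expR (- kap * x) * C.
    apply: h1 => t; rewrite -subr_ge0 (_ : _ - _ = (ER t * hI t + EI t * hR t) ^+ 2) ?sqr_ge0//; ring.
  have {}h2 : `|ER x * q x + EI x * p x| <= expR (- kap * x) * C.
    apply: h2 => t; rewrite -subr_ge0 (_ : _ - _ = (ER t * hR t - EI t * hI t) ^+ 2) ?sqr_ge0//; ring.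
  have e0 : 0 < expR (- kap * x) by exact: expR_gt0.
  have := EE x; move: h1 h2 e0; set e := expR _ => h1 h2 e0 E.
  have eC : 0 <= e * C by exact: le_trans h1.
  have k1 : (ER x * p x - EI x * q x) ^+ 2 <= (e * C) ^+ 2.
    by rewrite -(real_normK (num_real _)) ler_sqr ?nnegrE.
  have k2 : (ER x * q x + EI x * p x) ^+ 2 <= (e * C) ^+ 2.
    by rewrite -(real_normK (num_real _)) ler_sqr ?nnegrE.
  have e2 : 0 < e ^+ 2 by rewrite exprn_gt0.
  rewrite -(ler_pM2l e2) -{1}E; apply: le_trans (_ : _ <= (e * C) ^+ 2 + (e * C) ^+ 2) _; last first.
    by rewrite exprMn; lra.
  apply: le_trans (lerD k1 k2); rewrite le_eqVlt; apply/orP; left; apply/eqP; ring.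
have LE x : 0 <= x -> L1 `[0, x]%classic (fun t => p t ^+ 2 + q t ^+ 2).
  by move=> x0; exact: AC_L1 (AC_D (AC_sqr (Ap x0)) (AC_sqr (Aq x0))).
apply: (@L1_sqr_halfline _ _ _ (kap^-1 * (2 * C ^+ 2 + kap^-1 * H))) => //.
- exact: AC_measurable_halfline Ap.
- exact: AC_measurable_halfline Aq.
move=> x x0; have A := AC_D (AC_sqr (Ap x0)) (AC_sqr (Aq x0)).
have := AC_diff A (lexx _) x0 (lexx _); set I := Int _ _ => E.
have LHx := L1_itvy x (lexx 0) LH.
(* From w' = mu w - h the derivative of |w|^2 is at least kap |w|^2 - |h|^2 / kap, so a bound on |w|
   bounds the integral of |w|^2. *)
have : Int `[0, x]%classic (fun t => kap * (p t ^+ 2 + q t ^+ 2) - kap^-1 * (hR t ^+ 2 + hI t ^+ 2)) <= I.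
  apply: Ri_le => //; last 2 first.
    by case: A.
  - move=> t _; rewrite -subr_ge0 -(pmulr_rge0 _ kap0).
    rewrite [X in 0 <= X](_ : _ = (kap * p t - hR t) ^+ 2 + (kap * q t - hI t) ^+ 2).
      by rewrite addr_ge0// sqr_ge0.
    by rewrite /hR /hI; field.
  by apply: L1B => //; [apply: L1Z => //; exact: LE|exact: L1Z].
rewrite RiB//; last 2 first.
  by apply: L1Z => //; exact: LE.
  exact: L1Z.
rewrite RiZ//; last exact: LE.
rewrite RiZ//.
have HH : Int `[0, x]%classic (fun t => hR t ^+ 2 + hI t ^+ 2) <= H.
  apply: Ri_le_sub => //; first exact: itv_suby.
  by move=> t _; rewrite addr_ge0// sqr_ge0.
have : kap^-1 * Int `[0, x]%classic (fun t => hR t ^+ 2 + hI t ^+ 2) <= kap^-1 * H.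
  by rewrite ler_wpM2l// invr_ge0 ltW.
move=> h1 h2; rewrite ler_pdivlMl//; have := Ubd x x0.
have := sqr_ge0 (p 0); have := sqr_ge0 (q 0); lra.
Qed.

End HalfLineSolution.
End Decay.

Ltac nneg := repeat first [exact: sqr_ge0 | done | apply: addr_ge0 | apply: mulr_ge0].

(** * Injective linear maps in finite dimension *)

Section LinearAlgebra.
Context {R : fieldType}.

Lemma linear_expand (I J : finType) (Phi : (I -> R) -> J -> R) :
  (forall c c' s k, Phi (fun i => c i + s * c' i) k = Phi c k + s * Phi c' k) ->
  forall c k, Phi c k = \sum_l c l * Phi (fun i => (i == l)%:R) k.
Proof.
move=> lin c k.
have Phi0 : Phi (fun=> 0) k = 0.
  have E : (fun _ : I => 0 + 1 * 0) = (fun=> 0 : R) by apply/funext => i; rewrite mulr0 addr0.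
  by have := lin (fun=> 0) (fun=> 0) 1 k; rewrite E mul1r -{1}[Phi _ k]addr0 => /addrI.
rewrite [X in Phi X](_ : c = (fun i => \sum_(l <- index_enum I) c l * (i == l)%:R)); last first.
  apply/funext => i; rewrite (bigD1 i)//= eqxx mulr1 big1 ?addr0// => l.
  by rewrite eq_sym => /negPf ->; rewrite mulr0.
elim: (index_enum I) => [|l s IH].
  by rewrite big_nil -[RHS]Phi0; congr Phi; apply/funext => i; rewrite big_nil.
rewrite big_cons -IH addrC -lin; congr Phi; apply/funext => i.
by rewrite big_cons addrC.
Qed.

(** The coefficients [L] give a bound of [c] by [Phi c]: this turns uniqueness for the Neumann
    problem into an estimate. *)
Lemma linear_left_inverse (I J : finType) (Phi : (I -> R) -> J -> R) :
  (forall c c' s k, Phi (fun i => c i + s * c' i) k = Phi c k + s * Phi c' k) ->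
  (forall c, (forall k, Phi c k = 0) -> forall l, c l = 0) ->
  exists L : I -> J -> R, forall c l, c l = \sum_k L l k * Phi c k.
Proof.
move=> lin inj; have ex := linear_expand lin.
pose A := \matrix_(i < #|I|, j < #|J|) Phi (fun x => (x == enum_val i)%:R) (enum_val j).
have PhiA c k : Phi c k = ((\row_i c (enum_val i)) *m A) 0 (enum_rank k).
  rewrite ex !mxE (reindex (@enum_val I I)) /=; last first.
    exact: (onW_bij _ (@enum_val_bij I)).
  by apply: eq_bigr => i _; rewrite !mxE enum_rankK.
have /row_freeP[B AB] : row_free A.
  apply: inj_row_free => v vA0; apply/rowP => i; rewrite mxE.
  have := inj (fun l => v 0 (enum_rank l)) _ (enum_val i); rewrite enum_valK; apply => k.
  rewrite PhiA (_ : \row_j _ = v) ?vA0 ?mxE//.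
  by apply/rowP => j; rewrite mxE enum_valK.
exists (fun l k => B (enum_rank k) (enum_rank l)) => c l.
have : (\row_i c (enum_val i)) *m A *m B = \row_i c (enum_val i) by rewrite -mulmxA AB mulmx1.
move=> /rowP/(_ (enum_rank l)); rewrite mxE [RHS]mxE enum_rankK => <-.
rewrite (reindex (@enum_rank J)) /=; last exact: (onW_bij _ (@enum_rank_bij J)).
by apply: eq_bigr => k _; rewrite PhiA mulrC.
Qed.

(** Injectivity makes the square matrix of [Phi] invertible; used to deduce existence of the
    resolvent from its uniqueness. *)
Lemma linear_surjective (I : finType) (Phi : (I -> R) -> I -> R) :
  (forall c c' s k, Phi (fun i => c i + s * c' i) k = Phi c k + s * Phi c' k) ->
  (forall c, (forall k, Phi c k = 0) -> forall l, c l = 0) ->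
  forall b, exists c, forall k, Phi c k = b k.
Proof.
move=> lin inj b; have ex := linear_expand lin.
pose A := \matrix_(i < #|I|, j < #|I|) Phi (fun x => (x == enum_val i)%:R) (enum_val j).
have PhiA c k : Phi c k = ((\row_i c (enum_val i)) *m A) 0 (enum_rank k).
  rewrite ex !mxE (reindex (@enum_val I I)) /=; last first.
    exact: (onW_bij _ (@enum_val_bij I)).
  by apply: eq_bigr => i _; rewrite !mxE enum_rankK.
have : row_free A.
  apply: inj_row_free => v vA0; apply/rowP => i; rewrite mxE.
  have := inj (fun l => v 0 (enum_rank l)) _ (enum_val i); rewrite enum_valK; apply => k.
  rewrite PhiA (_ : \row_j _ = v) ?vA0 ?mxE//.
  by apply/rowP => j; rewrite mxE enum_valK.
rewrite row_free_unit => uA.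
exists (fun l => ((\row_i b (enum_val i)) *m invmx A) 0 (enum_rank l)) => k.
rewrite PhiA (_ : \row_i _ = (\row_i b (enum_val i)) *m invmx A).
  by rewrite mulmxKV// mxE enum_rankK.
by apply/rowP => i; rewrite mxE enum_valK.
Qed.

End LinearAlgebra.

(** * The resolvent equation on a single edge *)

Section StarOperator.
Context {R : realType}.
Notation mu := (@lebesgue_measure R).
Notation half := (`[0, +oo[%classic : set R).
Implicit Types (V f g h : R -> R) (S : bool -> R -> R) (u : bool * bool -> R -> R) (b c d s t x M : R).
Variables (al be : R).

(** First-order real form of u'' = (V - zeta) u - S with zeta = al + i be, that is, of - u'' + V u -
    zeta u = S. *)
Definition rhs (V : R -> R) (S : bool -> R -> R) (y : bool * bool -> R) t (k : bool * bool) : R :=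
  match k with
  | (false, r) => y (true, r)
  | (true, false) => (V t - al) * y (false, false) + be * y (false, true) - S false t
  | (true, true) => (V t - al) * y (false, true) - be * y (false, false) - S true t
  end.

(* The component u (d, r) is the real (r = false) or imaginary (r = true) part
   of the solution (d = false) or of its derivative (d = true). *)
Definition edge_sol V S (u : bool * bool -> R -> R) :=
  forall k x, 0 <= x -> AC 0 x (u k) (fun t => rhs V S (fun j => u j t) t k).

Lemma edge_sol_exists V S M (y0 : bool * bool -> R) :
  measurable_fun half V -> (forall t, 0 <= t -> `|V t| <= M) ->
  (forall r x, 0 <= x -> L1 `[0, x]%classic (S r)) ->
  exists2 u, edge_sol V S u & forall k, u k 0 = y0 k.
Proof.
move=> mV VM LS.
have M0 : 0 <= M by exact: le_trans (VM 0 (lexx _)).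
have VM' t : 0 <= t -> `|V t - al| <= M + `|al|.
  by move=> t0; rewrite (le_trans (ler_normB _ _))// lerD2r VM.
have [|||u [u0 Au]] := @picard R _ (rhs V S) y0 (1 + M + `|al| + `|be|).
- by rewrite !addr_ge0.
- move=> y z t k t0; set T := \sum_j _.
  have T0 : 0 <= T by apply: sumr_ge0.
  have yz j : `|y j - z j| <= T by rewrite /T (bigD1 j)//= lerDl sumr_ge0.
  have two j j' : j != j' -> `|y j - z j| + `|y j' - z j'| <= T.
    by move=> jj; rewrite /T (bigD1 j)//= lerD2l (bigD1 j')/= ?lerDl ?sumr_ge0// eq_sym.
  have V1 := VM' t t0; have al0 := normr_ge0 al; have be0 := normr_ge0 be.
  case: k => [[] []] /=.
  + rewrite (_ : _ - _ = (V t - al) * (y (false, true) - z (false, true)) - be * (y (false, false) - z (false, false))); last by ring.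
    apply: (le_trans (ler_normB _ _)); rewrite !normrM.
    have := two (false, true) (false, false) isT.
    have := normr_ge0 (y (false, true) - z (false, true)).
    have := normr_ge0 (y (false, false) - z (false, false)).
    nra.
  + rewrite (_ : _ - _ = (V t - al) * (y (false, false) - z (false, false)) + be * (y (false, true) - z (false, true))); last by ring.
    apply: (le_trans (ler_normD _ _)); rewrite !normrM.
    have := two (false, true) (false, false) isT.
    have := normr_ge0 (y (false, true) - z (false, true)).
    have := normr_ge0 (y (false, false) - z (false, false)).
    nra.
  + by apply: (le_trans (yz _)); rewrite -{1}[T]mul1r ler_wpM2r// -!addrA lerDl !addr_ge0.
  + by apply: (le_trans (yz _)); rewrite -{1}[T]mul1r ler_wpM2r// -!addrA lerDl !addr_ge0.
- move=> y x x0 my yb k.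
  have Ly j : L1 `[0, x]%classic (y j) by have [c yc] := yb j; apply: L1_bdd yc.
  have LVy j : L1 `[0, x]%classic (fun t => (V t - al) * y j t).
    apply: (@L1_Mbdd _ _ _ _ (M + `|al|)) => //.
      apply: measurable_funB => //; apply: measurable_funS mV => //; exact: itv_suby.
    by move=> t /=; rewrite in_itv/= => /andP[t0 _]; exact: VM'.
  case: k => [[] []] //=.
    by apply: L1B => //; [apply: L1B => //; exact: L1Z|exact: LS].
  by apply: L1B => //; [apply: L1D => //; exact: L1Z|exact: LS].
by exists u.
Qed.

Lemma edge_sol_comb V S S' u u' s : edge_sol V S u -> edge_sol V S' u' ->
  edge_sol V (fun r t => S r t + s * S' r t) (fun k t => u k t + s * u' k t).
Proof.
move=> Au Au' k x x0; apply: AC_ext (AC_D (Au k x x0) (AC_Z s (Au' k x x0))) => // t _.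
by case: k => [[] []] /=; ring.
Qed.

Lemma edge_sol_sum (I : finType) V (c : I -> R) (u : I -> bool * bool -> R -> R) :
  (forall i, edge_sol V (fun _ _ => 0) (u i)) ->
  edge_sol V (fun _ _ => 0) (fun k t => \sum_i c i * u i k t).
Proof.
move=> Au k x x0; apply: AC_ext (AC_sum (fun i => AC_Z (c i) (Au i k x x0))) => // t _.
case: k => [[] []] //=; rewrite !mulr_sumr subr0 -?sumrB -?big_split /=;
  by apply: eq_bigr => i _; ring.
Qed.

Lemma edge_sol_itv V S u k x y : edge_sol V S u -> 0 <= x ->
  AC x y (u k) (fun t => rhs V S (fun j => u j t) t k).
Proof.
move=> Au x0; have [y0|y0] := leP 0 y; first exact: AC_sub (Au k y y0).
split; first by rewrite set_itv_ge ?bnd_simp -?ltNge ?(lt_le_trans y0)//; exact: integrable_set0.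
by move=> t /andP[xt ty]; have := le_lt_trans (le_trans x0 xt) (le_lt_trans ty y0); rewrite ltxx.
Qed.

Definition sqn (u : bool * bool -> R -> R) t := u (false, false) t ^+ 2 + u (false, true) t ^+ 2.
Definition ssqn (S : bool -> R -> R) t := S false t ^+ 2 + S true t ^+ 2.

Lemma sqn_ge0 u t : 0 <= sqn u t. Proof. by rewrite addr_ge0// sqr_ge0. Qed.
Lemma ssqn_ge0 S t : 0 <= ssqn S t. Proof. by rewrite addr_ge0// sqr_ge0. Qed.

Lemma L1_sqn u : (forall k, L2R half (u k)) -> L1 half (sqn u).
Proof. by move=> L; apply: L1D => //; exact: L2_L1. Qed.

Lemma L1_ssqn S : (forall k, L2R half (S k)) -> L1 half (ssqn S).
Proof. by move=> L; apply: L1D => //; exact: L2_L1. Qed.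

(* Imaginary part of the product of the equation with the conjugate of u. *)
Lemma edge_energy V S u b : edge_sol V S u -> (forall k, L2R half (u k)) ->
  (forall r, L2R half (S r)) -> 0 <= b ->
  be * Int `[b, +oo[%classic (sqn u) =
  Int `[b, +oo[%classic (fun t => S false t * u (false, true) t - S true t * u (false, false) t)
  - (u (true, false) b * u (false, true) b - u (true, true) b * u (false, false) b).
Proof.
move=> Au Lu LS b0.
have LSu : L1 half (fun t => S false t * u (false, true) t - S true t * u (false, false) t).
  by apply: L1B => //; exact: L2_M.
pose w t := u (true, false) t * u (false, true) t - u (true, true) t * u (false, false) t.
pose w' t := be * sqn u t - (S false t * u (false, true) t - S true t * u (false, false) t).
have := @Int_halfline_derivative R b w w' _ _ _; rewrite /w' RiB//; last 2 first.
  by apply: L1Z => //; exact: L1_itvyy (L1_sqn Lu).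
  exact: L1_itvyy LSu.
rewrite RiZ//; last exact: L1_itvyy (L1_sqn Lu).
move=> H; rewrite -/(w b); suff: be * Int `[b, +oo[%classic (sqn u) -
   Int `[b, +oo[%classic (fun t => S false t * u (false, true) t - S true t * u (false, false) t) = - w b by lra.
apply: H.
- move=> x bx.
  apply: AC_ext (AC_B (AC_M (edge_sol_itv (true, false) x Au b0) (edge_sol_itv (false, true) x Au b0))
    (AC_M (edge_sol_itv (true, true) x Au b0) (edge_sol_itv (false, false) x Au b0))) => t _ //.
  by rewrite /sqn /=; ring.
- by apply: (L1_itvyy b0); apply: L1B => //; exact: L2_M.
- apply: L1B => //; last exact: L1_itvyy LSu.
  by apply: L1Z => //; exact: L1_itvyy (L1_sqn Lu).
Qed.

Definition trace_cst M := 144 * (3 + 6 * (M ^+ 2 + al ^+ 2) + 3 * be ^+ 2).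

Lemma trace_cst_ge0 M : 0 <= trace_cst M.
Proof.
by rewrite mulr_ge0// !addr_ge0// mulr_ge0// ?addr_ge0// sqr_ge0.
Qed.

(** [V] is bounded by [M] on [b, +oo) only. Taken with M = 0 beyond the support of the scaled
    potential, the constant is free of eps. *)
Lemma edge_trace V S u b M : edge_sol V S u -> (forall k, L2R half (u k)) ->
  (forall r, L2R half (S r)) -> 0 <= b -> measurable_fun half V ->
  (forall t, b <= t -> `|V t| <= M) ->
  u (false, false) b ^+ 2 + u (true, false) b ^+ 2 + u (false, true) b ^+ 2 + u (true, true) b ^+ 2 <=
  trace_cst M * (Int `[b, +oo[%classic (sqn u) + Int `[b, +oo[%classic (ssqn S)).
Proof.
move=> Au Lu LS b0 mV VM.
have LB := L2_itvy (b + 1) b0.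
have LVu r : L2R `[b, b + 1]%classic (fun t => (V t - al) * u (false, r) t).
  apply: (@L2_Mbdd _ _ _ _ (M + `|al|)) => //; last exact: LB.
    by apply: measurable_funB => //; apply: measurable_funS mV => //; exact: itv_suby.
  move=> t; rewrite /= in_itv/= => /andP[bt _].
  by rewrite (le_trans (ler_normB _ _))// lerD2r VM.
have A k := edge_sol_itv k (b + 1) Au b0.
pose p2 t := rhs V S (fun j => u j t) t (true, false).
pose q2 t := rhs V S (fun j => u j t) t (true, true).
have Lp2 : L2R `[b, b + 1]%classic p2.
  by apply: L2_B => //; [apply: L2_D => //; apply: L2_Z => //; exact: LB|exact: LB].
have Lq2 : L2R `[b, b + 1]%classic q2.
  by apply: L2_B => //; [apply: L2_B => //; apply: L2_Z => //; exact: LB|exact: LB].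
have t1 : u (false, false) b ^+ 2 + u (true, false) b ^+ 2 <=
    144 * Int `[b, b + 1]%classic (fun t => u (false, false) t ^+ 2 + p2 t ^+ 2).
  exact: trace_bound (A (false, false)) (A (true, false)) Lp2.
have t2 : u (false, true) b ^+ 2 + u (true, true) b ^+ 2 <=
    144 * Int `[b, b + 1]%classic (fun t => u (false, true) t ^+ 2 + q2 t ^+ 2).
  exact: trace_bound (A (false, true)) (A (true, true)) Lq2.
have L1s : L1 `[b, b + 1]%classic (fun t => sqn u t + ssqn S t).
  by apply: (L1_itvy _ b0); apply: L1D => //; [exact: L1_sqn|exact: L1_ssqn].
set C := 3 + 6 * (M ^+ 2 + al ^+ 2) + 3 * be ^+ 2.
have C0 : 0 <= C.
  by rewrite !addr_ge0// mulr_ge0// ?addr_ge0// sqr_ge0.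
have : Int `[b, b + 1]%classic (fun t => u (false, false) t ^+ 2 + p2 t ^+ 2) +
   Int `[b, b + 1]%classic (fun t => u (false, true) t ^+ 2 + q2 t ^+ 2) <=
   C * (Int `[b, b + 1]%classic (fun t => sqn u t + ssqn S t)).
  rewrite -RiD//; last 2 first.
    by apply: L1D => //; apply: L2_L1 => //; exact: LB.
    by apply: L1D => //; apply: L2_L1 => //; exact: LB.
  rewrite -RiZ//; apply: Ri_le => //.
  - by apply: L1D => //; apply: L1D => //; apply: L2_L1 => //; exact: LB.
  - exact: L1Z.
  move=> t; rewrite /= in_itv/= => /andP[bt _].
  have := VM t bt; rewrite ler_norml => /andP[v1 v2].
  rewrite /p2 /q2 /= /sqn /ssqn /C.
  move: (V t) (u (false, false) t) (u (false, true) t) (S false t) (S true t) v1 v2 => v p q F G v1 v2.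
  have v3 : (v - al) ^+ 2 <= 2 * (M ^+ 2 + al ^+ 2).
    have : 0 <= (M - v) * (M + v) by rewrite mulr_ge0//; lra.
    by have := sqr_ge0 (v + al); lra.
  have p3 : ((v - al) * p + be * q - F) ^+ 2 <= 3 * ((v - al) ^+ 2 * p ^+ 2 + be ^+ 2 * q ^+ 2 + F ^+ 2).
    have := sqr_ge0 ((v - al) * p - be * q); have := sqr_ge0 ((v - al) * p + F).
    have := sqr_ge0 (be * q + F); lra.
  have q3 : ((v - al) * q - be * p - G) ^+ 2 <= 3 * ((v - al) ^+ 2 * q ^+ 2 + be ^+ 2 * p ^+ 2 + G ^+ 2).
    have := sqr_ge0 ((v - al) * q + be * p); have := sqr_ge0 ((v - al) * q + G).
    have := sqr_ge0 (be * p - G); lra.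
  have w1 := ler_wpM2r (sqr_ge0 p) v3; have w2 := ler_wpM2r (sqr_ge0 q) v3.
  have : 0 <= (6 * (M ^+ 2 + al ^+ 2) + 3 * be ^+ 2) * (F ^+ 2 + G ^+ 2).
    by nneg.
  have := sqr_ge0 p; have := sqr_ge0 q; lra.
rewrite (@RiD _ _ (sqn u) (ssqn S))//; last 2 first.
  exact: L1_itvy (L1_sqn Lu).
  exact: L1_itvy (L1_ssqn LS).
have i1 : Int `[b, b + 1]%classic (sqn u) <= Int `[b, +oo[%classic (sqn u).
  apply: Ri_le_sub => //; [exact: itv_suby|exact: L1_itvyy (L1_sqn Lu)|by move=> t _; exact: sqn_ge0].
have i2 : Int `[b, b + 1]%classic (ssqn S) <= Int `[b, +oo[%classic (ssqn S).
  apply: Ri_le_sub => //; [exact: itv_suby|exact: L1_itvyy (L1_ssqn LS)|by move=> t _; exact: ssqn_ge0].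
have := ler_wpM2l C0 (lerD i1 i2).
rewrite /trace_cst -/C; lra.
Qed.

End StarOperator.

(** * Unique solvability on the star under self-adjoint vertex conditions *)

Section StarResolvent.
Context {R : realType}.
Notation mu := (@lebesgue_measure R).
Notation half := (`[0, +oo[%classic : set R).
Variables (al be : R) (n : nat) (V : 'I_n -> R -> R) (M : R) (b : R).
Variable L : 'I_n -> ('I_n -> R) -> ('I_n -> R) -> R.
Hypotheses (be0 : be != 0)
  (mV : forall j, measurable_fun half (V j))
  (VM : forall j (t : R), 0 <= t -> `|V j t| <= M)
  (Vb : forall j (t : R), b < t -> V j t = 0)
  (Llin : forall k x x' y y' s,
     L k (fun j => x j + s * x' j) (fun j => y j + s * y' j) = L k x y + s * L k x' y')
  (Liso : forall x y x' y', (forall k, L k x y = 0) -> (forall k, L k x' y' = 0) ->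
     \sum_j (y j * x' j - y' j * x j) = 0).

Implicit Types (f : R -> R) (S : 'I_n -> bool -> R -> R) (U : 'I_n -> bool * bool -> R -> R).

(* The vertex conditions are L k x y = 0 for the vectors x of values and y of
   outgoing derivatives at the vertex; Liso is their self-adjointness. *)
Definition star_sol S U := [/\ forall j, edge_sol al be (V j) (S j) (U j),
  forall j k, L2R half (U j k) &
  forall k r, L k (fun j => U j (false, r) 0) (fun j => U j (true, r) 0) = 0].

(** The resolvent bound 1/|Im zeta|: summed over the edges, the boundary terms of [edge_energy]
    cancel by [Liso], and the source term is absorbed by the weighted inequality of squares. *)
Lemma star_bound S U : star_sol S U -> (forall j r, L2R half (S j r)) ->
  \sum_j Int half (sqn (U j)) <= (be ^+ 2)^-1 * \sum_j Int half (ssqn (S j)).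
Proof.
move=> [AU LU vc] LS.
have LSU j : L1 half (fun t => S j false t * U j (false, true) t - S j true t * U j (false, false) t).
  by apply: L1B => //; exact: L2_M.
have E j := edge_energy (AU j) (LU j) (LS j) (lexx 0).
have be2 : 0 < be ^+ 2 by rewrite exprn_even_gt0.
rewrite ler_pdivlMl//.
have iso := Liso (fun k => vc k false) (fun k => vc k true).
have H j : be * Int half (fun t => S j false t * U j (false, true) t - S j true t * U j (false, false) t) <=
   2^-1 * (be ^+ 2 * Int half (sqn (U j))) + 2^-1 * Int half (ssqn (S j)).
  have L1s := L1_sqn (LU j); have L1S := L1_ssqn (LS j).
  rewrite -!RiZ//; last exact: L1Z.
  rewrite -RiD//; last 2 first.
    by apply: L1Z => //; exact: L1Z.
    exact: L1Z.
  apply: Ri_le => //; first exact: L1Z.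
    by apply: L1D => //; apply: L1Z => //; exact: L1Z.
  move=> t _; rewrite /sqn /ssqn.
  have := sqr_ge0 (be * U j (false, true) t - S j false t).
  have := sqr_ge0 (be * U j (false, false) t + S j true t); lra.
have E2 : be * (be * \sum_j Int half (sqn (U j))) =
   \sum_j (be * Int half (fun t => S j false t * U j (false, true) t - S j true t * U j (false, false) t)).
  rewrite -mulr_sumr; congr (be * _); rewrite mulr_sumr.
  under eq_bigr do rewrite E.
  by rewrite sumrB iso subr0.
have := ler_sum (index_enum 'I_n) (fun j (_ : xpredT j) => H j).
rewrite -E2 big_split/= -!mulr_sumr mulrA -expr2; lra.
Qed.

(** [star_bound] makes the integrals of |u|^2 vanish, and [edge_trace] at an arbitrary point t turns
    this into pointwise vanishing of the solution and its derivative. *)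
Lemma star_unique U : star_sol (fun _ _ _ => 0) U -> forall j k (t : R), 0 <= t -> U j k t = 0.
Proof.
move=> sU j k t t0; have [AU LU vc] := sU.
have L0 : L2R half (fun=> 0 : R).
  split; first exact: measurable_cst.
  by apply: (@L1_ext _ _ (fun=> 0)) => // [x _|]; [rewrite expr0n|exact: integrable0].
have L1s := L1_sqn (LU j).
have I0 : Int half (fun t => ssqn (fun _ _ => 0 : R) t) = 0.
  rewrite (@Ri_ext _ _ _ (fun=> 0 * 0)) => [|x _]; last by rewrite /ssqn expr0n addr0 mul0r.
  by rewrite RiZ ?mul0r//; exact: integrable0.
have := star_bound sU (fun _ _ => L0); rewrite [X in _ <= _ * X]big1 => [|i _]; last exact: I0.
rewrite mulr0 => H.
have Hj : Int half (sqn (U j)) <= 0.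
  apply: le_trans H; rewrite (bigD1 j)//= lerDl sumr_ge0// => i _.
  by apply: Ri_ge0 => s _; exact: sqn_ge0.
have VMt (s : R) : t <= s -> `|V j s| <= M by move=> ts; apply: VM; exact: le_trans ts.
have := edge_trace (AU j) (LU j) (fun _ => L0) t0 (mV j) VMt.
have i1 : Int `[t, +oo[%classic (sqn (U j)) <= 0.
  apply: le_trans Hj; apply: Ri_le_sub => //; first exact: itvy_suby.
  by move=> s _; exact: sqn_ge0.
have i2 : Int `[t, +oo[%classic (ssqn (fun _ _ => 0 : R)) <= 0.
  rewrite -[leRHS]I0; apply: Ri_le_sub => //; first exact: itvy_suby.
    by apply: L1_ssqn.
  by move=> s _; exact: ssqn_ge0.
move=> /le_trans/(_ (ler_wpM2l (trace_cst_ge0 _ _ M) (lerD i1 i2))); rewrite addr0 mulr0 => T.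
have := sqr_ge0 (U j (false, false) t); have := sqr_ge0 (U j (false, true) t).
have := sqr_ge0 (U j (true, false) t); have := sqr_ge0 (U j (true, true) t) => *.
apply/eqP; rewrite -sqrf_eq0 eq_le sqr_ge0 andbT.
by case: k => [[] []]; lra.
Qed.

Lemma L2_compact_support f : measurable_fun half f -> (forall t : R, b < t -> f t = 0) ->
  (forall x, 0 <= x -> L2R `[0, x]%classic f) -> L2R half f.
Proof.
move=> mf fb Lf.
set c := `|b| + 1; have c0 : 0 <= c by rewrite addr_ge0.
have bc : b < c by rewrite (le_lt_trans (ler_norm b))// ltrDl.
set T := Int `[0, c]%classic (fun t => f t ^+ 2).
suff [] : L1 half (fun t => f t ^+ 2) /\ Int half (fun t => f t ^+ 2) <= T by move=> ? _; split.
apply: L1_halfline.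
- exact: measurable_funX.
- by move=> x _; exact: sqr_ge0.
- by move=> x x0; apply: L2_L1; exact: Lf.
move=> x x0; have [xb|cx] := leP x c.
  apply: Ri_le_sub => //; [exact: itv_sub|by apply: L2_L1; exact: Lf|by move=> t _; exact: sqr_ge0].
rewrite (@Ri_cat _ 0 c x) ?c0 ?(ltW cx)//; last by apply: L2_L1; exact: Lf.
rewrite -[leRHS]addr0 lerD2l (@Ri_ext _ _ _ (fun=> 0)) ?Ri_cst ?mul0r// ?ltW//.
by move=> t; rewrite /= in_itv/= => /andP[ct _]; rewrite fb ?expr0n// (lt_le_trans bc).
Qed.

Variables (kap om : R).
Hypotheses (kap0 : 0 < kap) (kapom : kap ^+ 2 - om ^+ 2 = - al) (kapbe : 2 * kap * om = - be).
Implicit Types (u : bool * bool -> R -> R).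

Definition hR u t : R := - u (true, false) t + kap * u (false, false) t - om * u (false, true) t.
Definition hI u t : R := - u (true, true) t + kap * u (false, true) t + om * u (false, false) t.
Definition decay_form u (r : bool) t : R :=
  if r then ER kap om t * hI u t + EI kap om t * hR u t
  else ER kap om t * hR u t - EI kap om t * hI u t.

(* Vanishes exactly on the solutions that decay at infinity: it is the limit
   of e^(- mu x) u(x), with mu = kap + i om. *)
Definition growth u (r : bool) : R := u (false, r) 0 - Int half (decay_form u r).

(** Moves the potential into the source. [V] has bounded support, so the product is
    square-integrable even for a growing solution, and the constant-coefficient analysis of the
    half-line applies. *)
Let src u (S : bool -> R -> R) (v : R -> R) (r : bool) t : R := S r t - v t * u (false, r) t.

Let src_sol j (S : bool -> R -> R) u : edge_sol al be (V j) S u ->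
  edge_sol al be (fun=> 0) (src u S (V j)) u.
Proof.
move=> Au k x x0; apply: AC_ext (Au k x x0) => // t _.
by case: k => [[] []] //=; rewrite /src; ring.
Qed.

Let L2_src j (S : bool -> R -> R) u r : edge_sol al be (V j) S u -> (forall r, L2R half (S r)) ->
  L2R half (src u S (V j) r).
Proof.
move=> Au LS; apply: L2_B => //; apply: L2_compact_support.
- apply: measurable_funM => //; apply: AC_measurable_halfline => x; exact: Au.
- by move=> t bt; rewrite Vb// mul0r.
move=> x x0; apply: (@L2_Mbdd _ _ _ _ M) => //.
- by apply: measurable_funS (mV j) => //; exact: itv_suby.
- by move=> t; rewrite /= in_itv/= => /andP[t0 _]; exact: VM.
- exact: AC_L2 (Au (false, r) x x0).
Qed.

Lemma L2_hRI j (S : bool -> R -> R) u : edge_sol al be (V j) S u -> (forall r, L2R half (S r)) ->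
  (L2R half (hR u) /\ L2R half (hI u)) /\ forall r, L1 half (decay_form u r).
Proof.
move=> Au LS; have A0 := src_sol Au.
have E (k : bool * bool) x : 0 <= x -> AC 0 x (u k) _ := A0 k x.
have A1 x : 0 <= x -> AC 0 x (u (true, false)) (fun t => - al * u (false, false) t + be * u (false, true) t - src u S (V j) false t).
  by move=> x0; apply: AC_ext (A0 (true, false) x x0) => // t _ /=; ring.
have A2 x : 0 <= x -> AC 0 x (u (true, true)) (fun t => - al * u (false, true) t - be * u (false, false) t - src u S (V j) true t).
  by move=> x0; apply: AC_ext (A0 (true, true) x x0) => // t _ /=; ring.
have S1 := L2_src false Au LS; have S2 := L2_src true Au LS.
have h := L2_h kap0 kapom kapbe S1 S2 (Au (false, false)) A1 (Au (false, true)) A2.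
split; first exact: h.
have [e1 e2] := L1_Eh kap0 kapom kapbe S1 S2 (Au (false, false)) A1 (Au (false, true)) A2.
by case.
Qed.

Lemma growth0_L2 j (S : bool -> R -> R) u : edge_sol al be (V j) S u -> (forall r, L2R half (S r)) ->
  (forall r, growth u r = 0) -> forall k, L2R half (u k).
Proof.
move=> Au LS g0; have A0 := src_sol Au.
have A1 x : 0 <= x -> AC 0 x (u (true, false)) (fun t => - al * u (false, false) t + be * u (false, true) t - src u S (V j) false t).
  by move=> x0; apply: AC_ext (A0 (true, false) x x0) => // t _ /=; ring.
have A2 x : 0 <= x -> AC 0 x (u (true, true)) (fun t => - al * u (false, true) t - be * u (false, false) t - src u S (V j) true t).
  by move=> x0; apply: AC_ext (A0 (true, true) x x0) => // t _ /=; ring.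
have S1 := L2_src false Au LS; have S2 := L2_src true Au LS.
have [[HR HI] _] := L2_hRI Au LS.
have [Lp Lq] : L2R half (u (false, false)) /\ L2R half (u (false, true)).
  apply: (decaying_L2 kap0 kapom kapbe S1 S2 (Au (false, false)) A1 (Au (false, true)) A2).
    by apply/eqP; rewrite -subr_eq0; apply/eqP; exact: g0 false.
  by apply/eqP; rewrite -subr_eq0; apply/eqP; exact: g0 true.
case=> [[] []] //.
  apply: (@L2_ext _ _ (fun t => kap * u (false, true) t + om * u (false, false) t - hI u t)) => //.
    by move=> t _; rewrite /hI; ring.
  by apply: L2_B => //; apply: L2_D => //; exact: L2_Z.
apply: (@L2_ext _ _ (fun t => kap * u (false, false) t - om * u (false, true) t - hR u t)) => //.
  by move=> t _; rewrite /hR; ring.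
by apply: L2_B => //; apply: L2_B => //; exact: L2_Z.
Qed.

Lemma decay_form_comb (I : finType) u (c : I -> R) (v : I -> bool * bool -> R -> R) r t :
  decay_form (fun k t => u k t + \sum_i c i * v i k t) r t =
  decay_form u r t + \sum_i c i * decay_form (v i) r t.
Proof.
rewrite /decay_form /hR /hI; case: r.
- rewrite [X in _ = _ + X](_ : _ = ER kap om t * (- (\sum_i c i * v i (true, true) t) +
    kap * (\sum_i c i * v i (false, true) t) + om * (\sum_i c i * v i (false, false) t)) +
    EI kap om t * (- (\sum_i c i * v i (true, false) t) + kap * (\sum_i c i * v i (false, false) t)
    - om * (\sum_i c i * v i (false, true) t))).
    by ring.
  rewrite !mulrDr !mulrN !mulrA !mulr_sumr -!sumrN -!big_split/=; apply: eq_bigr => i _; ring.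
- rewrite [X in _ = _ + X](_ : _ = ER kap om t * (- (\sum_i c i * v i (true, false) t) +
    kap * (\sum_i c i * v i (false, false) t) - om * (\sum_i c i * v i (false, true) t)) -
    EI kap om t * (- (\sum_i c i * v i (true, true) t) + kap * (\sum_i c i * v i (false, true) t)
    + om * (\sum_i c i * v i (false, false) t))).
    by ring.
  rewrite !mulrDr !mulrN !mulrA !mulr_sumr -!sumrN -!big_split/= -?sumrN -?big_split/=; apply: eq_bigr => i _; ring.
Qed.

Lemma growth_comb (I : finType) j (S : bool -> R -> R) u (c : I -> R) (v : I -> bool * bool -> R -> R) r :
  edge_sol al be (V j) S u -> (forall r, L2R half (S r)) ->
  (forall i, edge_sol al be (V j) (fun _ _ => 0) (v i)) ->
  growth (fun k t => u k t + \sum_i c i * v i k t) r =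
  growth u r + \sum_i c i * growth (v i) r.
Proof.
move=> Au LS Av.
have L0 : L2R half (fun=> 0 : R).
  split; first exact: measurable_cst.
  by apply: (@L1_ext _ _ (fun=> 0)) => // [x _|]; [rewrite expr0n|exact: integrable0].
have [_ Lu] := L2_hRI Au LS.
have Lv i := (L2_hRI (Av i) (fun _ => L0)).2.
rewrite /growth (Ri_ext (fun t _ => decay_form_comb u c v r t)) RiD//; last first.
  by apply: L1_sum => // i; exact: L1Z.
rewrite Ri_sum//; last by move=> i; exact: L1Z.
under [in RHS]eq_bigr do rewrite mulrBr -RiZ//.
by rewrite sumrB; ring.
Qed.

(** A particular solution on each edge is corrected by the four real fundamental solutions of the
    homogeneous equation; solving for the coefficients is a square linear problem, injective by
    [star_unique]. *)
Lemma star_exists S : (forall j r, L2R half (S j r)) -> exists U, star_sol S U.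
Proof.
move=> LS.
have L0 : L2R half (fun=> 0 : R).
  split; first exact: measurable_cst.
  by apply: (@L1_ext _ _ (fun=> 0)) => // [x _|]; [rewrite expr0n|exact: integrable0].
have LSx j r x : 0 <= x -> L1 `[0, x]%classic (S j r).
  by move=> x0; apply: L2_integrable; exact: L2_itvy (LS j r).
have exP j : {u | edge_sol al be (V j) (S j) u & forall k, u k 0 = 0}.
  by apply: cid2; exact: edge_sol_exists (mV j) (VM j) (LSx j).
have exE j (l : bool * bool) : {u | edge_sol al be (V j) (fun _ _ => 0) u & forall k, u k 0 = (k == l)%:R}.
  apply: cid2; apply: edge_sol_exists (mV j) (VM j) _ => r x x0; exact: L1_cst.
pose P j := s2val (exP j); pose E j l := s2val (exE j l).
have AP j : edge_sol al be (V j) (S j) (P j) by exact: (s2valP (exP j)).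
have P0 j k : P j k 0 = 0 by exact: (s2valP' (exP j)).
have AE j l : edge_sol al be (V j) (fun _ _ => 0) (E j l) by exact: (s2valP (exE j l)).
have E0 j l k : E j l k 0 = (k == l)%:R by exact: (s2valP' (exE j l)).
pose I := ('I_n * (bool * bool))%type.
(* The 4n unknowns are the real and imaginary parts of the values and derivatives at the vertex. The
   4n equations are n vertex conditions and n growth conditions, each with two real parts. *)
pose Phi (c : I -> R) (i : I) : R := match i with
  | (j, (false, r)) => L j (fun j => c (j, (false, r))) (fun j => c (j, (true, r)))
  | (j, (true, r)) => \sum_l c (j, l) * growth (E j l) r end.
pose comb (c : I -> R) j k t := \sum_l c (j, l) * E j l k t.
have comb0 c j k : comb c j k 0 = c (j, k).
  rewrite /comb (bigD1 k)//= E0 eqxx mulr1 big1 ?addr0// => l lk.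
  by rewrite E0 eq_sym (negPf lk) mulr0.
have combA c j : edge_sol al be (V j) (fun _ _ => 0) (comb c j) by exact: edge_sol_sum.
have inj c : (forall i, Phi c i = 0) -> forall i, c i = 0.
  move=> Phi0 [j k]; rewrite -comb0; apply: (@star_unique (comb c)) => //; split=> //.
  - move=> {}j {}k; apply: (growth0_L2 (combA c j) (fun _ => L0)) => r.
    have := @growth_comb _ j (fun _ _ => 0) (fun _ _ => 0) (fun l => c (j, l)) (E j) r _ (fun _ => L0) (AE j).
    have -> : (fun (k : bool * bool) (t : R) => 0 + \sum_i c (j, i) * E j i k t) = comb c j.
      by apply/funext => ?; apply/funext => ?; rewrite add0r.
    rewrite [growth (fun _ _ => 0) r](_ : _ = 0); last first.
      rewrite /growth (@Ri_ext _ _ _ (fun=> 0 * 0)) => [|t _].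
        by rewrite RiZ ?mul0r ?subr0//; exact: integrable0.
      by rewrite /decay_form /hR /hI; case: r; ring.
    rewrite add0r => ->; first exact: (Phi0 (j, (true, r))).
    by move=> l x _; apply: AC_ext (AC_cst 0 x 0) => // t _; case: l => [[] []] /=; ring.
  - move=> {}k r; rewrite -[RHS](Phi0 (k, (false, r))) /Phi.
    by congr L; apply/funext => ?; rewrite comb0.
have lin c c' s k : Phi (fun i => c i + s * c' i) k = Phi c k + s * Phi c' k.
  case: k => j [[] r] /=; last exact: Llin.
  by rewrite mulr_sumr -big_split/=; apply: eq_bigr => l _; ring.
have [c cE] := linear_surjective lin inj
  (fun i => match i with (j, (false, r)) => 0 | (j, (true, r)) => - growth (P j) r end).
exists (fun j k t => P j k t + comb c j k t).
have A j : edge_sol al be (V j) (S j) (fun k t => P j k t + comb c j k t).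
  move=> k x x0; have H := edge_sol_comb 1 (AP j) (combA c j).
  apply: AC_ext (H k x x0) => t _.
    by rewrite mul1r.
  by case: k => [[] []] /=; ring.
split=> //.
- move=> j; apply: (growth0_L2 (A j) (LS j)) => r.
  rewrite (@growth_comb _ j _ _ (fun l => c (j, l)) (E j) r (AP j) (LS j) (AE j)).
  by have := cE (j, (true, r)); rewrite /Phi => ->; rewrite subrr.
- move=> k r; have cE0 : L k _ _ = 0 := cE (k, (false, r)); rewrite -[RHS]cE0.
  by congr (L k _ _); apply/funext => j; rewrite P0 add0r comb0.
Qed.

End StarResolvent.

(** * Zero modes and the Neumann problem on the compact star *)

Section ZeroModes.
Context {R : realType}.
Notation mu := (@lebesgue_measure R).
Implicit Types (f g Q F : R -> R) (b t x y M dl : R).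

Lemma energy_bound_real b f f1 Q F M x y :
  AC 0 b f f1 -> AC 0 b f1 (fun t => Q t * f t - F t) ->
  (forall t, 0 <= t <= b -> `|Q t| <= M) -> L2R `[0, b]%classic F ->
  0 <= x <= b -> 0 <= y <= b ->
  f x ^+ 2 + f1 x ^+ 2 <= expR ((2 + 2 * M ^+ 2) * b) *
    (f y ^+ 2 + f1 y ^+ 2 + 2 * Int `[0, b]%classic (fun t => F t ^+ 2)).
Proof.
move=> Af Af1 QM LF xb yb.
have L2F : L1 `[0, b]%classic (fun t => 2 * F t ^+ 2) by apply: L1Z => //; exact: L2_L1.
have h0 : AC 0 b (fun=> 0 : R) (fun=> 0) by exact: AC_cst.
have M0 : 0 <= 2 * M ^+ 2 by nneg.
have := energy_bound M0 Af Af1 h0 h0 L2F _ _ xb yb.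
rewrite !expr0n /= !addr0 RiZ//; last exact: L2_L1.
apply; first by move=> t _; nneg.
move=> t tb; have := QM t tb; rewrite ler_norml => /andP[q1 q2].
rewrite /= !addr0.
have : 0 <= (M - Q t) * (M + Q t) by rewrite mulr_ge0//; lra.
move=> /(mulr_ge0 (sqr_ge0 (f t))); have := sqr_ge0 (Q t * f t + F t); lra.
Qed.

Variables (n m : nat) (a : 'I_n -> R) (Q : 'I_n -> R -> R) (M : R).
Variables (psi : 'I_m -> 'I_n -> R -> R) (sigma : 'I_m -> 'I_n).
Hypotheses (a0 : forall j, 0 < a j)
  (mQ : forall j, measurable_fun (`[0, +oo[%classic : set R) (Q j))
  (QM : forall j (t : R), 0 <= t -> `|Q j t| <= M).

Definition zero_mode (phi phi1 : 'I_n -> R -> R) := [/\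
  forall j, AC 0 (a j) (phi j) (phi1 j),
  forall j, AC 0 (a j) (phi1 j) (fun t => Q j t * phi j t),
  forall i j, phi i 0 = phi j 0,
  \sum_j phi1 j 0 = 0 &
  forall j, phi1 j (a j) = 0].

Let M0 (j : 'I_n) : 0 <= M. Proof. exact: le_trans (normr_ge0 _) (QM j (lexx 0)). Qed.

Lemma L2_Q j f f1 : AC 0 (a j) f f1 -> L2R `[0, a j]%classic (fun t => Q j t * f t).
Proof.
move=> Af; apply: (@L2_Mbdd _ _ _ _ M) => //; last exact: AC_L2 Af.
  by apply: measurable_funS (mQ j) => //; exact: itv_suby.
by move=> t; rewrite /= in_itv/= => /andP[t0 _]; exact: QM.
Qed.

Lemma H2R_AC D f f1 f2 x : H2R D f f1 f2 -> 0 <= x -> `[0, x]%classic `<=` D ->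
  AC 0 x f f1 /\ AC 0 x f1 f2.
Proof.
move=> [_ [_ [_ [_ H]]]] x0 sub.
have [|L1f [L2f _]] := H x; first by apply: sub; rewrite /= in_itv/= x0 lexx.
split; split=> // t t0x; have [|_ [_ [e1 e2]]] := H t; rewrite ?IntE//;
  by apply: sub; rewrite /= in_itv.
Qed.

Lemma solR_zero_mode phi : solR a Q phi -> exists phi1, zero_mode phi phi1.
Proof.
move=> [d1 [d2 [H [E [c [k nm]]]]]]; exists d1.
have A j : AC 0 (a j) (phi j) (d1 j) /\ AC 0 (a j) (d1 j) (d2 j).
  by apply: H2R_AC (H j) _ _ => //; exact: ltW.
split=> // j; first exact: (A j).1.
apply: AC_ae (A j).2 _ _; first by have [] := L2_Q (A j).1.
by apply: ae_imply (E j) => x Ex xa; have := Ex xa; lra.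
Qed.

Lemma zero_mode_solR phi phi1 : zero_mode phi phi1 -> solR a Q phi.
Proof.
move=> [A A1 c k nm]; exists phi1, (fun j t => Q j t * phi j t); split; last first.
  by split=> // j; apply: aeW => x _; rewrite addrC subrr.
move=> j; split; first by rewrite /= in_itv/= lexx ltW.
split; first exact: AC_L2 (A j).
split; first exact: AC_L2 (A1 j).
split; first exact: L2_Q (A j).
move=> x; rewrite /= in_itv/= => /andP[x0 xa].
have B := AC_sub (lexx _) xa (A j); have B1 := AC_sub (lexx _) xa (A1 j).
split; first by case: B.
split; first by case: B1.
case: B B1 => _ B [_ B1]; rewrite -!IntE; split.
  by rewrite B ?x0 ?lexx.
by rewrite B1 ?x0 ?lexx.
Qed.

Hypotheses (sol : forall i, solR a Q (psi i))
  (norm : forall i k, psi i (sigma k) (a (sigma k)) = (i == k)%:R)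
  (span : forall phi, solR a Q phi -> exists c : 'I_m -> R,
     forall j x, 0 <= x <= a j -> phi j x = \sum_(i < m) c i * psi i j x).

Let unit_sol j (y0 y1 : R) : {f : (R -> R) * (R -> R) |
  [/\ AC 0 (a j) f.1 f.2, AC 0 (a j) f.2 (fun t => Q j t * f.1 t),
   f.1 0 = y0 & f.2 0 = y1]}.
Proof.
(* The complex edge equation at zeta = 0 decouples, so its real part serves as a solver for the real
   equation. *)
apply: cid; have [|u Au u0] := @edge_sol_exists R 0 0 (Q j) (fun _ _ => 0) M
  (fun k => match k with (false, false) => y0 | (true, false) => y1 | _ => 0 end) (mQ j) (QM j).
  by move=> r x x0; exact: L1_cst.
exists (u (false, false), u (true, false)); split=> /=.
- exact: (Au (false, false) _ (ltW (a0 j))).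
- by apply: AC_ext (Au (true, false) _ (ltW (a0 j))) => // t _ /=; ring.
- by rewrite u0.
- by rewrite u0.
Qed.

(** By the normalization, the coefficients of a zero mode in the basis are its values at the ends
    [a (sigma k)]. *)
Lemma zero_mode_value0 phi phi1 : zero_mode phi phi1 ->
  (forall k, phi (sigma k) (a (sigma k)) = 0) ->
  forall j x, 0 <= x <= a j -> phi j x = 0.
Proof.
move=> Z v0; have [c cE] := span (zero_mode_solR Z).
have c0 k : c k = 0.
  have := cE (sigma k) (a (sigma k)); rewrite lexx (ltW (a0 _)) v0 => /(_ isT).
  rewrite (bigD1 k)//= norm eqxx mulr1 big1 ?addr0// => i ik.
  by rewrite norm (negPf ik) mulr0.
by move=> j x xa; rewrite cE// big1// => i _; rewrite c0 mul0r.
Qed.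

(* On the complement of the zero modes the Neumann problem is a finite linear
   system in the data (W(0), W_1'(0), ..., W_n'(0)) at the vertex, which is
   injective and hence bounded below. *)
Lemma inner_estimate0 : exists2 C, 0 <= C & forall (W W1 F : 'I_n -> R -> R) dl, 0 <= dl ->
  (forall j, AC 0 (a j) (W j) (W1 j)) ->
  (forall j, AC 0 (a j) (W1 j) (fun t => Q j t * W j t - F j t)) ->
  (forall j, L2R `[0, a j]%classic (F j)) ->
  (forall j, Int `[0, a j]%classic (fun t => F j t ^+ 2) <= dl ^+ 2) ->
  (forall i j, W i 0 = W j 0) -> \sum_j W1 j 0 = 0 ->
  (forall j, `|W1 j (a j)| <= dl) ->
  (forall k, W (sigma k) (a (sigma k)) = 0) ->
  forall j x, 0 <= x <= a j -> `|W j x| <= C * dl.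
Proof.
have [j0|no] := pselect (exists j : 'I_n, True); last first.
  exists 0 => // W W1 F dl _ _ _ _ _ _ _ _ _ j; exfalso; apply: no; by exists j.
have [{}j0 _] := cid j0.
pose X j := sval (unit_sol j 1 0); pose Y j := sval (unit_sol j 0 1).
have [AX AX1 X0 X10] : [/\ forall j, AC 0 (a j) (X j).1 (X j).2,
    forall j, AC 0 (a j) (X j).2 (fun t => Q j t * (X j).1 t), forall j, (X j).1 0 = 1 & forall j, (X j).2 0 = 0].
  by split=> j; rewrite /X; case: (unit_sol j 1 0) => f [].
have [AY AY1 Y0 Y10] : [/\ forall j, AC 0 (a j) (Y j).1 (Y j).2,
    forall j, AC 0 (a j) (Y j).2 (fun t => Q j t * (Y j).1 t), forall j, (Y j).1 0 = 0 & forall j, (Y j).2 0 = 1].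
  by split=> j; rewrite /Y; case: (unit_sol j 0 1) => f [].
move: X Y AX AX1 X0 X10 AY AY1 Y0 Y10 => X Y AX AX1 X0 X10 AY AY1 Y0 Y10.
(* [None] stands for the common value at the vertex, [Some j] for the outgoing derivative on edge j.
   The n + 1 + m equations are the Neumann conditions, the Kirchhoff sum and the prescribed values
   at the ends [sigma k]; being overdetermined, they call for a left inverse. *)
pose I := option 'I_n; pose J := ('I_n + (unit + 'I_m))%type.
pose f (c : I -> R) j t := c None * (X j).1 t + c (Some j) * (Y j).1 t.
pose f1 (c : I -> R) j t := c None * (X j).2 t + c (Some j) * (Y j).2 t.
have Af c j : AC 0 (a j) (f c j) (f1 c j) by exact: AC_D (AC_Z _ (AX j)) (AC_Z _ (AY j)).
have Af1 c j : AC 0 (a j) (f1 c j) (fun t => Q j t * f c j t).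
  by apply: AC_ext (AC_D (AC_Z (c None) (AX1 j)) (AC_Z (c (Some j)) (AY1 j))) => // t _; rewrite /f; ring.
have f0 c j : f c j 0 = c None by rewrite /f X0 Y0; ring.
have f10 c j : f1 c j 0 = c (Some j) by rewrite /f1 X10 Y10; ring.
pose Phi (c : I -> R) (i : J) : R := match i with
  | inl j => f1 c j (a j)
  | inr (inl _) => \sum_j c (Some j)
  | inr (inr k) => f c (sigma k) (a (sigma k)) end.
have lin c c' s k : Phi (fun i => c i + s * c' i) k = Phi c k + s * Phi c' k.
  case: k => [j|[_|k]] /=; rewrite /f1 /f; [by ring| |by ring].
  by rewrite big_split/= -mulr_sumr.
have inj c : (forall k, Phi c k = 0) -> forall l, c l = 0.
  move=> Phi0.
  have Z : zero_mode (f c) (f1 c).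
    split=> //.
    - by move=> i j; rewrite !f0.
    - by under eq_bigr do rewrite f10; exact: (Phi0 (inr (inl tt))).
    - by move=> j; exact: (Phi0 (inl j)).
  have z := zero_mode_value0 Z (fun k => Phi0 (inr (inr k))).
  have z0 j x : 0 <= x <= a j -> f1 c j x = c (Some j).
    move=> /[dup] xa /andP[x0 xaj].
    have := AC_diff (Af1 c j) (lexx _) x0 xaj.
    rewrite f10 (@Ri_ext _ _ _ (fun=> 0)) => [|t]; first by rewrite Ri_cst// mul0r; lra.
    by rewrite /= in_itv/= => /andP[t0 tx]; rewrite z ?mulr0// t0 (le_trans tx).
  case=> [j|]; last by rewrite -(f0 c j0) z// lexx ltW.
  have := AC_diff (Af c j) (lexx _) (ltW (a0 j)) (lexx _).
  rewrite !z ?lexx ?(ltW (a0 j))// subrr (@Ri_ext _ _ _ (fun=> c (Some j))) => [|t]; last first.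
    by rewrite /= in_itv/=; exact: z0.
  rewrite Ri_cst ?(ltW (a0 j))// subr0 => /esym/eqP.
  by rewrite mulf_eq0 (gt_eqF (a0 j)) orbF => /eqP.
have [L LE] := linear_left_inverse lin inj.
pose K := 2 + 2 * M ^+ 2.
(* A sum in place of a maximum, and 1 + 2 e in place of the square root of 2 e; the same majorants
   recur below. *)
pose beta := \sum_j (1 + 2 * expR (K * a j)).
have beta0 : 0 <= beta by apply: sumr_ge0 => j _; rewrite addr_ge0// mulr_ge0// expR_ge0.
pose Lam := \sum_l \sum_k `|L l k|.
have Lam0 : 0 <= Lam by apply: sumr_ge0 => l _; exact: sumr_ge0.
have [bX bXE] : exists bX : 'I_n -> R, forall j x, 0 <= x <= a j -> `|(X j).1 x| <= bX j.
  by eexists => j x xa; exact: AC_bdd (AX j) xa.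
have [bY bYE] : exists bY : 'I_n -> R, forall j x, 0 <= x <= a j -> `|(Y j).1 x| <= bY j.
  by eexists => j x xa; exact: AC_bdd (AY j) xa.
have a00 j : (0 : R) <= 0 <= a j by rewrite lexx ltW.
have bX0 j : 0 <= bX j by have := bXE j 0 (a00 j); have := normr_ge0 ((X j).1 0); lra.
have bY0 j : 0 <= bY j by have := bYE j 0 (a00 j); have := normr_ge0 ((Y j).1 0); lra.
pose B := \sum_j (bX j + bY j).
have B0 : 0 <= B by apply: sumr_ge0 => j _; exact: addr_ge0.
exists (Lam * (1 + beta) * B + beta); first by rewrite addr_ge0// !mulr_ge0// addr_ge0.
move=> W W1 F dl dl0 AW AW1 LF Fdl Wc Wk Wn W0.
(* [f c] is the homogeneous solution with the Cauchy data of W at the vertex. Their difference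
   starts from zero data and is O(dl) by the growth bound; so [Phi c] is O(dl), hence [c], hence
   W. *)
pose c (i : I) : R := if i is Some j then W1 j 0 else W j0 0.
have E j x : 0 <= x <= a j -> `|W j x - f c j x| <= beta * dl /\ `|W1 j x - f1 c j x| <= beta * dl.
  move=> xa; have AE := AC_B (AW j) (Af c j).
  have AE1 : AC 0 (a j) (fun t => W1 j t - f1 c j t) (fun t => Q j t * (W j t - f c j t) - F j t).
    by apply: AC_ext (AC_B (AW1 j) (Af1 c j)) => // t _; ring.
  have QMa t : 0 <= t <= a j -> `|Q j t| <= M by move=> /andP[t0 _]; exact: QM.
  have := energy_bound_real AE AE1 QMa (LF j) xa (_ : (0 : R) <= 0 <= a j); rewrite lexx (ltW (a0 j)) => /(_ isT).
  rewrite f0 f10 (Wc j j0) !subrr !expr0n /= !add0r -/K.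
  set e := expR _ => H.
  have e1 : 1 <= e by rewrite -expR0 ler_expR mulr_ge0 ?(ltW (a0 j))// /K; nneg.
  have eb : 1 + 2 * e <= beta.
    by rewrite /beta (bigD1 j)//= lerDl sumr_ge0// => i _; rewrite addr_ge0// mulr_ge0// expR_ge0.
  have {}H : (W j x - f c j x) ^+ 2 + (W1 j x - f1 c j x) ^+ 2 <= (beta * dl) ^+ 2.
    apply: (le_trans H); apply: (@le_trans _ _ (e * (2 * dl ^+ 2))).
      by rewrite !ler_wpM2l// ?expR_ge0// Fdl.
    rewrite exprMn mulrA ler_wpM2r ?sqr_ge0//.
    have : 2 * e <= (1 + 2 * e) ^+ 2 by have := sqr_ge0 e; lra.
    rewrite mulrC => /le_trans; apply; rewrite ler_sqr ?nnegrE//; lra.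
  have bd0 : 0 <= beta * dl by rewrite mulr_ge0.
  split; rewrite -ler_sqr ?nnegrE// real_normK ?num_real//.
    by have := sqr_ge0 (W1 j x - f1 c j x); lra.
  by have := sqr_ge0 (W j x - f c j x); lra.
have PhiB k : `|Phi c k| <= (1 + beta) * dl.
  rewrite mulrDl mul1r; case: k => [j|[_|k]] /=.
  - have [|_ h] := E j (a j); first by rewrite lexx ltW.
    rewrite -(subKr (W1 j (a j)) (f1 c j (a j))) (le_trans (ler_normB _ _))// lerD// Wn.
  - by rewrite Wk normr0 addr_ge0// mulr_ge0.
  - have [|h _] := E (sigma k) (a (sigma k)); first by rewrite lexx ltW.
    by rewrite -normrN -[X in `|X|]add0r -{1}(W0 k) (le_trans h)// lerDr.
have cB l : `|c l| <= Lam * (1 + beta) * dl.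
  rewrite LE (le_trans (ler_norm_sum _ _ _))//.
  apply: (@le_trans _ _ (\sum_k `|L l k| * ((1 + beta) * dl))).
    by apply: ler_sum => k _; rewrite normrM ler_wpM2l.
  rewrite -mulr_suml -[leRHS]mulrA ler_wpM2r ?mulr_ge0 ?addr_ge0//.
  by rewrite /Lam (bigD1 l)//= lerDl; apply: sumr_ge0 => i _; exact: sumr_ge0.
move=> j x xa; have [h _] := E j x xa.
rewrite -(subrK (f c j x) (W j x)) (le_trans (ler_normD _ _))// addrC [leRHS]mulrDl lerD//.
rewrite (le_trans (ler_normD _ _))// !normrM mulrAC.
have Bj : bX j + bY j <= B.
  by rewrite /B (bigD1 j)//= lerDl sumr_ge0// => i _; exact: addr_ge0.
apply: (@le_trans _ _ (Lam * (1 + beta) * dl * (bX j + bY j))); last first.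
  by rewrite ler_wpM2l// !mulr_ge0// addr_ge0.
by rewrite mulrDr lerD// ler_pM// ?bXE ?bYE.
Qed.

(** Subtracting the zero modes weighted by the values of W at the ends [sigma i] changes neither the
    source nor the Kirchhoff and Neumann data, and reduces to vanishing values at these ends. *)
Lemma inner_estimate : exists2 C, 0 <= C & forall (W W1 F : 'I_n -> R -> R) dl, 0 <= dl ->
  (forall j, AC 0 (a j) (W j) (W1 j)) ->
  (forall j, AC 0 (a j) (W1 j) (fun t => Q j t * W j t - F j t)) ->
  (forall j, L2R `[0, a j]%classic (F j)) ->
  (forall j, Int `[0, a j]%classic (fun t => F j t ^+ 2) <= dl ^+ 2) ->
  (forall i j, W i 0 = W j 0) -> \sum_j W1 j 0 = 0 ->
  (forall j, `|W1 j (a j)| <= dl) ->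
  forall j x, 0 <= x <= a j ->
    `|W j x - \sum_i W (sigma i) (a (sigma i)) * psi i j x| <= C * dl.
Proof.
have [C C0 H] := inner_estimate0; exists C => // W W1 F dl dl0 AW AW1 LF Fdl Wc Wk Wn.
pose w i := W (sigma i) (a (sigma i)).
pose p1 i := sval (cid (solR_zero_mode (sol i))).
have Z i : zero_mode (psi i) (p1 i) by exact: svalP (cid (solR_zero_mode (sol i))).
apply: (H (fun j x => W j x - \sum_i w i * psi i j x) (fun j x => W1 j x - \sum_i w i * p1 i j x) F dl) => //.
- by move=> j; apply: AC_B => //; apply: AC_sum => i; apply: AC_Z; case: (Z i).
- move=> j; have ACs : AC 0 (a j) (fun x => \sum_i w i * p1 i j x) (fun x => \sum_i w i * (Q j x * psi i j x)).
    by apply: AC_sum => i; apply: AC_Z; case: (Z i).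
  apply: AC_ext (AC_B (AW1 j) ACs) => // t _.
  have -> : \sum_i w i * (Q j t * psi i j t) = Q j t * \sum_i w i * psi i j t.
    by rewrite mulr_sumr; apply: eq_bigr => i _; ring.
  ring.
- move=> i j; rewrite (Wc i j); congr (_ - _); apply: eq_bigr => k _.
  by have [_ _ E _ _] := Z k; rewrite (E i j).
- rewrite sumrB Wk exchange_big/= big1 ?subr0// => i _.
  by rewrite -mulr_sumr; have [_ _ _ -> _] := Z i; rewrite mulr0.
- move=> j; rewrite big1 ?subr0// => i _.
  by have [_ _ _ _ ->] := Z i; rewrite mulr0.
- move=> k; rewrite (bigD1 k)//= norm eqxx mulr1 big1 ?addr0 ?subrr// => i ik.
  by rewrite norm (negPf ik) mulr0.
Qed.

End ZeroModes.

(** * Quantitative comparison of the scaled and the limit solution *)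

Section Convergence.
Context {R : realType}.
Notation mu := (@lebesgue_measure R).
Notation half := (`[0, +oo[%classic : set R).
Implicit Types (f g V : R -> R) (b t x y : R).

(** The potential is known to vanish strictly beyond the end of its segment, while [edge_trace]
    takes its bound at that end too. A change at one point leaves the integral equation intact. *)
Lemma edge_sol_modify al be V S u c : measurable_fun half V -> (forall r, L2R half (S r)) ->
  @edge_sol R al be V S u ->
  measurable_fun half (fun t => if t == c then 0 else V t) /\
  edge_sol al be (fun t => if t == c then 0 else V t) S u.
Proof.
move=> mV LS Au.
have mV' : measurable_fun half (fun t => if t == c then 0 else V t).
  apply: (@eq_measurable_fun _ _ _ _ _ (fun t => \1_(~` [set c]) t * V t)).
    move=> t _; rewrite indicE; case: eqVneq => [->|tc].
      by rewrite memNset ?mul0r//= => h; exact: h.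
    by rewrite mem_set ?mul1r//=; apply/eqP.
  apply: measurable_funM => //; apply: measurable_indic; exact: measurableC.
split=> // k x x0; apply: AC_ae (Au k x x0) _ _.
- have sub : `[0, x]%classic `<=` (half : set R) by exact: itv_suby.
  have mu_ l : measurable_fun `[0, x]%classic (u l) := AC_measurable (Au l x x0).
  have mS r : measurable_fun `[0, x]%classic (S r) by apply: measurable_funS (LS r).1.
  have mVx := measurable_funS (measurable_itv `[0, +oo[) sub mV'.
  case: k => [[] []] /=; [| | exact: mu_|exact: mu_].
    apply: measurable_funB => //; apply: measurable_funB => //; apply: measurable_funM => //.
    exact: measurable_funB.
  apply: measurable_funB => //; apply: measurable_funD => //; apply: measurable_funM => //.
  exact: measurable_funB.
- exists [set c]; split; [exact: measurable_set1|exact: lebesgue_measure_set1|].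
  move=> t /=; apply: contra_notP => /eqP tc _.
  by case: k => [[] []] //=; rewrite (negPf tc).
Qed.

Lemma ge0_sqr_le x y : 0 <= y -> x ^+ 2 <= y ^+ 2 -> `|x| <= y.
Proof. by move=> y0 h; rewrite -ler_sqr ?nnegrE// real_normK ?num_real. Qed.

Lemma normr_le_sqr x y : `|x| <= y -> x ^+ 2 <= y ^+ 2.
Proof.
move=> h; have y0 := le_trans (normr_ge0 x) h.
by rewrite -(real_normK (num_real x)) ler_sqr ?nnegrE.
Qed.

Variables (al be : R) (n m : nat) (a : 'I_n -> R) (Q : 'I_n -> R -> R) (M lam1 K A Bp Cin : R).
Variables (psi psi1 : 'I_m -> 'I_n -> R -> R) (sigma : 'I_m -> 'I_n).
Hypotheses (a0 : forall j, 0 < a j) (aA : forall j, a j <= A)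
  (mQ : forall j, measurable_fun half (Q j))
  (M0 : 0 <= M) (A0 : 0 <= A) (K0 : 0 <= K) (Bp0 : 0 <= Bp) (Cin0 : 0 <= Cin)
  (QM : forall j t, 0 <= t -> `|Q j t| <= M)
  (Qa : forall j t, a j < t -> Q j t = 0)
  (Zpsi : forall i, zero_mode a Q (psi i) (psi1 i))
  (psiB : forall i j x, 0 <= x <= a j -> `|psi i j x| <= Bp)
  (inner : forall (W W1 F : 'I_n -> R -> R) (dl : R), 0 <= dl ->
    (forall j, AC 0 (a j) (W j) (W1 j)) ->
    (forall j, AC 0 (a j) (W1 j) (fun t => Q j t * W j t - F j t)) ->
    (forall j, L2R `[0, a j]%classic (F j)) ->
    (forall j, Int `[0, a j]%classic (fun t => F j t ^+ 2) <= dl ^+ 2) ->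
    (forall i j, W i 0 = W j 0) -> \sum_j W1 j 0 = 0 ->
    (forall j, `|W1 j (a j)| <= dl) ->
    forall j x, 0 <= x <= a j ->
      `|W j x - \sum_i W (sigma i) (a (sigma i)) * psi i j x| <= Cin * dl).

Definition th i j : R := psi i j (a j).
Definition qc i k : R := \sum_(j < n) Int `[0, a j]%classic (fun x => Q j x * psi i j x * psi k j x).

Lemma th_bound i j : `|th i j| <= Bp.
Proof. by apply: psiB; rewrite lexx ltW. Qed.

Lemma qc_sym i k : qc i k = qc k i.
Proof. by apply: eq_bigr => j _; apply: Ri_ext => x _; ring. Qed.

(* For e = 0 these are the limit conditions: the first group is trivial and the
   second sum has the term y (sigma i) on the edges sigma k, where th is the
   Kronecker delta. *)
Definition approx_bc (e : R) (x y : 'I_n -> R) :=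
  (forall j, `|x j - \sum_i th i j * x (sigma i)| <= e) /\
  (forall i, `|\sum_j th i j * y j - lam1 * \sum_k qc i k * x (sigma k)| <= e).

(** Up to the symmetric form [Bf], the pairing of y with x' is y paired with the defect of x' in the
    first group, plus x' on the edges [sigma i] paired with the defect of (x, y) in the second. [Bf]
    cancels in the antisymmetric difference because [qc] is symmetric. Only one factor T appears,
    which the final absorption relies on. *)
Lemma approx_bc_isotropic (e T : R) (x y x' y' : 'I_n -> R) : 0 <= e -> 0 <= T ->
  approx_bc e x y -> approx_bc e x' y' ->
  (forall j, [/\ `|x j| <= T, `|y j| <= T, `|x' j| <= T & `|y' j| <= T]) ->
  `|\sum_j (y j * x' j - y' j * x j)| <= 2 * (n%:R + m%:R) * e * T.
Proof.
move=> e0 T0 h h' B.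
pose Bf (x x' : 'I_n -> R) := lam1 * \sum_i \sum_k qc i k * x (sigma k) * x' (sigma i).
have Bsym : Bf x x' = Bf x' x.
  rewrite /Bf; congr (_ * _); rewrite exchange_big/=; apply: eq_bigr => i _.
  by apply: eq_bigr => k _; rewrite qc_sym; ring.
have key u v u' : approx_bc e u v -> (forall j, `|u' j - \sum_i th i j * u' (sigma i)| <= e) ->
    (forall j, `|v j| <= T) -> (forall j, `|u' j| <= T) ->
    `|\sum_j v j * u' j - Bf u u'| <= (n%:R + m%:R) * e * T.
  move=> [_ h2] h1 vT uT.
  have -> : \sum_j v j * u' j - Bf u u' = \sum_j v j * (u' j - \sum_i th i j * u' (sigma i)) +
      \sum_i u' (sigma i) * (\sum_j th i j * v j - lam1 * \sum_k qc i k * u (sigma k)).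
    under [X in _ = X + _]eq_bigr do rewrite mulrBr.
    under [X in _ = _ + X]eq_bigr do rewrite mulrBr.
    rewrite !sumrB.
    have -> : \sum_j v j * (\sum_i th i j * u' (sigma i)) = \sum_i u' (sigma i) * (\sum_j th i j * v j).
      under eq_bigr do rewrite mulr_sumr.
      rewrite exchange_big/=; apply: eq_bigr => i _; rewrite mulr_sumr.
      by apply: eq_bigr => j _; ring.
    have -> : Bf u u' = \sum_i u' (sigma i) * (lam1 * \sum_k qc i k * u (sigma k)).
      rewrite /Bf mulr_sumr; apply: eq_bigr => i _; rewrite mulrCA; congr (_ * _).
      by rewrite mulr_sumr; apply: eq_bigr => k _; ring.
    ring.
  apply: (le_trans (ler_normD _ _)); rewrite !mulrDl lerD//.
  - apply: (le_trans (ler_norm_sum _ _ _)).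
    apply: (@le_trans _ _ (\sum_(j < n) e * T)).
      by apply: ler_sum => j _; rewrite normrM mulrC ler_pM.
    by rewrite sumr_const card_ord -[leLHS]mulr_natl mulrA.
  - apply: (le_trans (ler_norm_sum _ _ _)).
    apply: (@le_trans _ _ (\sum_(j < m) e * T)).
      by apply: ler_sum => j _; rewrite normrM mulrC ler_pM.
    by rewrite sumr_const card_ord -[leLHS]mulr_natl mulrA.
have k1 := key x y x' h h'.1 (fun j => let: And4 _ b _ _ := B j in b) (fun j => let: And4 _ _ b _ := B j in b).
have k2 := key x' y' x h' h.1 (fun j => let: And4 _ _ _ b := B j in b) (fun j => let: And4 b _ _ _ := B j in b).
rewrite sumrB; move: k1 k2; rewrite Bsym.
set s1 := \sum_j _; set s2 := \sum_j _; rewrite !ler_norml => /andP[a1 a2] /andP[b1 b2].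
by apply/andP; split; lra.
Qed.

Lemma approx_bcB e e' (x y x' y' : 'I_n -> R) : approx_bc e x y -> approx_bc e' x' y' ->
  approx_bc (e + e') (fun j => x j - x' j) (fun j => y j - y' j).
Proof.
move=> [h1 h2] [h1' h2']; split=> i.
  have -> : \sum_k th k i * (x (sigma k) - x' (sigma k)) =
      \sum_k th k i * x (sigma k) - \sum_k th k i * x' (sigma k).
    by rewrite -sumrB; apply: eq_bigr => k _; rewrite mulrBr.
  move: (h1 i) (h1' i); set s1 := \sum_k _; set s2 := \sum_k _.
  by rewrite !ler_norml => /andP[? ?] /andP[? ?]; apply/andP; split; lra.
have -> : \sum_j th i j * (y j - y' j) = \sum_j th i j * y j - \sum_j th i j * y' j.
  by rewrite -sumrB; apply: eq_bigr => k _; rewrite mulrBr.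
have -> : \sum_k qc i k * (x (sigma k) - x' (sigma k)) =
    \sum_k qc i k * x (sigma k) - \sum_k qc i k * x' (sigma k).
  by rewrite -sumrB; apply: eq_bigr => k _; rewrite mulrBr.
move: (h2 i) (h2' i); set s1 := \sum_k _; set s2 := \sum_k _; set s3 := \sum_k _; set s4 := \sum_k _.
by rewrite !ler_norml => /andP[? ?] /andP[? ?]; apply/andP; split; lra.
Qed.

Definition cp : R := 1 + m%:R * Bp + n%:R * Bp + `|lam1| * \sum_i \sum_k `|qc i k|.

Lemma cp_ge0 : 0 <= cp.
Proof.
rewrite !addr_ge0// ?mulr_ge0//.
by apply: sumr_ge0 => i _; exact: sumr_ge0.
Qed.

(** Serves for the change of the limit solution between the vertex and the points [eps * a j]. *)
Lemma approx_bc_small d (x y : 'I_n -> R) : 0 <= d ->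
  (forall j, `|x j| <= d) -> (forall j, `|y j| <= d) -> approx_bc (cp * d) x y.
Proof.
move=> d0 xd yd.
have q0 : 0 <= `|lam1| * \sum_i \sum_k `|qc i k|.
  by rewrite mulr_ge0//; apply: sumr_ge0 => i _; exact: sumr_ge0.
have n0 : 0 <= n%:R * Bp by rewrite mulr_ge0.
have m0 : 0 <= m%:R * Bp by rewrite mulr_ge0.
split=> i.
  have h : `|\sum_k th k i * x (sigma k)| <= m%:R * Bp * d.
    apply: (le_trans (ler_norm_sum _ _ _)).
    apply: (@le_trans _ _ (\sum_(k < m) (Bp * d))).
      by apply: ler_sum => k _; rewrite normrM ler_pM// th_bound.
    by rewrite sumr_const card_ord -[leLHS]mulr_natl mulrA.
  apply: (le_trans (ler_normB _ _)); apply: (le_trans (lerD (xd i) h)).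
  by rewrite /cp; nra.
have h : `|\sum_j th i j * y j| <= n%:R * Bp * d.
  apply: (le_trans (ler_norm_sum _ _ _)).
  apply: (@le_trans _ _ (\sum_(k < n) (Bp * d))).
    by apply: ler_sum => k _; rewrite normrM ler_pM// th_bound.
  by rewrite sumr_const card_ord -[leLHS]mulr_natl mulrA.
have h' : `|lam1 * \sum_k qc i k * x (sigma k)| <= `|lam1| * (\sum_i \sum_k `|qc i k|) * d.
  rewrite normrM -mulrA ler_wpM2l// [X in _ <= X * _](bigD1 i)//= mulrDl.
  apply: (@le_trans _ _ ((\sum_k `|qc i k|) * d)); last first.
    by rewrite lerDl mulr_ge0//; apply: sumr_ge0 => l _; exact: sumr_ge0.
  apply: (le_trans (ler_norm_sum _ _ _)); rewrite mulr_suml.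
  by apply: ler_sum => k _; rewrite normrM ler_wpM2l.
apply: (le_trans (ler_normB _ _)); apply: (le_trans (lerD h h')).
by rewrite /cp; nra.
Qed.

Definition c1 : R := 1 + trace_cst al be 0 * ((be ^+ 2)^-1 + 1).

Lemma c1_ge1 : 1 <= c1.
Proof. by rewrite lerDl mulr_ge0 ?trace_cst_ge0// addr_ge0// invr_ge0 sqr_ge0. Qed.

Lemma edge_value_bound D V S u b : 0 <= D -> edge_sol al be V S u ->
  (forall k, L2R half (u k)) -> (forall r, L2R half (S r)) -> measurable_fun half V ->
  (forall t, b < t -> V t = 0) -> 0 <= b ->
  Int half (sqn u) <= (be ^+ 2)^-1 * D ^+ 2 -> Int half (ssqn S) <= D ^+ 2 ->
  forall k, `|u k b| <= c1 * D.
Proof.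
move=> D0 Au0 Lu LS mV0 Vb b0 uD SD k.
have [mV Au] := edge_sol_modify b mV0 LS Au0.
have := edge_trace (M := 0) Au Lu LS b0 mV.
have h t : b <= t -> `|if t == b then 0 else V t| <= 0.
  by rewrite le_eqVlt eq_sym => /predU1P[->|bt]; rewrite ?eqxx ?normr0// Vb// if_same normr0.
move=> /(_ h).
have i1 : Int `[b, +oo[%classic (sqn u) <= (be ^+ 2)^-1 * D ^+ 2.
  apply: le_trans uD; apply: Ri_le_sub => //; [exact: itvy_suby|exact: L1_sqn|by move=> t _; exact: sqn_ge0].
have i2 : Int `[b, +oo[%classic (ssqn S) <= D ^+ 2.
  apply: le_trans SD; apply: Ri_le_sub => //; [exact: itvy_suby|exact: L1_ssqn|by move=> t _; exact: ssqn_ge0].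
move=> /le_trans/(_ (ler_wpM2l (trace_cst_ge0 _ _ 0) (lerD i1 i2))).
set T := trace_cst al be 0; set bb := (be ^+ 2)^-1 => H.
apply: ge0_sqr_le; first by rewrite mulr_ge0// (le_trans ler01 c1_ge1).
have X0 : 0 <= T * (bb + 1) by rewrite mulr_ge0 ?trace_cst_ge0// addr_ge0// invr_ge0 sqr_ge0.
have : T * (bb * D ^+ 2 + D ^+ 2) <= (c1 * D) ^+ 2.
  rewrite (_ : T * _ = T * (bb + 1) * D ^+ 2); last by ring.
  rewrite exprMn ler_wpM2r ?sqr_ge0// /c1 -/T -/bb.
  have := sqr_ge0 (T * (bb + 1)); lra.
move=> /(le_trans H); apply: le_trans.
have := sqr_ge0 (u (false, false) b); have := sqr_ge0 (u (true, false) b).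
have := sqr_ge0 (u (false, true) b); have := sqr_ge0 (u (true, true) b).
by case: k => [[] []] *; lra.
Qed.

(** [s] is the square root of eps, [Lam] the coupling at eps and [D] the norm of the source. The
    constants [c2] to [cOut] below do not involve these four, which is the uniformity in eps. *)
Variables (eps s Lam D : R).
Hypotheses (eps0 : 0 < eps) (eps1 : eps <= 1) (s0 : 0 < s) (sE : s ^+ 2 = eps) (D0 : 0 <= D)
  (Lam1 : `|Lam - 1 - eps * lam1| <= K * eps ^+ 2).
Variables (S : 'I_n -> bool -> R -> R) (U : 'I_n -> bool * bool -> R -> R).
Hypotheses (LS : forall j r, L2R half (S j r)) (SD : forall j, Int half (ssqn (S j)) <= D ^+ 2)
  (AU : forall j, edge_sol al be (fun t => Lam / eps ^+ 2 * Q j (t / eps)) (S j) (U j))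
  (LU : forall j k, L2R half (U j k))
  (UD : forall j, Int half (sqn (U j)) <= (be ^+ 2)^-1 * D ^+ 2)
  (Uc : forall r i j, U i (false, r) 0 = U j (false, r) 0)
  (Uk : forall r, \sum_j U j (true, r) 0 = 0).

Lemma measurable_Veps j : measurable_fun half (fun t => Lam / eps ^+ 2 * Q j (t / eps)).
Proof.
apply: measurable_funM => //.
apply: (@measurable_comp _ _ _ _ _ _ half _ _ (fun t : R => t / eps)) => //.
  by move=> _ [t /= + <-]; rewrite !in_itv/= !andbT => t0; rewrite divr_ge0// ltW.
by apply: measurable_funM => //; exact: measurable_id.
Qed.

Lemma U_bound j k : `|U j k (eps * a j)| <= c1 * D.
Proof.
apply: (edge_value_bound D0 (AU j) (LU j) (LS j) (measurable_Veps j) _ _ (UD j) (SD j)).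
  move=> t ta; rewrite Qa ?mulr0// ltr_pdivlMr// mulrC//.
by rewrite mulr_ge0// ltW.
Qed.

(* P is U rescaled to Omega: P'' = Q P - FF, where FF collects the terms of
   order eps. *)
Definition P j r x : R := U j (false, r) (eps * x).
Definition P1 j r x : R := eps * U j (true, r) (eps * x).
Definition bs (r : bool) : R := if r then - be else be.
Definition FF j r x : R := (1 - Lam) * (Q j x * P j r x) +
  eps ^+ 2 * (al * P j r x - bs r * P j (~~ r) x + S j r (eps * x)).

Lemma AC_P j r : AC 0 (a j) (P j r) (P1 j r).
Proof.
apply: AC_scale => //; rewrite mulr0; apply: (AU j (false, r)).
by rewrite mulr_ge0// ltW.
Qed.

Lemma AC_P1 j r : AC 0 (a j) (P1 j r) (fun x => Q j x * P j r x - FF j r x).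
Proof.
have en0 : eps != 0 by rewrite lt0r_neq0.
have ea0 : 0 <= eps * a j by rewrite mulr_ge0// ltW.
have := AU j (true, r) ea0; rewrite -{1}(mulr0 eps) => h.
apply: AC_ext (AC_Z eps (AC_scale eps0 h)) => // x _.
have xE : eps * x / eps = x by rewrite mulrAC mulfV// mul1r.
by rewrite /FF /P /bs; case: r {h} => /=; rewrite xE; field.
Qed.

(** The dilation costs a factor 1/eps in the squared norm; the weight eps^2 of the source in [FF]
    outweighs it. *)
Lemma scaled_L2 j r : L2R `[0, a j]%classic (fun x => S j r (eps * x)) /\
  Int `[0, a j]%classic (fun x => S j r (eps * x) ^+ 2) <= eps^-1 * D ^+ 2.
Proof.
have sub : `[eps * 0, eps * a j]%classic `<=` (half : set R) by rewrite mulr0; exact: itv_suby.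
have Lh : L2R `[eps * 0, eps * a j]%classic (S j r) by exact: L2_sub (LS j r).
have [L1s IE] := Int_scale eps0 (L2_L1 Lh).
have [L1m _] := Int_scale eps0 (L2_integrable Lh).
split; first by split => //; exact: L1_measurable L1m.
rewrite -(ler_pM2l eps0) -IE mulrA mulfV ?lt0r_neq0// mul1r; apply: le_trans (SD j).
apply: (@le_trans _ _ (Int half (fun t => S j r t ^+ 2))).
  apply: Ri_le_sub => //; [exact: L2_L1|by move=> t _; exact: sqr_ge0].
apply: Ri_le => //; [exact: L2_L1|exact: L1_ssqn|].
by move=> t _; rewrite /ssqn; case: (r); rewrite ?lerDl ?lerDr sqr_ge0.
Qed.

Definition Lm : R := 1 + `|lam1| + K.

Lemma Lam_bounds : `|Lam| <= Lm /\ `|1 - Lam| <= eps * (`|lam1| + K).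
Proof.
have e2 : eps ^+ 2 <= eps by have := eps0; have := eps1; nra.
have KE : K * eps ^+ 2 <= K * eps by rewrite ler_wpM2l.
have E : `|1 - Lam| <= eps * (`|lam1| + K).
  rewrite distrC (_ : Lam - 1 = (Lam - 1 - eps * lam1) + eps * lam1); last by ring.
  rewrite (le_trans (ler_normD _ _))// normrM (gtr0_norm eps0) mulrDr.
  by have := Lam1; have := KE; lra.
split=> //; rewrite (_ : Lam = 1 - (1 - Lam)); last by ring.
rewrite (le_trans (ler_normB _ _))// normr1 /Lm -addrA lerD2l (le_trans E)//.
by rewrite ler_piMl// addr_ge0.
Qed.

Definition c2 : R := 1 + expR ((2 + 4 * (Lm ^+ 2 * M ^+ 2 + al ^+ 2 + be ^+ 2)) * A) * (4 * c1 ^+ 2 + 8).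

Lemma c2_ge1 : 1 <= c2.
Proof. by rewrite lerDl mulr_ge0 ?expR_ge0//; nneg. Qed.

(** The bound at the outer end of the segment propagates inwards by [energy_bound]: after rescaling,
    the potential [Lam * Q] is bounded and the segment has length at most A. *)
Lemma P_bound j r x : 0 <= x <= a j -> `|P j r x| <= c2 * D.
Proof.
move=> xa; have [L0' B0] := scaled_L2 j false; have [L1' B1] := scaled_L2 j true.
set G := fun x => 4 * eps ^+ 4 * (S j false (eps * x) ^+ 2 + S j true (eps * x) ^+ 2).
have LG : L1 `[0, a j]%classic G by apply: L1Z => //; apply: L1D => //; exact: L2_L1.
set MM := 4 * (Lm ^+ 2 * M ^+ 2 + al ^+ 2 + be ^+ 2).
have MM0 : 0 <= MM by rewrite /MM; nneg.
have [LamB _] := Lam_bounds.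
have e4 : eps ^+ 4 <= 1 by rewrite exprn_ile1// ltW.
have e40 : 0 <= eps ^+ 4 by rewrite exprn_ge0// ltW.
have aj : (0 : R) <= a j <= a j by rewrite lexx ltW.
have := energy_bound MM0 (AC_P j false) (AC_P1 j false) (AC_P j true) (AC_P1 j true) LG _ _ xa aj.
set e := expR _ => H.
have {}H : P j false x ^+ 2 + P1 j false x ^+ 2 + P j true x ^+ 2 + P1 j true x ^+ 2 <= e *
    (P j false (a j) ^+ 2 + P1 j false (a j) ^+ 2 + P j true (a j) ^+ 2 + P1 j true (a j) ^+ 2 +
     Int `[0, a j]%classic G).
  apply: H => t; first by move=> _; rewrite /G; nneg.
  move=> /andP[t0 ta].
  have q2 : (Lam * Q j t) ^+ 2 <= Lm ^+ 2 * M ^+ 2.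
    by rewrite exprMn ler_pM ?sqr_ge0//; apply: normr_le_sqr => //; exact: QM.
  have gen (p q f b' : R) : b' ^+ 2 = be ^+ 2 ->
     (Lam * Q j t * p - eps ^+ 2 * (al * p - b' * q + f)) ^+ 2 <=
     4 * ((Lm ^+ 2 * M ^+ 2 + al ^+ 2) * p ^+ 2 + be ^+ 2 * q ^+ 2 + eps ^+ 4 * f ^+ 2).
    move=> bE; have w1 := ler_wpM2r (sqr_ge0 p) q2.
    have w2 : eps ^+ 4 * (al ^+ 2 * p ^+ 2) <= al ^+ 2 * p ^+ 2 by rewrite ler_piMl//; nneg.
    have w3 : eps ^+ 4 * (b' ^+ 2 * q ^+ 2) <= b' ^+ 2 * q ^+ 2 by rewrite ler_piMl//; nneg.
    set X1 := Lam * Q j t * p; set X2 := eps ^+ 2 * (al * p); set X3 := eps ^+ 2 * (b' * q); set X4 := eps ^+ 2 * f.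
    rewrite (_ : X1 - eps ^+ 2 * _ = X1 - X2 + X3 - X4); last by rewrite /X2 /X3 /X4; ring.
    apply: (@le_trans _ _ (4 * (X1 ^+ 2 + X2 ^+ 2 + X3 ^+ 2 + X4 ^+ 2))).
      have := sqr_ge0 (X1 + X2); have := sqr_ge0 (X1 - X3); have := sqr_ge0 (X1 + X4).
      have := sqr_ge0 (X2 + X3); have := sqr_ge0 (X2 - X4); have := sqr_ge0 (X3 + X4).
      move: X1 X2 X3 X4 => X1 X2 X3 X4; lra.
    rewrite ler_wpM2l//.
    have -> : X1 ^+ 2 = (Lam * Q j t) ^+ 2 * p ^+ 2 by rewrite /X1 exprMn.
    have -> : X2 ^+ 2 = eps ^+ 4 * (al ^+ 2 * p ^+ 2) by rewrite /X2; ring.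
    have -> : X3 ^+ 2 = eps ^+ 4 * (b' ^+ 2 * q ^+ 2) by rewrite /X3; ring.
    have -> : X4 ^+ 2 = eps ^+ 4 * f ^+ 2 by rewrite /X4; ring.
    rewrite -bE; move: w1 w2 w3; set y1 := (Lam * Q j t) ^+ 2 * _; lra.
  have g1 := gen (P j false t) (P j true t) (S j false (eps * t)) be erefl.
  have g2 := gen (P j true t) (P j false t) (S j true (eps * t)) (- be) (sqrrN _).
  have E1 : Q j t * P j false t - FF j false t = Lam * Q j t * P j false t - eps ^+ 2 * (al * P j false t - be * P j true t + S j false (eps * t)).
    by rewrite /FF /bs /=; ring.
  have E2 : Q j t * P j true t - FF j true t = Lam * Q j t * P j true t - eps ^+ 2 * (al * P j true t - - be * P j false t + S j true (eps * t)).
    by rewrite /FF /bs /=; ring.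
  rewrite E1 E2; apply: (le_trans (lerD g1 g2)); rewrite /MM /G.
  move: (P j false t) (P j true t) (S j false _) (S j true _) => p q f g; lra.
have IG : Int `[0, a j]%classic G <= 8 * D ^+ 2.
  rewrite /G RiZ//; last by apply: L1D => //; exact: L2_L1.
  rewrite RiD//; [|exact: L2_L1|exact: L2_L1].
  have -> : 8 * D ^+ 2 = 4 * (D ^+ 2 + D ^+ 2) by ring.
  rewrite -mulrA ler_wpM2l// -[leRHS]mul1r; apply: (@le_trans _ _ (eps ^+ 4 * (eps^-1 * D ^+ 2 + eps^-1 * D ^+ 2))).
    by rewrite ler_wpM2l// lerD.
  rewrite (_ : eps ^+ 4 * _ = eps ^+ 3 * (D ^+ 2 + D ^+ 2)); last by field; rewrite lt0r_neq0.
  rewrite ler_wpM2r//; first by nneg.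
  by rewrite exprn_ile1// ltW.
have bP r' : P j r' (a j) ^+ 2 + P1 j r' (a j) ^+ 2 <= 2 * (c1 * D) ^+ 2.
  have h1 := normr_le_sqr (U_bound j (false, r')).
  have h2 := normr_le_sqr (U_bound j (true, r')).
  have : P1 j r' (a j) ^+ 2 <= U j (true, r') (eps * a j) ^+ 2.
    by rewrite /P1 exprMn ler_piMl ?sqr_ge0// exprn_ile1// ltW.
  by rewrite /P; lra.
have bP0 := bP false; have bP1 := bP true.
have eE : e <= expR ((2 + MM) * A) by rewrite ler_expR ler_wpM2l// addr_ge0.
have e0 : 0 <= e by exact: expR_ge0.
apply: ge0_sqr_le; first by rewrite mulr_ge0// (le_trans ler01 c2_ge1).
have X0 : 0 <= (4 * c1 ^+ 2 + 8) * D ^+ 2 by nneg.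
apply: (@le_trans _ _ (e * ((4 * c1 ^+ 2 + 8) * D ^+ 2))).
  apply: (@le_trans _ _ (e * (P j false (a j) ^+ 2 + P1 j false (a j) ^+ 2 + P j true (a j) ^+ 2 + P1 j true (a j) ^+ 2 +
     Int `[0, a j]%classic G))).
    apply: le_trans H; have := sqr_ge0 (P j false x); have := sqr_ge0 (P j true x).
    have := sqr_ge0 (P1 j false x); have := sqr_ge0 (P1 j true x).
    by case: r; lra.
  by rewrite ler_wpM2l//; move: bP0 bP1 IG; rewrite exprMn; lra.
apply: (@le_trans _ _ (expR ((2 + MM) * A) * ((4 * c1 ^+ 2 + 8) * D ^+ 2))).
  by rewrite ler_wpM2r.
rewrite mulrA exprMn ler_wpM2r ?sqr_ge0// /c2 -/MM.
set Y := expR _ * _; have Y0 : 0 <= Y by rewrite mulr_ge0 ?expR_ge0//; nneg.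
by have := sqr_ge0 Y; lra.
Qed.

Lemma L2_FF j r : L2R `[0, a j]%classic (FF j r).
Proof.
have [LSs _] := scaled_L2 j r.
have LP r' := AC_L2 (AC_P j r').
have LQP := L2_Q mQ QM (AC_P j r).
apply: L2_D => //; first exact: L2_Z.
apply: L2_Z => //; apply: L2_D => //; apply: L2_B => //; exact: L2_Z.
Qed.

Definition cF : R := ((`|lam1| + K) ^+ 2 * M ^+ 2 + al ^+ 2 + be ^+ 2) * c2 ^+ 2.
(** Includes [c1] so that the single tolerance c3 eps D covers both the source [FF] and the Neumann
    data of [P], as [inner] requires. *)
Definition c3 : R := 1 + c1 + 4 * (cF * A + 1).

Lemma cF_ge0 : 0 <= cF. Proof. by rewrite /cF; nneg. Qed.

Lemma FF_bound j r : Int `[0, a j]%classic (fun x => FF j r x ^+ 2) <= (c3 * (eps * D)) ^+ 2.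
Proof.
have [LSs IS] := scaled_L2 j r.
have [_ LamB] := Lam_bounds.
have e2 : eps ^+ 2 <= 1 by rewrite exprn_ile1// ltW.
have e0 := ltW eps0.
have LG : L1 `[0, a j]%classic (fun x => 4 * eps ^+ 2 * cF * D ^+ 2 + 4 * eps ^+ 4 * S j r (eps * x) ^+ 2).
  by apply: L1D => //; [exact: L1_cst|apply: L1Z => //; exact: L2_L1].
apply: (@le_trans _ _ (Int `[0, a j]%classic
   (fun x => 4 * eps ^+ 2 * cF * D ^+ 2 + 4 * eps ^+ 4 * S j r (eps * x) ^+ 2))).
  apply: Ri_le => //; first by apply: L2_L1; exact: L2_FF.
  move=> x; rewrite /= in_itv/= => xa; have /andP[x0 _] := xa.
  have p1 := normr_le_sqr (P_bound r xa); have p2 := normr_le_sqr (P_bound (~~ r) xa).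
  have q2 := normr_le_sqr (QM j x0).
  have l2 := normr_le_sqr LamB.
  have b2 : bs r ^+ 2 = be ^+ 2 by rewrite /bs; case: (r); rewrite ?sqrrN.
  rewrite /FF.
  set X1 := (1 - Lam) * _; set X2 := al * _; set X3 := bs r * _; set X4 := S j r _.
  apply: (@le_trans _ _ (4 * (X1 ^+ 2 + eps ^+ 4 * X2 ^+ 2 + eps ^+ 4 * X3 ^+ 2 + eps ^+ 4 * X4 ^+ 2))).
    have := sqr_ge0 (X1 - eps ^+ 2 * X2); have := sqr_ge0 (X1 + eps ^+ 2 * X3).
    have := sqr_ge0 (X1 - eps ^+ 2 * X4); have := sqr_ge0 (eps ^+ 2 * X2 + eps ^+ 2 * X3).
    have := sqr_ge0 (eps ^+ 2 * X2 - eps ^+ 2 * X4); have := sqr_ge0 (eps ^+ 2 * X3 + eps ^+ 2 * X4).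
    move: X1 X2 X3 X4 => X1 X2 X3 X4; lra.
  have x1 : X1 ^+ 2 <= eps ^+ 2 * ((`|lam1| + K) ^+ 2 * M ^+ 2 * (c2 * D) ^+ 2).
    rewrite (_ : eps ^+ 2 * _ = (eps * (`|lam1| + K) * (M * (c2 * D))) ^+ 2); last by ring.
    apply: normr_le_sqr; rewrite /X1 !normrM ler_pM ?mulr_ge0// ler_pM ?QM//.
    exact: P_bound.
  have dd : 0 <= (c2 * D) ^+ 2 by exact: sqr_ge0.
  have x2 : eps ^+ 4 * X2 ^+ 2 <= eps ^+ 2 * (al ^+ 2 * (c2 * D) ^+ 2).
    rewrite (_ : eps ^+ 4 = eps ^+ 2 * eps ^+ 2); last by ring.
    rewrite -mulrA ler_wpM2l ?sqr_ge0// (le_trans (ler_piMl _ e2)) ?sqr_ge0//.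
    by rewrite /X2 exprMn ler_wpM2l ?sqr_ge0.
  have x3 : eps ^+ 4 * X3 ^+ 2 <= eps ^+ 2 * (be ^+ 2 * (c2 * D) ^+ 2).
    rewrite (_ : eps ^+ 4 = eps ^+ 2 * eps ^+ 2); last by ring.
    rewrite -mulrA ler_wpM2l ?sqr_ge0// (le_trans (ler_piMl _ e2)) ?sqr_ge0//.
    by rewrite /X3 exprMn b2 ler_wpM2l ?sqr_ge0.
  rewrite /cF; move: x1 x2 x3; rewrite exprMn; set y1 := X1 ^+ 2; set y2 := _ * X2 ^+ 2; set y3 := _ * X3 ^+ 2.
  lra.
rewrite RiD//; [|exact: L1_cst|by apply: L1Z => //; exact: L2_L1].
rewrite Ri_cst ?(ltW (a0 j))// subr0 RiZ//; last exact: L2_L1.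
have h1 : 4 * eps ^+ 4 * Int `[0, a j]%classic (fun x => S j r (eps * x) ^+ 2) <= 4 * eps ^+ 2 * D ^+ 2.
  apply: (@le_trans _ _ (4 * eps ^+ 4 * (eps^-1 * D ^+ 2))); first by rewrite ler_wpM2l//; nneg; rewrite exprn_ge0.
  rewrite (_ : 4 * eps ^+ 4 * _ = 4 * (eps ^+ 2 * D ^+ 2) * eps); last by field; rewrite lt0r_neq0.
  by rewrite -[leRHS]mulrA ler_piMr//; nneg.
have h2 : 4 * eps ^+ 2 * cF * D ^+ 2 * a j <= 4 * eps ^+ 2 * cF * D ^+ 2 * A.
  by rewrite ler_wpM2l//; nneg; exact: cF_ge0.
apply: (le_trans (lerD h2 h1)).
rewrite (_ : _ + _ = 4 * (cF * A + 1) * (eps * D) ^+ 2); last by ring.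
rewrite [leRHS]exprMn ler_wpM2r ?sqr_ge0// /c3.
set Y := 4 * _; have Y0 : 0 <= Y by rewrite /Y mulr_ge0// addr_ge0// mulr_ge0// cF_ge0.
have := c1_ge1; set c := c1 => c1'.
have := sqr_ge0 (c + Y); nra.
Qed.

Lemma c3_ge1 : 1 <= c3 /\ c1 <= c3.
Proof.
have := c1_ge1; have : 0 <= 4 * (cF * A + 1) by rewrite mulr_ge0// addr_ge0// mulr_ge0// cF_ge0.
by rewrite /c3; split; lra.
Qed.

Let w r k := P (sigma k) r (a (sigma k)).

Lemma P_expansion r j x : 0 <= x <= a j ->
  `|P j r x - \sum_i w r i * psi i j x| <= Cin * (c3 * (eps * D)).
Proof.
have [c31 c3c1] := c3_ge1.
have eD : 0 <= eps * D by rewrite mulr_ge0// ltW.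
apply: (inner (W := fun j => P j r) (W1 := fun j => P1 j r) (F := fun j => FF j r)).
- by rewrite mulr_ge0// (le_trans ler01).
- by move=> i; exact: AC_P.
- by move=> i; exact: AC_P1.
- by move=> i; exact: L2_FF.
- by move=> i; exact: FF_bound.
- by move=> i i'; rewrite /P mulr0; exact: Uc.
- by rewrite /P1 -mulr_sumr mulr0 Uk mulr0.
- move=> i; rewrite /P1 normrM (gtr0_norm eps0) mulrCA ler_wpM2l ?(ltW eps0)//.
  by apply: (le_trans (U_bound i (true, r))); rewrite ler_wpM2r.
Qed.

(** At the outer ends the derivative of psi_i vanishes. At the vertex the boundary terms cancel in
    the sum, since both functions are continuous there and satisfy the Kirchhoff condition. *)
Lemma green_psi r i : \sum_j P1 j r (a j) * th i j =
  - \sum_j Int `[0, a j]%classic (fun x => FF j r x * psi i j x).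
Proof.
have [A1 A2 c k nm] := Zpsi i.
have E j : - (P1 j r (a j) * th i j) - (P j r 0 * psi1 i j 0 - P1 j r 0 * psi i j 0) =
    Int `[0, a j]%classic (fun x => FF j r x * psi i j x).
  have AB : AC 0 (a j) (fun x => P j r x * psi1 i j x - P1 j r x * psi i j x) (fun x => FF j r x * psi i j x).
    apply: AC_ext (AC_B (AC_M (AC_P j r) (A2 j)) (AC_M (AC_P1 j r) (A1 j))) => // x _; ring.
  rewrite -(AC_diff AB (lexx _) (ltW (a0 j)) (lexx _)) nm /th; ring.
have -> : \sum_j Int `[0, a j]%classic (fun x => FF j r x * psi i j x) =
   - (\sum_j P1 j r (a j) * th i j) - \sum_j (P j r 0 * psi1 i j 0 - P1 j r 0 * psi i j 0).
  by rewrite -sumrN -sumrB; apply: eq_bigr => j _; rewrite -E.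
suff -> : \sum_j (P j r 0 * psi1 i j 0 - P1 j r 0 * psi i j 0) = 0 by ring.
(* A reference edge is needed to express continuity at the vertex; for n = 0 the sums are empty. *)
have [j0|no] := pselect (exists j : 'I_n, True); last first.
  by rewrite big1// => j; exfalso; apply: no; exists j.
have [{}j0 _] := cid j0.
rewrite sumrB (eq_bigr (fun j => P j0 r 0 * psi1 i j 0)) => [|j _]; last first.
  by rewrite /P mulr0 (Uc r j j0).
rewrite -mulr_sumr k mulr0 (eq_bigr (fun j => P1 j r 0 * psi i j0 0)) => [|j _]; last first.
  by rewrite (c j j0).
rewrite -mulr_suml (_ : \sum_j P1 j r 0 = 0) ?mul0r ?subrr//.
by rewrite /P1 -mulr_sumr mulr0 Uk mulr0.
Qed.

Definition c5 : R := (`|lam1| * M * Cin * c3 + (K * M + `|al| + `|be|) * c2) * Bp.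
Definition c4 : R := n%:R * (c5 * A + Bp * (1 + A)).

Lemma c5_ge0 : 0 <= c5.
Proof.
have [c31 _] := c3_ge1; have c21 := c2_ge1.
have c30 : 0 <= c3 by lra.
have c20 : 0 <= c2 by lra.
by rewrite /c5; nneg.
Qed.

Lemma flux_estimate r i :
  `|\sum_j th i j * U j (true, r) (eps * a j) - lam1 * \sum_k qc i k * w r k| <= c4 * (s * D).
Proof.
have en0 : eps != 0 by rewrite lt0r_neq0.
have e0 := ltW eps0; have s0' := ltW s0.
have s1 : s <= 1 by rewrite -(ler_sqr (x := s)) ?nnegrE// sE expr1n.
rewrite -(ler_pM2l eps0) -{1}(gtr0_norm eps0) -normrM mulrBr.
have -> : eps * (\sum_j th i j * U j (true, r) (eps * a j)) = \sum_j P1 j r (a j) * th i j.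
  by rewrite mulr_sumr; apply: eq_bigr => j _; rewrite /P1; ring.
rewrite green_psi.
(* What is left of FF psi_i without the source term and the leading term - eps lam1 Q psi_i sum_k
   w_k psi_k. Each of its three pieces is O(eps^2 D): the first by [P_expansion], the second by the
   expansion of the coupling, the third by its prefactor. *)
pose rem j x := - (eps * lam1) * (Q j x * (P j r x - \sum_k w r k * psi k j x) * psi i j x) +
  (1 - Lam + eps * lam1) * (Q j x * P j r x * psi i j x) +
  eps ^+ 2 * ((al * P j r x - bs r * P j (~~ r) x) * psi i j x).
have [A1 _ _ _ _] := Zpsi i.
have Lpsi k j := AC_L2 (let: And5 x _ _ _ _ := Zpsi k in x j).
have LQpp k j : L1 `[0, a j]%classic (fun x => Q j x * psi i j x * psi k j x).
  by apply: L2_M => //; apply: (L2_Q mQ QM); exact: A1.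
have Lw j : L1 `[0, a j]%classic (fun x => \sum_k w r k * (Q j x * psi i j x * psi k j x)).
  by apply: L1_sum => // k; apply: L1Z.
have LSp j : L1 `[0, a j]%classic (fun x => S j r (eps * x) * psi i j x).
  by apply: L2_M => //; have [] := scaled_L2 j r.
have LFp j : L1 `[0, a j]%classic (fun x => FF j r x * psi i j x).
  by apply: L2_M => //; exact: L2_FF.
have FE j x : rem j x = FF j r x * psi i j x - eps ^+ 2 * (S j r (eps * x) * psi i j x) +
    eps * lam1 * \sum_k w r k * (Q j x * psi i j x * psi k j x).
  have -> : \sum_k w r k * (Q j x * psi i j x * psi k j x) = Q j x * psi i j x * \sum_k w r k * psi k j x.
    by rewrite mulr_sumr; apply: eq_bigr => k _; ring.
  by rewrite /rem /FF; ring.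
have Lrem j : L1 `[0, a j]%classic (rem j).
  apply: (@L1_ext _ _ (fun x => FF j r x * psi i j x - eps ^+ 2 * (S j r (eps * x) * psi i j x) +
    eps * lam1 * \sum_k w r k * (Q j x * psi i j x * psi k j x))) => //.
  by apply: L1D => //; [apply: L1B => //; exact: L1Z|exact: L1Z].
have remI j : Int `[0, a j]%classic (rem j) = Int `[0, a j]%classic (fun x => FF j r x * psi i j x) -
    eps ^+ 2 * Int `[0, a j]%classic (fun x => S j r (eps * x) * psi i j x) +
    eps * lam1 * \sum_k w r k * Int `[0, a j]%classic (fun x => Q j x * psi i j x * psi k j x).
  rewrite (Ri_ext (fun x _ => FE j x)) RiD//; [|by apply: L1B => //; exact: L1Z|exact: L1Z].
  rewrite RiB//; last exact: L1Z.
  rewrite !RiZ// Ri_sum//; last by move=> k; exact: L1Z.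
  by congr (_ + _ * _); apply: eq_bigr => k _; rewrite RiZ.
have -> : - (\sum_j Int `[0, a j]%classic (fun x => FF j r x * psi i j x)) - eps * (lam1 * \sum_k qc i k * w r k) =
   - \sum_j (Int `[0, a j]%classic (rem j) + eps ^+ 2 * Int `[0, a j]%classic (fun x => S j r (eps * x) * psi i j x)).
  have -> : \sum_k qc i k * w r k = \sum_j \sum_k w r k * Int `[0, a j]%classic (fun x => Q j x * psi i j x * psi k j x).
    rewrite exchange_big/=; apply: eq_bigr => k _.
    by rewrite /qc mulr_suml; apply: eq_bigr => j _; rewrite mulrC.
  rewrite mulrA mulr_sumr -opprD -big_split/=; congr (- _); apply: eq_bigr => j _.
  by rewrite remI; ring.
rewrite normrN (le_trans (ler_norm_sum _ _ _))//.
have [c31 _] := c3_ge1; have c21 := c2_ge1; have c50 := c5_ge0.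
have edge j : `|Int `[0, a j]%classic (rem j) + eps ^+ 2 * Int `[0, a j]%classic (fun x => S j r (eps * x) * psi i j x)| <=
    eps * ((c5 * A + Bp * (1 + A)) * (s * D)).
  have h1 : `|Int `[0, a j]%classic (rem j)| <= eps ^+ 2 * (c5 * D) * A.
    apply: (@le_trans _ _ (Int `[0, a j]%classic (fun=> eps ^+ 2 * (c5 * D)))); last first.
      by rewrite Ri_cst ?(ltW (a0 j))// subr0 ler_wpM2l//; nneg.
    apply: Ri_norm_le => //; first exact: L1_cst.
    move=> x; rewrite /= in_itv/= => xa; have /andP[x0 _] := xa.
    have p1 := P_bound r xa; have p2 := P_bound (~~ r) xa; have p3 := P_expansion r xa.
    have q := QM j x0; have b := psiB i xa.
    have cD : 0 <= c2 * D by rewrite mulr_ge0//; lra.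
    have bsE : `|bs r| = `|be| by rewrite /bs; case: (r); rewrite ?normrN.
    have LamB : `|1 - Lam + eps * lam1| <= K * eps ^+ 2.
      by rewrite (_ : _ + _ = - (Lam - 1 - eps * lam1)) ?normrN//; ring.
    have CD : 0 <= Cin * (c3 * (eps * D)) by rewrite !mulr_ge0//; lra.
    have t1 : `|- (eps * lam1) * (Q j x * (P j r x - \sum_k w r k * psi k j x) * psi i j x)| <=
        eps * `|lam1| * (M * (Cin * (c3 * (eps * D))) * Bp).
      rewrite !normrM normrN normrM (gtr0_norm eps0) ler_pM ?mulr_ge0//.
      by rewrite ler_pM ?mulr_ge0// ler_pM.
    have t2 : `|(1 - Lam + eps * lam1) * (Q j x * P j r x * psi i j x)| <= K * eps ^+ 2 * (M * (c2 * D) * Bp).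
      by rewrite normrM ler_pM// !normrM ler_pM ?mulr_ge0// ler_pM.
    have t3 : `|eps ^+ 2 * ((al * P j r x - bs r * P j (~~ r) x) * psi i j x)| <=
        eps ^+ 2 * ((`|al| + `|be|) * (c2 * D) * Bp).
      rewrite normrM (ger0_norm (sqr_ge0 eps)) ler_wpM2l ?sqr_ge0// normrM ler_pM//.
      rewrite (le_trans (ler_normB _ _))// !normrM bsE mulrDl lerD// ler_wpM2l//.
    rewrite /rem; apply: (le_trans (ler_normD _ _)).
    apply: (le_trans (lerD (le_trans (ler_normD _ _) (lerD t1 t2)) t3)).
    rewrite /c5 le_eqVlt; apply/orP; left; apply/eqP; ring.
  (* The factor 1/s comes from [scaled_L2], and 1 + A majorizes the square root of A. With the
     weight eps^2 = eps s^2 this term is of order eps s, so dividing Green's formula by eps leaves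
     s, the square root of eps. *)
  have h2 : `|Int `[0, a j]%classic (fun x => S j r (eps * x) * psi i j x)| <= Bp * (1 + A) * (s^-1 * D).
    have [LSs IS] := scaled_L2 j r.
    apply: ge0_sqr_le; first by rewrite !mulr_ge0// ?addr_ge0// invr_ge0.
    apply: (le_trans (cauchy_schwarz (measurable_itv _) LSs (Lpsi i j))).
    have pp : Int `[0, a j]%classic (fun x => psi i j x ^+ 2) <= Bp ^+ 2 * A.
      apply: (@le_trans _ _ (Int `[0, a j]%classic (fun=> Bp ^+ 2))); last first.
        by rewrite Ri_cst ?(ltW (a0 j))// subr0 ler_wpM2l ?sqr_ge0.
      apply: Ri_le => //; [exact: L2_L1|exact: L1_cst|].
      by move=> x; rewrite /= in_itv/= => xa; apply: normr_le_sqr; exact: psiB.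
    have pp0 : 0 <= Int `[0, a j]%classic (fun x => psi i j x ^+ 2).
      by apply: Ri_ge0 => x _; exact: sqr_ge0.
    have SS0 : 0 <= Int `[0, a j]%classic (fun x => S j r (eps * x) ^+ 2).
      by apply: Ri_ge0 => x _; exact: sqr_ge0.
    apply: (le_trans (ler_pM SS0 pp0 IS pp)).
    rewrite -sE; have sn : s != 0 by rewrite lt0r_neq0.
    rewrite (_ : (s ^+ 2)^-1 * D ^+ 2 * (Bp ^+ 2 * A) = A * (Bp * (s^-1 * D)) ^+ 2); last by field.
    rewrite (_ : (Bp * (1 + A) * (s^-1 * D)) ^+ 2 = (1 + A) ^+ 2 * (Bp * (s^-1 * D)) ^+ 2); last by ring.
    by rewrite ler_wpM2r ?sqr_ge0//; have := A0; nra.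
  apply: (le_trans (ler_normD _ _)); rewrite normrM (ger0_norm (sqr_ge0 eps)).
  have h3 := ler_wpM2l (sqr_ge0 eps) h2.
  apply: (le_trans (lerD h1 h3)).
  have -> : eps ^+ 2 * (Bp * (1 + A) * (s^-1 * D)) = eps * (Bp * (1 + A) * (s * D)).
    by rewrite -sE; field; rewrite lt0r_neq0.
  have es : eps <= s by rewrite -sE expr2 ler_piMl.
  have -> : eps ^+ 2 * (c5 * D) * A = eps * (c5 * A * (eps * D)) by ring.
  have cA0 : 0 <= c5 * A by rewrite mulr_ge0.
  by rewrite -mulrDr ler_wpM2l// mulrDl lerD// ler_wpM2l// ler_wpM2r.
apply: (@le_trans _ _ (\sum_(j < n) (eps * ((c5 * A + Bp * (1 + A)) * (s * D))))).
  by apply: ler_sum => j _; exact: edge.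
rewrite sumr_const card_ord -[leLHS]mulr_natl /c4.
by rewrite le_eqVlt; apply/orP; left; apply/eqP; ring.
Qed.

Definition cU : R := Cin * c3 + c4.

Lemma U_approx_bc r : approx_bc (cU * (s * D)) (fun j => U j (false, r) (eps * a j))
  (fun j => U j (true, r) (eps * a j)).
Proof.
have e0 := ltW eps0; have s0' := ltW s0.
have s1 : s <= 1 by rewrite -(ler_sqr (x := s)) ?nnegrE// sE expr1n.
have es : eps <= s by rewrite -sE expr2 ler_piMl.
have [c31 _] := c3_ge1; have c50 := c5_ge0.
have c40 : 0 <= c4 by rewrite /c4 mulr_ge0// addr_ge0// mulr_ge0// addr_ge0.
have sD : 0 <= s * D by rewrite mulr_ge0.
split=> i.
  have := @P_expansion r i (a i); rewrite lexx (ltW (a0 i)) => /(_ isT).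
  rewrite /P /w /P (eq_bigr (fun k => th k i * U (sigma k) (false, r) (eps * a (sigma k)))); last first.
    by move=> k _; rewrite mulrC.
  move=> /le_trans; apply; rewrite /cU [leRHS]mulrDl.
  have : Cin * (c3 * (eps * D)) <= Cin * c3 * (s * D).
    by rewrite -!mulrA ler_wpM2l// ler_wpM2l ?ler_wpM2r//; lra.
  by move=> /le_trans; apply; rewrite lerDl mulr_ge0.
apply: (le_trans (flux_estimate r i)); rewrite /cU [leRHS]mulrDl lerDr mulr_ge0// mulr_ge0//; lra.
Qed.

Variable Z : 'I_n -> bool * bool -> R -> R.
Hypotheses (AZ : forall j, edge_sol al be (fun=> 0) (S j) (Z j))
  (LZ : forall j k, L2R half (Z j k))
  (ZD : forall j, Int half (sqn (Z j)) <= (be ^+ 2)^-1 * D ^+ 2)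
  (Zbc : forall r, approx_bc 0 (fun j => Z j (false, r) 0) (fun j => Z j (true, r) 0))
  (be0 : be != 0).

Let eps_le_s : eps <= s.
Proof.
have s1 : s <= 1 by rewrite -(ler_sqr (x := s)) ?nnegrE ?(ltW s0)// sE expr1n.
by rewrite -sE expr2 ler_piMl// ltW.
Qed.

Lemma Z_bound j k x : 0 <= x -> `|Z j k x| <= c1 * D.
Proof.
by move=> x0; apply: (edge_value_bound D0 (AZ j) (LZ j) (LS j) _ _ x0 (ZD j) (SD j)) => //.
Qed.

Definition cZ : R := A * ((1 + `|al| + `|be|) * c1) + (1 + A).

(** The integrand is a bounded part [g], which contributes O(eps) over the segment, and for the
    derivative components also the source, which contributes O(sqrt eps) by Cauchy-Schwarz. *)
Lemma Z_variation j k : `|Z j k 0 - Z j k (eps * a j)| <= cZ * (s * D).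
Proof.
have b0 : 0 <= eps * a j by rewrite mulr_ge0// ltW.
have c10 : 0 <= c1 by exact: le_trans c1_ge1.
have sD0 : 0 <= s * D by rewrite mulr_ge0// ltW.
rewrite distrC (AC_diff (AZ j k b0) (lexx _) b0 (lexx _)).
pose g (l : bool * bool) t := rhs al be (fun=> 0) (fun _ _ => 0) (fun l => Z j l t) t l.
set G := (1 + `|al| + `|be|) * c1 * D.
have Lg l : L1 `[0, eps * a j]%classic (g l).
  have L l' := AC_L1 (AZ j l' b0).
  rewrite /g; case: l => [[] []] /=; [| | exact: L|exact: L].
  - apply: (@L1_ext _ _ (fun t => - al * Z j (false, true) t - be * Z j (false, false) t)) => //.
      by move=> t _; ring.
    by apply: L1B => //; exact: L1Z.
  - apply: (@L1_ext _ _ (fun t => - al * Z j (false, false) t + be * Z j (false, true) t)) => //.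
      by move=> t _; ring.
    by apply: L1D => //; exact: L1Z.
have gB l t : 0 <= t -> `|g l t| <= G.
  move=> t0; have z l' := Z_bound j l' t0.
  have ab0 := normr_ge0 al; have bb0 := normr_ge0 be; have cD : 0 <= c1 * D by rewrite mulr_ge0.
  have two p q b' : `|p| <= c1 * D -> `|q| <= c1 * D -> `|b'| = `|be| -> `|- al * p + b' * q| <= G.
    move=> hp hq hb; rewrite (le_trans (ler_normD _ _))// !normrM normrN hb /G.
    have := ler_wpM2l ab0 hp; have := ler_wpM2l bb0 hq; nra.
  rewrite /g; case: l => [[] []] /=.
  - rewrite (_ : _ - 0 = - al * Z j (false, true) t + - be * Z j (false, false) t); last by ring.
    by apply: two; rewrite ?normrN.
  - rewrite (_ : _ - 0 = - al * Z j (false, false) t + be * Z j (false, true) t); last by ring.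
    exact: two.
  - by apply: (le_trans (z _)); rewrite /G; nra.
  - by apply: (le_trans (z _)); rewrite /G; nra.
have Ig l : `|Int `[0, eps * a j]%classic (g l)| <= A * ((1 + `|al| + `|be|) * c1) * (s * D).
  apply: (@le_trans _ _ (Int `[0, eps * a j]%classic (fun=> G))).
    apply: Ri_norm_le => //; first exact: L1_cst.
    by move=> t; rewrite /= in_itv/= => /andP[t0 _]; exact: gB.
  rewrite Ri_cst// subr0 /G (_ : _ * D * (eps * a j) = (eps * a j) * ((1 + `|al| + `|be|) * c1 * D)); last by ring.
  rewrite (_ : A * _ * (s * D) = (s * A) * ((1 + `|al| + `|be|) * c1 * D)); last by ring.
  by rewrite ler_wpM2r ?ler_pM ?(ltW (a0 j)) ?(ltW eps0)//; nneg.
have IS r : `|Int `[0, eps * a j]%classic (S j r)| <= (1 + A) * (s * D).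
  have LSb := L2_itvy (eps * a j) (lexx 0) (LS j r).
  apply: ge0_sqr_le; first by rewrite mulr_ge0// addr_ge0.
  have := cauchy_schwarz (measurable_itv _) LSb (AC_L2 (AC_cst 0 (eps * a j) (1 : R))).
  rewrite (@Ri_ext _ _ (fun t => S j r t * 1) (S j r)) => [|t _]; last by rewrite mulr1.
  rewrite [X in _ <= _ * X](@Ri_ext _ _ _ (fun=> 1)) => [|t _]; last by rewrite expr1n.
  rewrite Ri_cst// mul1r subr0 => /le_trans; apply.
  have h : Int `[0, eps * a j]%classic (fun t => S j r t ^+ 2) <= D ^+ 2.
    apply: le_trans (SD j); apply: (@le_trans _ _ (Int half (fun t => S j r t ^+ 2))).
      apply: Ri_le_sub => //; [exact: itv_suby|exact: L2_L1|by move=> t _; exact: sqr_ge0].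
    apply: Ri_le => //; [exact: L2_L1|exact: L1_ssqn|].
    by move=> t _; rewrite /ssqn; case: (r); rewrite ?lerDl ?lerDr sqr_ge0.
  apply: (@le_trans _ _ (D ^+ 2 * (eps * A))).
    by rewrite ler_pM// ?ler_wpM2l ?(ltW eps0)//; apply: Ri_ge0 => t _; exact: sqr_ge0.
  rewrite -sE (_ : D ^+ 2 * _ = A * (s * D) ^+ 2); last by ring.
  by rewrite [leRHS]exprMn ler_wpM2r ?sqr_ge0//; have := A0; nra.
have S1 r : L1 `[0, eps * a j]%classic (S j r).
  by apply: L2_integrable; exact: L2_itvy (LS j r).
have fin l r f : (forall t, f t = g l t - S j r t) -> `|Int `[0, eps * a j]%classic f| <= cZ * (s * D).
  move=> fE; rewrite (Ri_ext (fun t _ => fE t)) RiB//.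
  by rewrite /cZ [leRHS]mulrDl (le_trans (ler_normB _ _))// lerD.
have tr : A * ((1 + `|al| + `|be|) * c1) * (s * D) <= cZ * (s * D).
  by rewrite ler_wpM2r// /cZ lerDl addr_ge0.
case: k => [[] r].
  by apply: (fin (true, r) r) => t; rewrite /g; case: (r) => /=; ring.
exact: le_trans (Ig (false, r)) tr.
Qed.

Lemma cZ_ge0 : 0 <= cZ.
Proof. by have c10 := le_trans ler01 c1_ge1; rewrite /cZ; nneg. Qed.

(** The summand 0 is the tolerance with which the limit solution meets its own conditions, kept in
    the shape that [approx_bcB] yields. *)
Definition cW : R := cU + (0 + cp * cZ).

Lemma cW_ge0 : 0 <= cW.
Proof.
have [c31 _] := c3_ge1; have c50 := c5_ge0.
have c30 : 0 <= c3 by lra.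
rewrite /cW !addr_ge0//; last by rewrite mulr_ge0 ?cp_ge0 ?cZ_ge0.
  by rewrite mulr_ge0.
by rewrite /c4 mulr_ge0// addr_ge0// mulr_ge0// addr_ge0.
Qed.

Definition Wd j k t : R := U j k t - Z j k t.

Lemma W_approx_bc r : approx_bc (cW * (s * D)) (fun j => Wd j (false, r) (eps * a j))
  (fun j => Wd j (true, r) (eps * a j)).
Proof.
have sD : 0 <= cZ * (s * D) by rewrite mulr_ge0 ?cZ_ge0// mulr_ge0// ltW.
have h := approx_bcB (Zbc r) (approx_bc_small sD
  (fun j => Z_variation j (false, r)) (fun j => Z_variation j (true, r))).
have := approx_bcB (U_approx_bc r) h.
have -> : cU * (s * D) + (0 + cp * (cZ * (s * D))) = cW * (s * D) by rewrite /cW; ring.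
congr (approx_bc _ _ _); apply/funext => j; rewrite /Wd; ring.
Qed.

(* The value at t = eps * a j is irrelevant to the equation; setting it to 0
   makes Veps vanish on all of [eps * a j, +oo). *)
Let Veps j t : R := if t == eps * a j then 0 else Lam / eps ^+ 2 * Q j (t / eps).
Let Sw j r t : R := - (Veps j t * U j (false, r) t).

Let Veps_out j t : eps * a j <= t -> Veps j t = 0.
Proof.
rewrite /Veps le_eqVlt eq_sym => /predU1P[->|ta]; first by rewrite eqxx.
by rewrite Qa ?mulr0 ?if_same// ltr_pdivlMr// mulrC.
Qed.

(** The common source cancels in the difference; the potential term of U becomes a source supported
    on the short segment. *)
Let W_sol j : edge_sol al be (fun=> 0) (Sw j) (Wd j) /\ forall r, L2R half (Sw j r).
Proof.
have [mV A1] := edge_sol_modify (eps * a j) (measurable_Veps j) (LS j) (AU j); split.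
  move=> k x x0; apply: AC_ext (AC_B (A1 k x x0) (AZ j k x0)) => // t _.
  rewrite /Sw -/(Veps j) /Wd; move: (Veps j t) => v.
  by case: k => [[] []] /=; rewrite -?/(Veps _ _); ring.
move=> r; apply: L2_N => //; apply: (@L2_Mbdd _ _ _ _ (`|Lam / eps ^+ 2| * M)) => // t.
rewrite /= in_itv/= andbT => t0; rewrite /Veps; case: ifP => _.
  by rewrite normr0 mulr_ge0.
by rewrite normrM ler_wpM2l// QM// divr_ge0// ltW.
Qed.

Let L2_W j k : L2R half (Wd j k). Proof. exact: L2_B. Qed.

Definition cOut : R := (2 * (n%:R + m%:R) * cW) ^+ 2 * trace_cst al be 0 / be ^+ 2.

Lemma Int0 (E : set R) : measurable E -> Int E (fun=> 0) = 0.
Proof.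
move=> mE; rewrite (@Ri_ext _ _ _ (fun=> 0 * 0)) => [|t _]; last by rewrite mul0r.
by rewrite RiZ ?mul0r//; exact: integrable0.
Qed.

Lemma outer_estimate :
  \sum_j Int `[eps * a j, +oo[%classic (sqn (Wd j)) <= cOut * (s * D) ^+ 2.
Proof.
set X := \sum_j _; set tr := trace_cst al be 0.
have b0 j : 0 <= eps * a j by rewrite mulr_ge0// ltW.
have X0 : 0 <= X by apply: sumr_ge0 => j _; apply: Ri_ge0 => t _; exact: sqn_ge0.
have tr0 : 0 <= tr by exact: trace_cst_ge0.
have Sw0 j r t : eps * a j <= t -> Sw j r t = 0.
  by move=> /Veps_out E; rewrite /Sw E mul0r oppr0.
have E j : be * Int `[eps * a j, +oo[%classic (sqn (Wd j)) =
    - (Wd j (true, false) (eps * a j) * Wd j (false, true) (eps * a j)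
       - Wd j (true, true) (eps * a j) * Wd j (false, false) (eps * a j)).
  have [A1 LSw] := W_sol j.
  rewrite (edge_energy A1 (L2_W j) LSw (b0 j)) (@Ri_ext _ _ _ (fun=> 0)) ?Int0 ?sub0r// => t.
  by rewrite /= in_itv/= andbT => bt; rewrite !Sw0// !mul0r subr0.
set T := Num.sqrt (tr * X).
have T2 : T ^+ 2 = tr * X by rewrite sqr_sqrtr// mulr_ge0.
have T0 : 0 <= T by exact: sqrtr_ge0.
have WT j k : `|Wd j k (eps * a j)| <= T.
  have [A1 LSw] := W_sol j; apply: ge0_sqr_le => //; rewrite T2.
  have := edge_trace (M := 0) A1 (L2_W j) LSw (b0 j) (measurable_cst _).
  rewrite (@Ri_ext _ _ (ssqn (Sw j)) (fun=> 0)) => [|t]; last first.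
    by rewrite /= in_itv/= andbT => bt; rewrite /ssqn !Sw0// expr0n /= addr0.
  have n0 : `|0 : R| <= 0 by rewrite normr0.
  rewrite Int0// addr0 => /(_ (fun _ _ => n0)) H.
  have XX : Int `[eps * a j, +oo[%classic (sqn (Wd j)) <= X.
    rewrite /X (bigD1 j)//= lerDl; apply: sumr_ge0 => i _.
    by apply: Ri_ge0 => t _; exact: sqn_ge0.
  have := le_trans H (ler_wpM2l tr0 XX).
  have := sqr_ge0 (Wd j (false, false) (eps * a j)); have := sqr_ge0 (Wd j (true, false) (eps * a j)).
  have := sqr_ge0 (Wd j (false, true) (eps * a j)); have := sqr_ge0 (Wd j (true, true) (eps * a j)).
  by case: k => [[] []] *; lra.
set e := cW * (s * D).
have e0 : 0 <= e by rewrite mulr_ge0 ?cW_ge0// mulr_ge0// ltW.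
have iso := approx_bc_isotropic e0 T0 (W_approx_bc false) (W_approx_bc true)
  (fun j => And4 (WT j _) (WT j _) (WT j _) (WT j _)).
have EX : be * X = - \sum_j (Wd j (true, false) (eps * a j) * Wd j (false, true) (eps * a j)
       - Wd j (true, true) (eps * a j) * Wd j (false, false) (eps * a j)).
  by rewrite mulr_sumr -sumrN; apply: eq_bigr => j _; exact: E.
have := normr_le_sqr iso; rewrite -[X in X <= _]sqrrN -EX [X in _ <= X]exprMn T2 => H.
have be2 : 0 < be ^+ 2 by rewrite exprn_even_gt0.
(* [H] reads be^2 X^2 <= (2 (n + m) e)^2 tr X; one factor X is cancelled, so X = 0 is set apart. *)
have [->|Xn0] := eqVneq X 0.
  apply: mulr_ge0; last exact: sqr_ge0.
  by rewrite /cOut divr_ge0 ?(ltW be2)// mulr_ge0// sqr_ge0.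
have Xp : 0 < X by rewrite lt_neqAle eq_sym Xn0.
rewrite /cOut -/tr (_ : _ * (s * D) ^+ 2 = (2 * (n%:R + m%:R) * e) ^+ 2 * tr / be ^+ 2); last first.
  by rewrite /e !exprMn; ring.
rewrite ler_pdivlMr// -(ler_pM2r Xp); move: H; rewrite exprMn; lra.
Qed.

Definition cIn : R := 2 * (c1 + c2) ^+ 2 * A.

Lemma inside_estimate j :
  Int `[0, eps * a j]%classic (sqn (Wd j)) <= cIn * (s * D) ^+ 2.
Proof.
have b0 : 0 <= eps * a j by rewrite mulr_ge0// ltW.
have en0 : eps != 0 by rewrite lt0r_neq0.
apply: (@le_trans _ _ (Int `[0, eps * a j]%classic (fun=> 2 * ((c1 + c2) * D) ^+ 2))).
  apply: Ri_le => //; [|exact: L1_cst|].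
    by apply: (L1_itvy _ (lexx 0)); exact: L1_sqn (L2_W j).
  move=> t; rewrite /= in_itv/= => /andP[t0 tb].
  have h r : `|Wd j (false, r) t| <= (c1 + c2) * D.
    rewrite mulrDl addrC (le_trans (ler_normB _ _))// lerD ?Z_bound//.
    have := @P_bound j r (t / eps); rewrite /P [eps * _]mulrC divfK//; apply.
    by rewrite divr_ge0 ?(ltW eps0)//= ler_pdivrMr// mulrC.
  by rewrite /sqn; have := normr_le_sqr (h false); have := normr_le_sqr (h true); lra.
rewrite Ri_cst// subr0 /cIn exprMn [(s * D) ^+ 2]exprMn sE.
rewrite (_ : 2 * _ * _ = 2 * (c1 + c2) ^+ 2 * (eps * D ^+ 2) * a j); last by ring.
rewrite (_ : _ * A * _ = 2 * (c1 + c2) ^+ 2 * (eps * D ^+ 2) * A); last by ring.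
apply: ler_wpM2l => //; apply: mulr_ge0.
  by apply: mulr_ge0 => //; exact: sqr_ge0.
by apply: mulr_ge0; [exact: ltW|exact: sqr_ge0].
Qed.

Lemma convergence_estimate :
  \sum_j Int half (sqn (Wd j)) <= (n%:R * cIn + cOut) * (s * D) ^+ 2.
Proof.
have -> : \sum_j Int half (sqn (Wd j)) = \sum_j Int `[0, eps * a j]%classic (sqn (Wd j)) +
    \sum_j Int `[eps * a j, +oo[%classic (sqn (Wd j)).
  rewrite -big_split/=; apply: eq_bigr => j _; apply: Ri_caty; last exact: L1_sqn (L2_W j).
  by rewrite mulr_ge0// ltW.
rewrite [leRHS]mulrDl lerD ?outer_estimate//.
apply: (@le_trans _ _ (\sum_(j < n) (cIn * (s * D) ^+ 2))).
  by apply: ler_sum => j _; exact: inside_estimate.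
by rewrite sumr_const card_ord -[leLHS]mulr_natl mulrA.
Qed.

End Convergence.

(** * From complex-valued functions to pairs of real ones *)

Section ComplexParts.
Context {R : realType}.
Notation mu := (@lebesgue_measure R).
Notation half := (`[0, +oo[%classic : set R).
Implicit Types (z w : R[i]) (r : bool).

Definition part r z : R := if r then complex.Im z else complex.Re z.

Lemma part_inj z w : (forall r, part r z = part r w) -> z = w.
Proof. by case: z w => [x y] [x' y'] h; congr Complex; [exact: (h false)|exact: (h true)]. Qed.

Lemma part0 r : part r 0 = 0. Proof. by case: r. Qed.

Lemma partD r z w : part r (z + w) = part r z + part r w.
Proof. by case: r z w => [] [x y] [x' y']. Qed.

Lemma partB r z w : part r (z - w) = part r z - part r w.
Proof. by case: r z w => [] [x y] [x' y']. Qed.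

Lemma partZ r c z : part r (toC c * z) = c * part r z.
Proof. by case: r z => [] [x y] /=; rewrite mul0r ?subr0 ?addr0. Qed.

Lemma part_sum (I : finType) (P : pred I) r (F : I -> R[i]) :
  part r (\sum_(i | P i) F i) = \sum_(i | P i) part r (F i).
Proof. by apply: (big_morph (part r)); [exact: partD|exact: part0]. Qed.

Definition parts n (u u1 : 'I_n -> R -> R[i]) (j : 'I_n) (k : bool * bool) (t : R) : R :=
  part k.2 (if k.1 then u1 j t else u j t).

Definition source n (f : 'I_n -> R -> R[i]) (j : 'I_n) r (t : R) : R := part r (f j t).

Lemma L2_source n (f : 'I_n -> R -> R[i]) j r : L2Gamma f -> L2R half (source f j r).
Proof. by move=> /(_ j)[]; case: r. Qed.

Lemma L2sqE n (u u1 : 'I_n -> R -> R[i]) : L2sq u = \sum_j Int half (sqn (parts u u1 j)).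
Proof. by apply: eq_bigr => j _; rewrite IntE. Qed.

Lemma L2sq_source n (f : 'I_n -> R -> R[i]) : L2sq f = \sum_j Int half (ssqn (source f j)).
Proof. by apply: eq_bigr => j _; rewrite IntE. Qed.

Variables (n : nat) (V : 'I_n -> R -> R) (M b : R) (L : 'I_n -> ('I_n -> R) -> ('I_n -> R) -> R).
Variable zeta : R[i].
Hypotheses (zeta0 : complex.Im zeta != 0)
  (mV : forall j, measurable_fun half (V j))
  (VM : forall j (t : R), 0 <= t -> `|V j t| <= M)
  (Vb : forall j (t : R), b < t -> V j t = 0)
  (Llin : forall k (x x' y y' : 'I_n -> R) s,
     L k (fun j => x j + s * x' j) (fun j => y j + s * y' j) = L k x y + s * L k x' y')
  (Liso : forall x y x' y' : 'I_n -> R, (forall k, L k x y = 0) -> (forall k, L k x' y' = 0) ->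
     \sum_j (y j * x' j - y' j * x j) = 0).

(** Common form of the scaled and the limit problem. The vertex conditions [L] are real and linear,
    so they are imposed on real and imaginary parts separately. *)
Definition csolves (u f : 'I_n -> R -> R[i]) := exists u1 u2 : 'I_n -> R -> R[i],
  [/\ forall j, H2C half (u j) (u1 j) (u2 j),
      forall r k, L k (fun j => part r (u j 0)) (fun j => part r (u1 j 0)) = 0
    & forall j, {ae mu, forall x, half x -> - u2 j x + toC (V j x) * u j x - zeta * u j x = f j x}].

Let al := complex.Re zeta.
Let be := complex.Im zeta.

Lemma csolves_star u f : L2Gamma f -> csolves u f -> exists u1,
  star_sol al be V L (source f) (parts u u1).
Proof.
move=> Lf [u1 [u2 [H BC E]]]; exists u1.
have L2P j k : L2R half (parts u u1 j k).
  by have [[_ [? [? _]]] [_ [? [? _]]]] := H j; case: k => [[] []].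
split=> //; last by move=> k r; exact: BC.
move=> j k x x0; have sub : `[0, x]%classic `<=` half by exact: itv_suby.
have [A00 A10] := H2R_AC (H j).1 x0 sub; have [A01 A11] := H2R_AC (H j).2 x0 sub.
case: k => [[] r]; last by case: r.
have mu_ k : measurable_fun `[0, x]%classic (parts u u1 j k).
  by apply: measurable_funS (L2P j k).1.
have mS : measurable_fun `[0, x]%classic (source f j r).
  by apply: measurable_funS (L2_source j r Lf).1.
have mVx : measurable_fun `[0, x]%classic (V j) by apply: measurable_funS (mV j).
apply: (@AC_ae _ _ _ _ (fun t => part r (u2 j t))); first by case: (r).
- case: r mS => mS /=.
    apply: measurable_funB => //; apply: measurable_funB => //; apply: measurable_funM => //.
    exact: measurable_funB.
  apply: measurable_funB => //; apply: measurable_funD => //; apply: measurable_funM => //.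
  exact: measurable_funB.
- apply: ae_imply (E j) => t Et /sub /Et Eq; have := congr1 (part r) Eq.
  rewrite !partB partD partZ /parts /source /al /be.
  case: (zeta) (u j t) (u2 j t) => [p q] [v w] [v2 w2].
  by case: (r) => /= <-; ring.
Qed.

Lemma star_csolves f U : L2Gamma f -> star_sol al be V L (source f) U ->
  exists u, L2Gamma u /\ csolves u f.
Proof.
move=> Lf [AU LU BC].
pose mk (d : bool) j t : R[i] := Complex (U j (d, false) t) (U j (d, true) t).
(* The second derivative is defined by the equation, which then holds at every point. *)
pose W r j t : R := rhs al be (V j) (source f j) (U j ^~ t) t (true, r).
have LW r j : L2R half (W r j).
  have LS := L2_source j r Lf.
  have LV : L2R half (fun t => (V j t - al) * U j (false, r) t).
    apply: (@L2_Mbdd _ _ _ _ (M + `|al|)) => //; first exact: measurable_funB.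
    move=> t; rewrite /= in_itv/= andbT => t0; rewrite (le_trans (ler_normB _ _))// lerD// VM//.
  case: r LS LV => LS LV.
    by apply: L2_B => //; apply: L2_B => //; exact: L2_Z.
  by apply: L2_B => //; apply: L2_D => //; exact: L2_Z.
have H r j : H2R half (U j (false, r)) (U j (true, r)) (W r j).
  split; first by rewrite /= in_itv/= lexx.
  split; first exact: LU.
  split; first exact: LU.
  split; first exact: LW.
  move=> x; rewrite /= in_itv/= andbT => x0.
  have [L0 E0] := AU j (false, r) x x0; have [L1' E1] := AU j (true, r) x x0.
  by rewrite -!IntE (E0 x) ?(E1 x) ?x0 ?lexx//; split=> //; split.
exists (mk false); split; first by move=> j; split; exact: LU.
exists (mk true), (fun j t => Complex (W false j t) (W true j t)); split.
- by move=> j; split; exact: H.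
- by case=> k; exact: BC.
- move=> j; apply: aeW => t _; apply: part_inj => r.
  rewrite partB partD partZ /mk /W /= /al /be /source; case: (zeta) (f j t) => [p q] [v w].
  by case: r => /=; ring.
Qed.

Lemma csolves_exists f : L2Gamma f -> exists u, L2Gamma u /\ csolves u f.
Proof.
(* [rho] is |zeta| and [kap] the real part of the square root of -zeta, so kap^2 = (|zeta| - Re
   zeta)/2; it is positive because zeta is not real. The imaginary part is then -be/(2 kap). *)
move=> Lf; pose rho := Num.sqrt (al ^+ 2 + be ^+ 2).
have be2 : 0 < be ^+ 2 by rewrite exprn_even_gt0.
have rho2 : rho ^+ 2 = al ^+ 2 + be ^+ 2 by rewrite sqr_sqrtr// addr_ge0 ?sqr_ge0.
have rho0 : 0 <= rho by exact: sqrtr_ge0.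
have rho_al : al < rho by nra.
pose kap := Num.sqrt ((rho - al) / 2).
have kap2 : kap ^+ 2 = (rho - al) / 2 by rewrite sqr_sqrtr//; lra.
have kap0 : 0 < kap by rewrite sqrtr_gt0; lra.
have kapn : kap != 0 by rewrite lt0r_neq0.
have kapom : kap ^+ 2 - (- be / (2 * kap)) ^+ 2 = - al.
  rewrite (_ : (- be / (2 * kap)) ^+ 2 = be ^+ 2 / (4 * kap ^+ 2)); last by field.
  rewrite kap2; have ra : rho - al != 0 by rewrite lt0r_neq0// subr_gt0.
  have -> : be ^+ 2 = (rho - al) * (rho + al) by rewrite -[be ^+ 2](addrK (al ^+ 2)) [_ + al ^+ 2]addrC -rho2; ring.
  by field.
have kapbe : 2 * kap * (- be / (2 * kap)) = - be by field.
have [U] := star_exists zeta0 mV VM Vb Llin Liso kap0 kapom kapbe (fun j r => L2_source j r Lf).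
exact: star_csolves.
Qed.

Lemma csolves_bound u f : L2Gamma f -> csolves u f -> L2sq u <= (be ^+ 2)^-1 * L2sq f.
Proof.
move=> Lf /(csolves_star Lf)[u1 US]; rewrite (L2sqE u u1) L2sq_source.
by apply: (star_bound zeta0 Liso US) => j r; exact: L2_source.
Qed.

Lemma csolves_unique f u u' : L2Gamma f -> csolves u f -> csolves u' f ->
  forall j (x : R), 0 <= x -> u j x = u' j x.
Proof.
move=> Lf /(csolves_star Lf)[u1 [A1 L1 B1]] /(csolves_star Lf)[u2 [A2 L2 B2]] j x x0.
pose D j k t := parts u u1 j k t + -1 * parts u' u2 j k t.
have DS : star_sol al be V L (fun _ _ _ => 0) D.
  split=> [l|l k|k r].
  - have := edge_sol_comb (-1) (A1 l) (A2 l); congr (edge_sol _ _ _ _ _).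
    by apply/funext => r; apply/funext => t; ring.
  - by apply: L2_D => //; exact: L2_Z.
  - by rewrite /D Llin B1 B2 mulr0 addr0.
apply: part_inj => r.
by have := star_unique zeta0 mV VM Liso DS j (false, r) x0; rewrite /D /parts /=; lra.
Qed.

End ComplexParts.

(** * Kirchhoff and limit conditions as self-adjoint vertex conditions *)

Section VertexConditions.
Context {R : realType}.
Variable n : nat.
Implicit Types (x y : 'I_n -> R) (z w : 'I_n -> R[i]).

(** The edge of index 0, obtained from a given edge so that n = 0 stays allowed. *)
Definition first_ord (k : 'I_n) : 'I_n := Ordinal (leq_ltn_trans (leq0n k) (ltn_ord k)).

(** One equation per edge, as [star_exists] counts them: the first edge carries the flux condition,
    every other edge continuity with the first. *)
Definition kirchhoff (k : 'I_n) x y : R :=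
  if k == first_ord k then \sum_j y j else x k - x (first_ord k).

Lemma kirchhoffP x y : (forall k, kirchhoff k x y = 0) <->
  (forall i j, x i = x j) /\ \sum_j y j = 0.
Proof.
have FF i j : first_ord i = first_ord j by exact: val_inj.
split=> [H|[c s] k]; last by rewrite /kirchhoff; case: ifP => // _; rewrite (c _ k) subrr.
have E i : x i = x (first_ord i).
  have := H i; rewrite /kirchhoff; case: eqP => [<-//|_ /eqP]; by rewrite subr_eq0 => /eqP.
split; first by move=> i j; rewrite (E i) (E j) (FF i j).
case: (pickP (fun _ : 'I_n => true)) => [k _|no]; last by rewrite big_pred0.
by have := H (first_ord k); rewrite /kirchhoff (FF _ k) eqxx.
Qed.

Lemma kirchhoff_lin k x x' y y' s :
  kirchhoff k (fun j => x j + s * x' j) (fun j => y j + s * y' j) =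
  kirchhoff k x y + s * kirchhoff k x' y'.
Proof. by rewrite /kirchhoff; case: ifP => _; [rewrite big_split mulr_sumr|ring]. Qed.

Lemma kirchhoff_isotropic x y x' y' :
  (forall k, kirchhoff k x y = 0) -> (forall k, kirchhoff k x' y' = 0) ->
  \sum_j (y j * x' j - y' j * x j) = 0.
Proof.
move=> /kirchhoffP[c s] /kirchhoffP[c' s'].
case: (pickP (fun _ : 'I_n => true)) => [k _|no]; last by rewrite big_pred0.
rewrite (eq_bigr (fun j => y j * x' k - y' j * x k)).
  by rewrite sumrB -!mulr_suml s s' !mul0r subrr.
by move=> j _; rewrite (c j k) (c' j k).
Qed.

Lemma kirchhoff_complex z w : (forall r k, kirchhoff k (part r \o z) (part r \o w) = 0) <->
  (forall i j, z i = z j) /\ \sum_j w j = 0.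
Proof.
split=> [H|[c s] r]; last first.
  by apply/kirchhoffP; split=> [i j|]; [rewrite /= (c i j)|rewrite -part_sum s part0].
have {}H r := (kirchhoffP _ _).1 (H r).
split=> [i j|]; apply: part_inj => r; have [c s] := H r; first exact: c.
by rewrite part_sum part0.
Qed.

Variables (m : nat) (a : 'I_n -> R) (Q : 'I_n -> R -> R) (lam1 : R)
  (psi : 'I_m -> 'I_n -> R -> R) (sigma : 'I_m -> 'I_n).
Hypotheses (sigma_inj : injective sigma)
  (norm : forall i k, psi i (sigma k) (a (sigma k)) = (i == k)%:R).

Let theta_sigma i k : theta a psi i (sigma k) = (i == k)%:R.
Proof. exact: norm. Qed.

Definition limit_value (j : 'I_n) x : R := x j - \sum_i theta a psi i j * x (sigma i).
Definition limit_flux (i : 'I_m) x y : R :=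
  y (sigma i) + \sum_(j | j \notin codom sigma) theta a psi i j * y j
  - lam1 * \sum_k qcoef a Q psi i k * x (sigma k).
(** One equation per edge again: edges in the image of [sigma] carry the flux conditions, the others
    the value conditions. *)
Definition limit_bc (k : 'I_n) x y : R :=
  if [pick i | sigma i == k] is Some i then limit_flux i x y else limit_value k x.

Lemma limit_bcP x y : (forall k, limit_bc k x y = 0) <->
  (forall j, j \notin codom sigma -> limit_value j x = 0) /\ forall i, limit_flux i x y = 0.
Proof.
split=> [H|[hv hf] k]; last first.
  rewrite /limit_bc; case: pickP => [i _|no]; first exact: hf.
  by apply: hv; apply/negP => /codomP[i ki]; have := no i; rewrite ki eqxx.
split=> [j jn|i].
  have := H j; rewrite /limit_bc; case: pickP => // i /eqP ij.
  by rewrite -ij codom_f in jn.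
by have := H (sigma i); rewrite /limit_bc; case: pickP => [k /eqP/sigma_inj->//|/(_ i)]; rewrite eqxx.
Qed.

Lemma limit_bc_lin k x x' y y' s :
  limit_bc k (fun j => x j + s * x' j) (fun j => y j + s * y' j) =
  limit_bc k x y + s * limit_bc k x' y'.
Proof.
have S (I : finType) (P : pred I) (c v v' : I -> R) :
    \sum_(i | P i) c i * (v i + s * v' i) =
    \sum_(i | P i) c i * v i + s * \sum_(i | P i) c i * v' i.
  by rewrite mulr_sumr -big_split/=; apply: eq_bigr => i _; ring.
by rewrite /limit_bc; case: pickP => [i _|_]; rewrite /limit_flux /limit_value !S; ring.
Qed.

Lemma limit_bc_approx x y : (forall k, limit_bc k x y = 0) -> approx_bc a Q lam1 psi sigma 0 x y.
Proof.
move=> /limit_bcP[hv hf].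
split=> [j|i]; rewrite normr_le0.
  have [/codomP[k ->]|jn] := boolP (j \in codom sigma); last by rewrite -/(limit_value j x) hv.
  rewrite (bigD1 k)//= [th _ _ _ _]theta_sigma eqxx mul1r big1 ?addr0 ?subrr// => i ik.
  by rewrite [th _ _ _ _]theta_sigma (negPf ik) mul0r.
apply/eqP; rewrite -[RHS](hf i) /limit_flux; congr (_ - _).
  rewrite (bigID (mem (codom sigma)))/=; congr (_ + _).
  rewrite -big_filter.
  rewrite (perm_big (codom sigma)); last first.
    apply: uniq_perm; rewrite ?filter_uniq ?index_enum_uniq ?(map_inj_uniq sigma_inj) ?enum_uniq//.
    by move=> j; rewrite mem_filter mem_index_enum andbT.
  rewrite big_map big_enum/= (bigD1 i)//= [th _ _ _ _]theta_sigma eqxx mul1r big1 ?addr0// => k ki.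
  by rewrite [th _ _ _ _]theta_sigma eq_sym (negPf ki) mul0r.
congr (_ * _); apply: eq_bigr => k _; congr (_ * _).
by apply: eq_bigr => j _; rewrite IntE.
Qed.

(** The case e = 0 of [approx_bc_isotropic], with any common bound T. *)
Lemma limit_bc_isotropic x y x' y' :
  (forall k, limit_bc k x y = 0) -> (forall k, limit_bc k x' y' = 0) ->
  \sum_j (y j * x' j - y' j * x j) = 0.
Proof.
move=> /limit_bc_approx h /limit_bc_approx h'.
pose T := \sum_j (`|x j| + `|y j| + `|x' j| + `|y' j|).
have T0 : 0 <= T by apply: sumr_ge0 => j _; rewrite !addr_ge0.
have B j : [/\ `|x j| <= T, `|y j| <= T, `|x' j| <= T & `|y' j| <= T].
  have : `|x j| + `|y j| + `|x' j| + `|y' j| <= T.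
    by rewrite /T (bigD1 j)//= lerDl; apply: sumr_ge0 => i _; rewrite !addr_ge0.
  have := normr_ge0 (x j); have := normr_ge0 (y j); have := normr_ge0 (x' j).
  have := normr_ge0 (y' j); split; lra.
have := approx_bc_isotropic (lexx 0) T0 h h' B.
by rewrite mulr0 mul0r normr_le0 => /eqP.
Qed.

Lemma limit_bc_complex z w : (forall r k, limit_bc k (part r \o z) (part r \o w) = 0) <->
  (forall j, j \notin codom sigma -> z j - \sum_i toC (theta a psi i j) * z (sigma i) = 0) /\
  (forall i, w (sigma i) + \sum_(j | j \notin codom sigma) toC (theta a psi i j) * w j
     - toC lam1 * \sum_k toC (qcoef a Q psi i k) * z (sigma k) = 0).
Proof.
have Ev r j : part r (z j - \sum_i toC (theta a psi i j) * z (sigma i)) =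
    limit_value j (part r \o z).
  by rewrite partB part_sum; congr (_ - _); apply: eq_bigr => i _; rewrite partZ.
have Ef r i : part r (w (sigma i) + \sum_(j | j \notin codom sigma) toC (theta a psi i j) * w j
     - toC lam1 * \sum_k toC (qcoef a Q psi i k) * z (sigma k)) =
    limit_flux i (part r \o z) (part r \o w).
  rewrite partB partD partZ !part_sum; congr (_ + _ - _ * _).
    by apply: eq_bigr => j _; rewrite partZ.
  by apply: eq_bigr => k _; rewrite partZ.
split=> [H|[hv hf] r].
  split=> [j jn|i]; apply: part_inj => r; rewrite ?Ev ?Ef part0;
    have [hv hf] := (limit_bcP _ _).1 (H r); [exact: hv|exact: hf].
by apply/limit_bcP; split=> [j jn|i]; rewrite -?Ev -?Ef ?hv ?hf ?part0.
Qed.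

End VertexConditions.

(** * The two operators, and the resolvent estimate for all eps *)

Section ScaledPotential.
Context {R : realType}.
Variables (n m : nat) (a : 'I_n -> R) (Q : 'I_n -> R -> R) (lamf : R -> R) (lam1 : R).
Variables (psi : 'I_m -> 'I_n -> R -> R) (sigma : 'I_m -> 'I_n) (zeta : R[i]).

Definition scaled_potential (eps : R) (j : 'I_n) (t : R) : R := lamf eps / eps ^+ 2 * Q j (t / eps).

Lemma Heps_csolves eps u f : Heps_solves Q lamf eps zeta u f <->
  csolves (scaled_potential eps) (@kirchhoff R n) zeta u f.
Proof.
split=> [[u1 [u2 [H [c [s E]]]]]|[u1 [u2 [H BC E]]]]; exists u1, u2.
  by split=> //; apply/(kirchhoff_complex (fun j => u j 0) (fun j => u1 j 0)).
have [c s] := (kirchhoff_complex (fun j => u j 0) (fun j => u1 j 0)).1 BC.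
by split.
Qed.

Hypotheses (sigma_inj : injective sigma).

Lemma H_csolves u f : H_solves a Q lam1 psi sigma zeta u f <->
  csolves (fun _ _ => 0) (limit_bc a Q lam1 psi sigma) zeta u f.
Proof.
have P w := limit_bc_complex a Q lam1 psi sigma_inj (fun j => u j 0) w.
have E0 (z w : R[i]) : z + toC 0 * w = z by rewrite mul0r addr0.
split=> [[u1 [u2 [H [c [s E]]]]]|[u1 [u2 [H BC E]]]]; exists u1, u2.
  split=> //; first by apply/(P (fun j => u1 j 0)).
  by move=> j; apply: ae_imply (E j) => t; rewrite E0.
have [c s] := (P (fun j => u1 j 0)).1 BC.
by do 3?split=> //; move=> j; apply: ae_imply (E j) => t; rewrite E0.
Qed.

Lemma L2sq_ge0 (u : 'I_n -> R -> R[i]) : 0 <= L2sq u.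
Proof.
rewrite (L2sqE u u); apply: sumr_ge0 => j _; apply: Ri_ge0 => t _; exact: sqn_ge0.
Qed.

Hypotheses (a0 : forall j, 0 < a j) (Qok : potential_ok a Q) (lok : coupling_ok lamf lam1)
  (sol : forall i, solR a Q (psi i))
  (norm : forall i k, psi i (sigma k) (a (sigma k)) = (i == k)%:R)
  (span : forall phi, solR a Q phi -> exists c : 'I_m -> R,
     forall j x, 0 <= x <= a j -> phi j x = \sum_(i < m) c i * psi i j x)
  (zeta0 : complex.Im zeta != 0).

Let A := \sum_j a j.
Let aA j : a j <= A.
Proof. by rewrite /A (bigD1 j)//= lerDl sumr_ge0// => i _; exact: ltW. Qed.
Let A0 : 0 <= A. Proof. by apply: sumr_ge0 => i _; exact: ltW. Qed.

(** The bound [M] degenerates as eps tends to 0; it serves the existence of the resolvent and never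
    enters the final constant. *)
Lemma Heps_regular eps : 0 < eps -> exists2 M,
  (forall j, measurable_fun (`[0, +oo[%classic : set R) (scaled_potential eps j)) &
  (forall j (t : R), 0 <= t -> `|scaled_potential eps j t| <= M) /\
  (forall j (t : R), eps * A < t -> scaled_potential eps j t = 0).
Proof.
move=> e0; have [mQ [[M QM] Qa]] := Qok; exists (`|lamf eps / eps ^+ 2| * M).
  by move=> j; exact: measurable_Veps.
split=> j t t0; rewrite /scaled_potential.
  by rewrite normrM ler_wpM2l// QM// divr_ge0// ltW.
by rewrite Qa ?mulr0// ltr_pdivlMr// mulrC (le_lt_trans _ t0)// ler_pM2l.
Qed.

Let m0 (j : 'I_n) : measurable_fun (`[0, +oo[%classic : set R) (fun=> 0 : R).
Proof. exact: measurable_cst. Qed.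

Lemma near_estimate : exists delta C, [/\ 0 < delta, 0 <= C & forall eps, 0 < eps <= 1 -> eps < delta ->
  forall f u v, L2Gamma f -> Heps_solves Q lamf eps zeta u f ->
  H_solves a Q lam1 psi sigma zeta v f ->
  L2sq (fun j x => u j x - v j x) <= C * (eps * L2sq f)].
Proof.
(* The given bound has no sign when there are no edges; its absolute value is a bound in every case.
   The same is done for [K]. *)
have [mQ [[M' QM'] Qa]] := Qok; pose M := `|M'|.
have QM j (t : R) : 0 <= t -> `|Q j t| <= M.
  by move=> t0; rewrite (le_trans (QM' j t t0))// ler_norm.
have [_ [K' [delta [d0 lamE]]]] := lok; pose K := `|K'|.
have psi1_ex i := cid (solR_zero_mode a0 mQ QM (sol i)).
pose psi1 i := sval (psi1_ex i).
have Zpsi i : zero_mode a Q (psi i) (psi1 i) := svalP (psi1_ex i).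
pose B i j := `|psi i j 0| + Int `[0, a j]%classic (fun t => `|psi1 i j t|).
have B0 i j : 0 <= B i j by rewrite addr_ge0// Ri_ge0.
pose Bp := \sum_i \sum_j B i j.
have Bp0 : 0 <= Bp by do 2!apply: sumr_ge0 => ? _.
have psiB i j (x : R) : 0 <= x <= a j -> `|psi i j x| <= Bp.
  move=> xa; have [Ap _ _ _ _] := Zpsi i; apply: (le_trans (AC_bdd (Ap j) xa)).
  rewrite /Bp (bigD1 i)//= (bigD1 j)//= -/(B i j) -addrA lerDl addr_ge0//.
    by apply: sumr_ge0.
  by do 2!apply: sumr_ge0 => ? _.
have [Cin Cin0 inner] := inner_estimate a0 mQ QM sol norm span.
pose al := complex.Re zeta; pose be := complex.Im zeta.
exists delta, (n%:R * cIn al be M lam1 K A + cOut al be a Q M lam1 K A Bp Cin psi); split=> //.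
  apply: addr_ge0.
    apply: mulr_ge0 => //; apply: mulr_ge0 => //; apply: mulr_ge0 => //; exact: sqr_ge0.
  apply: divr_ge0; last exact: sqr_ge0.
  by apply: mulr_ge0; [exact: sqr_ge0|exact: trace_cst_ge0].
move=> eps /andP[e0 e1] ed f u v Lf /Heps_csolves Hu /H_csolves Hv.
have [Me mV [VM Vb]] := Heps_regular e0.
have bu := csolves_bound zeta0 mV (@kirchhoff_isotropic _ _) Lf Hu.
have bv := csolves_bound zeta0 m0 (limit_bc_isotropic sigma_inj norm) Lf Hv.
have [u1 [AU LU BU]] := csolves_star mV Lf Hu.
have [v1 [AZ LZ BZ]] := csolves_star m0 Lf Hv.
set U := parts u u1 in AU LU BU; set Z := parts v v1 in AZ LZ BZ.
have -> : L2sq (fun j x => u j x - v j x) =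
    \sum_j Int (`[0, +oo[%classic : set R) (sqn (Wd U Z j)).
  rewrite L2sq_source; apply: eq_bigr => j _; apply: Ri_ext => t _.
  by rewrite /ssqn /source !partB.
pose D := Num.sqrt (L2sq f); pose s := Num.sqrt eps.
have D2 : D ^+ 2 = L2sq f by rewrite sqr_sqrtr// L2sq_ge0.
have sE : s ^+ 2 = eps by rewrite sqr_sqrtr// ltW.
have term (F : 'I_n -> R) j : (forall i, 0 <= F i) -> F j <= \sum_i F i.
  by move=> F0; rewrite (bigD1 j)//= lerDl sumr_ge0.
rewrite -D2 -[in X in _ <= X]sE -exprMn.
apply: (convergence_estimate a0 aA mQ (normr_ge0 M') A0 (normr_ge0 K') Bp0 Cin0 QM Qa Zpsi psiB
  inner e0 e1 _ sE (sqrtr_ge0 _) _ _ _ AU LU _ _ _ AZ LZ) => //.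
- by rewrite sqrtr_gt0.
- have := lamE eps; rewrite gtr0_norm// => /(_ ed) /le_trans; apply.
  by rewrite ler_wpM2r ?sqr_ge0// ler_norm.
- by move=> j r; exact: L2_source.
- move=> j; rewrite D2 L2sq_source; apply: (term (fun i => Int _ (ssqn (source f i)))) => i.
  by apply: Ri_ge0 => t _; rewrite /ssqn addr_ge0 ?sqr_ge0.
- move=> j; rewrite D2; apply: le_trans bu; rewrite (L2sqE u u1).
  by apply: (term (fun i => Int _ (sqn (parts u u1 i)))) => i; apply: Ri_ge0 => t _; exact: sqn_ge0.
- by move=> r; have [c _] := (kirchhoffP _ _).1 (BU^~ r).
- by move=> r; have [_ c] := (kirchhoffP _ _).1 (BU^~ r).
- move=> j; rewrite D2; apply: le_trans bv; rewrite (L2sqE v v1).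
  by apply: (term (fun i => Int _ (sqn (parts v v1 i)))) => i; apply: Ri_ge0 => t _; exact: sqn_ge0.
- by move=> r; apply: limit_bc_approx => // k; exact: BZ.
Qed.

Lemma L2sqB (u v : 'I_n -> R -> R[i]) : L2Gamma u -> L2Gamma v ->
  L2sq (fun j x => u j x - v j x) <= 2 * (L2sq u + L2sq v).
Proof.
move=> Lu Lv; rewrite !L2sq_source -big_split/= mulr_sumr; apply: ler_sum => j _.
have Lu1 : L1 (`[0, +oo[%classic : set R) (ssqn (source u j)).
  by apply: L1_ssqn => r; exact: L2_source.
have Lv1 : L1 (`[0, +oo[%classic : set R) (ssqn (source v j)).
  by apply: L1_ssqn => r; exact: L2_source.
rewrite -RiD// -RiZ//; last exact: L1D.
apply: Ri_le => //.
- by apply: L1_ssqn => r; apply: L2_ext (L2_B _ (L2_source j r Lu) (L2_source j r Lv)) => // t _; rewrite /source partB.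
- by apply: L1Z => //; exact: L1D.
- move=> t _; rewrite /ssqn /source !partB.
  have := sqr_ge0 (part false (u j t) + part false (v j t)).
  by have := sqr_ge0 (part true (u j t) + part true (v j t)); nra.
Qed.

(** For eps >= delta the two a priori bounds give a squared difference of at most 4 L2sq f / be^2,
    and 1 <= eps / delta supplies the missing factor; this is the origin of [C']. *)
Lemma resolvent_estimate : exists C : R, forall eps, 0 < eps <= 1 ->
  forall f u v, L2Gamma f -> Heps_solves Q lamf eps zeta u f ->
  H_solves a Q lam1 psi sigma zeta v f ->
  L2norm (fun j x => u j x - v j x) <= C * Num.sqrt eps * L2norm f.
Proof.
have [delta [C [d0 C0 near]]] := near_estimate.
pose be := complex.Im zeta.
have be2 : 0 < be ^+ 2 by rewrite exprn_even_gt0.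
pose C' := 4 * (be ^+ 2)^-1 / delta.
have C'0 : 0 <= C' by rewrite divr_ge0 ?mulr_ge0 ?invr_ge0 ?ltW.
exists (Num.sqrt (C + C')) => eps e01 f u v Lf Hu Hv; have /andP[e0 e1] := e01.
have f0 := L2sq_ge0 f.
have ef : 0 <= eps * L2sq f by apply: mulr_ge0 => //; exact: ltW.
rewrite /L2norm -mulrA -!sqrtrM ?addr_ge0 ?(ltW e0)//; apply: ler_wsqrtr.
have [ed|ed] := ltP eps delta.
  by apply: (le_trans (near eps e01 ed f u v Lf Hu Hv)); rewrite ler_wpM2r// lerDl.
have [Me mV [VM Vb]] := Heps_regular e0.
have bu := csolves_bound zeta0 mV (@kirchhoff_isotropic _ _) Lf ((Heps_csolves _ _ _).1 Hu).
have bv := csolves_bound zeta0 m0 (limit_bc_isotropic sigma_inj norm) Lf ((H_csolves _ _).1 Hv).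
have Lu : L2Gamma u.
  by case: Hu => [u1 [u2 [H _]]] j; split; [have [_ []] := (H j).1|have [_ []] := (H j).2].
have Lv : L2Gamma v.
  by case: Hv => [u1 [u2 [H _]]] j; split; [have [_ []] := (H j).1|have [_ []] := (H j).2].
apply: (le_trans (L2sqB Lu Lv)).
apply: (@le_trans _ _ (4 * (be ^+ 2)^-1 * L2sq f)).
  by move: bu bv; rewrite -/be; lra.
apply: (@le_trans _ _ (C' * (eps * L2sq f))); last by rewrite ler_wpM2r// lerDr.
rewrite /C' mulrA ler_wpM2r// -mulrA ler_peMr ?mulr_ge0 ?invr_ge0 ?(ltW be2)//.
by rewrite mulrC ler_pdivlMr// mul1r.
Qed.

End ScaledPotential.

Theorem theorem1 (R : realType) (n m : nat) (a : 'I_n -> R)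
  (Q : 'I_n -> R -> R) (lamf : R -> R) (lam1 : R)
  (psi : 'I_m -> 'I_n -> R -> R) (sigma : 'I_m -> 'I_n) :
  (forall j, 0 < a j) ->
  potential_ok a Q ->
  coupling_ok lamf lam1 ->
  (* psi_1..psi_m : real solutions of (R), normalized psi_i(a_{sigma k}) = delta_ik *)
  injective sigma ->
  (forall i, solR a Q (psi i)) ->
  (forall i k, psi i (sigma k) (a (sigma k)) = (i == k)%:R) ->
  (* they span the solution space of (R): (R) has exactly m independent solutions *)
  (forall phi, solR a Q phi -> exists c : 'I_m -> R,
     forall j x, 0 <= x <= a j -> phi j x = \sum_(i < m) c i * psi i j x) ->
  forall zeta : R[i], complex.Im zeta != 0 ->
    (* the resolvents exist: unique solvability in the operator domains *)
    (forall f, L2Gamma f ->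
       (exists v, L2Gamma v /\ H_solves a Q lam1 psi sigma zeta v f) /\
       (forall v v', H_solves a Q lam1 psi sigma zeta v f ->
                     H_solves a Q lam1 psi sigma zeta v' f ->
                     forall j x, 0 <= x -> v j x = v' j x)) /\
    (forall eps, 0 < eps <= 1 -> forall f, L2Gamma f ->
       (exists u, L2Gamma u /\ Heps_solves Q lamf eps zeta u f) /\
       (forall u u', Heps_solves Q lamf eps zeta u f ->
                     Heps_solves Q lamf eps zeta u' f ->
                     forall j x, 0 <= x -> u j x = u' j x)) /\
    (* norm-resolvent estimate *)
    (exists C : R, forall eps, 0 < eps <= 1 ->
       forall f u v, L2Gamma f ->
         Heps_solves Q lamf eps zeta u f ->
         H_solves a Q lam1 psi sigma zeta v f ->
         L2norm (fun j x => u j x - v j x) <= C * Num.sqrt eps * L2norm f).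
Proof.
move=> a0 Qok lok sigma_inj sol norm span zeta zeta0.
pose m0 (j : 'I_n) := @measurable_cst _ _ R R (`[0, +oo[%classic) (0 : R).
have z0 (j : 'I_n) (t : R) : 0 <= t -> `|0 : R| <= 0 by rewrite normr0.
have b0 (j : 'I_n) (t : R) : 0 < t -> 0 = 0 :> R by [].
have lin := @limit_bc_lin R n m a Q lam1 psi sigma.
have iso := @limit_bc_isotropic R n m a Q lam1 psi sigma sigma_inj norm.
have HC := @H_csolves R n m a Q lam1 psi sigma zeta sigma_inj.
have linK := @kirchhoff_lin R n; have isoK := @kirchhoff_isotropic R n.
split; [|split].
- move=> f Lf; split.
    have [v [Lv Hv]] := csolves_exists zeta0 m0 z0 b0 lin iso Lf.
    by exists v; split=> //; apply/HC.
  by move=> v v' /HC Hv /HC Hv'; exact: (csolves_unique zeta0 m0 z0 lin iso Lf Hv Hv').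
- move=> eps /andP[e0 _] f Lf; have [M mV [VM Vb]] := Heps_regular lamf a0 Qok e0.
  split.
    have [u [Lu Hu]] := csolves_exists zeta0 mV VM Vb linK isoK Lf.
    by exists u; split=> //; apply/Heps_csolves.
  by move=> u u' /Heps_csolves Hu /Heps_csolves Hu'; exact: (csolves_unique zeta0 mV VM linK isoK Lf Hu Hu').
- exact: resolvent_estimate.
Qed.
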